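(* Let $-\infty<\omega_*<\omega^*<+\infty$ and let $M_0\in H^1((\omega_*,\omega^* ),\mathbb{S}^2)$. There exist $(t_n)_{n\in\mathbb{N}}\in[0,+\infty)^{\mathbb{N}}$ and $(u_n)_{n\in\mathbb{N}},(v_n)_{n\in\mathbb{N}}\in L^\infty_{loc}([0,+\infty),\mathbb{R})^{\mathbb{N}}$ such that $$U[t_n;u_n,v_n,M_0]\to e_3\quad\text{weakly in } H^1((\omega_*,\omega^* ),\mathbb{R}^3)\ \text{ as } n\to+\infty .$$
   Context: $\mathbb{S}^2$ is the unit sphere of $\mathbb{R}^3$, $e_3=(0,0,1)^t$ (also identified with a constant function), and $$\Omega_x=\begin{pmatrix}0&0&0\\0&0&-1\\0&1&0\end{pmatrix},\quad \Omega_y=\begin{pmatrix}0&0&1\\0&0&0\\-1&0&0\end{pmatrix},\quad \Omega_z=\begin{pmatrix}0&-1&0\\1&0&0\\0&0&0\end{pmatrix}.$$ $H^1((\omega_*,\omega^* ),\mathbb{S}^2):=\{M\in H^1((\omega_*,\omega^* ),\mathbb{R}^3):\ M(\omega)\in\mathbb{S}^2\ \forall\omega\}$. $U[t;u,v,M_0]$ denotes the value at time $t$, a function of $\omega\in(\omega_*,\omega^* )$, of the solution of the Bloch equation $$\frac{\partial M}{\partial t}(t,\omega)=(\omega\Omega_z+u(t)\Omega_x+v(t)\Omega_y)M(t,\omega),\quad (t,\omega)\in[0,+\infty)\times(\omega_*,\omega^* ),$$ with initial condition $M_0$ at time $0$. *)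

(* Defs.v *)
From HB Require Import structures.
From mathcomp Require Import all_boot all_order all_algebra.
From mathcomp Require Import all_classical all_reals all_analysis.
Set Implicit Arguments.
Unset Strict Implicit.
Unset Printing Implicit Defensive.
Import Order.TTheory GRing.Theory Num.Theory.
Import numFieldNormedType.Exports.
Local Open Scope classical_set_scope.
Local Open Scope ring_scope.

Section Bloch.
Context {R : realType}.
Local Notation mu := (@lebesgue_measure R).
Local Notation vec3 := 'cV[R]_3.

Definition mx3 (s : seq (seq R)) : 'M[R]_3 :=
  \matrix_(i, j) nth 0 (nth [::] s i) j.

Definition Omega_x : 'M[R]_3 :=
  mx3 [:: [:: 0; 0; 0]; [:: 0; 0; -1]; [:: 0; 1; 0]].
Definition Omega_y : 'M[R]_3 :=
  mx3 [:: [:: 0; 0; 1]; [:: 0; 0; 0]; [:: -1; 0; 0]].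
Definition Omega_z : 'M[R]_3 :=
  mx3 [:: [:: 0; -1; 0]; [:: 1; 0; 0]; [:: 0; 0; 0]].

Definition e3 : vec3 := \col_i nth 0 [:: 0; 0; 1] i.

(* The library's norm on matrices is the sup norm, hence the explicit
   Euclidean norm. *)
Definition S2 : set vec3 := [set x | \sum_i x i 0 ^+ 2 = 1].

(* Elements of L^2(]a, b[), H^1(]a, b[) are represented by total functions on
   R of which only the values on ]a, b[ matter: [f \_ D] is [f] extended by 0
   outside [D]. *)
Definition L2 (a b : R) (f : R -> R) : Prop :=
  f \_ `]a, b[ \in Lfun mu 2%:E.

Definition Linfty_loc (u : R -> R) : Prop :=
  forall T : R, 0 <= T -> u \_ `[0, T] \in Lfun mu +oo%E.

Definition test_function (a b : R) (phi : R -> R) : Prop :=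
  [/\ forall (n : nat) (x : R), derivable (derive1n n phi) x 1,
      compact (closure [set x | phi x != 0]) &
      closure [set x | phi x != 0] `<=` `]a, b[ ].

Definition weak_derivative (a b : R) (f g : R -> R) : Prop :=
  forall phi : R -> R, test_function a b phi ->
    \int[mu]_(x in `]a, b[) (f x * derive1 phi x)
    = - \int[mu]_(x in `]a, b[) (g x * phi x).

(* [F] is in H^1(]a, b[, R^3) and [G] is (a representative of) its weak
   derivative. *)
Definition H1_with (a b : R) (F G : R -> vec3) : Prop :=
  forall i : 'I_3,
    [/\ L2 a b (fun x => F x i 0), L2 a b (fun x => G x i 0) &
        weak_derivative a b (fun x => F x i 0) (fun x => G x i 0)].

Definition H1 (a b : R) (F : R -> vec3) : Prop :=
  exists G : R -> vec3, H1_with a b F G.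

(* When [H1_with a b F G], this is the H^1 norm of [F]. *)
Definition H1_norm (a b : R) (F G : R -> vec3) : R :=
  Num.sqrt (\sum_i (\int[mu]_(x in `]a, b[) (F x i 0 ^+ 2)
                    + \int[mu]_(x in `]a, b[) (G x i 0 ^+ 2))).

(* Continuous linear forms on H^1. Boundedness makes [l] take the same value
   on functions that agree a.e. on ]a, b[. *)
Definition H1_dual (a b : R) (l : (R -> vec3) -> R) : Prop :=
  (forall (c : R) (F G : R -> vec3), H1 a b F -> H1 a b G ->
     l (c *: F + G) = c * l F + l G)
  /\ (exists C : R, forall F G : R -> vec3, H1_with a b F G ->
        `|l F| <= C * H1_norm a b F G).

Definition weakly_cvg_H1 (a b : R) (F : nat -> R -> vec3) (G : R -> vec3)
    : Prop :=
  [/\ forall n, H1 a b (F n),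
      H1 a b G &
      forall l, H1_dual a b l -> l (F n) @[n --> \oo] --> l G].

Definition H1_S2 (a b : R) (F : R -> vec3) : Prop :=
  H1 a b F /\ (forall w, w \in `]a, b[ -> S2 (F w)).

Definition bloch_rhs (w p q : R) (X : vec3) : vec3 :=
  (w *: Omega_z + p *: Omega_x + q *: Omega_y) *m X.

(* [M t w] is U[t; u, v, M0] at frequency [w]. The controls being merely
   L^oo_loc, the Cauchy problem is understood in the sense of Caratheodory,
   i.e. in integral form, for each frequency. Its solution exists and is
   unique on [0, +oo[ x ]a, b[. *)
Definition bloch_solution (a b : R) (u v : R -> R) (M0 : R -> vec3)
    (M : R -> R -> vec3) : Prop :=
  forall w t : R, w \in `]a, b[ -> 0 <= t -> forall i : 'I_3,
    mu.-integrable `[0, t]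
      (EFin \o (fun s => bloch_rhs w (u s) (v s) (M s w) i 0))
    /\ M t w i 0 = M0 w i 0
         + \int[mu]_(s in `[0, t]) bloch_rhs w (u s) (v s) (M s w) i 0.

End Bloch.

(* Main.v *)
Require Import Defs.
From HB Require Import structures.
From mathcomp Require Import all_boot all_order all_algebra.
From mathcomp Require Import all_classical all_reals all_analysis measurable_realfun ess_sup_inf.
From mathcomp Require Import ring lra.
Set Implicit Arguments.
Unset Strict Implicit.
Unset Printing Implicit Defensive.
Import Order.TTheory GRing.Theory Num.Theory.
Import numFieldNormedType.Exports.
Local Open Scope classical_set_scope.
Local Open Scope ring_scope.

(** The convergence obtained is strong in H1; weak convergence follows because a
bounded linear form is continuous ([H1_norm_cvg_weakly]).

Attainable propagators. Piecewise constant controls propagate a state by a matrix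
that is a C1 function of the frequency [w]; [attainable] is the closure of these
matrix functions in C1([a, b]), which is stable under products. It contains the
constant rotations about the first two axes, by short and strong pulses that leave
no time for the drift ([attainable_strong]), hence all constant rotations. Half
turns before and after the drift reverse it, so the precessions of angle
[t w + phi] about the third axis are attainable for [t] of both signs
([attainable_drift]). Conjugating a small rotation about the first axis by two
opposite precessions yields the infinitesimal rotation of angle proportional to
[cos (t w + phi)], and Lie's product formula makes the finite rotations of this
angle attainable ([attainable_exp], [admissible_cos]). Angles about one axis add
up, and they pass to limits in C1; since derivatives in [t] of [cos (t w + phi)]
produce powers of [w], all polynomials in [w] are attainable angles, about either
of the first two axes ([attainable_horner_x], [attainable_horner_y]).

Steering. Polynomials are dense in H1, so a state can be rotated, up to a small
error in H1, by an angle that is any H1 function of [w] ([steer_rotation]). The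
initial state has a representative that is continuous on [[a, b]] and takes its
values in the sphere ([H1_S2_representative], from du Bois-Reymond's lemma). Where
its third coordinate is bounded away from 0, two arctangents give H1 angles that
rotate it to the pole [e3]. The interval is cut into short cells, which are treated
from left to right: the angles used in a cell are frozen outside of it, so that the
cells on the left remain at the pole, while the part on the right undergoes a
constant rotation. The scalar products of its states are thus those of the initial
states, so that by continuity the third coordinate is bounded away from 0 on the
next cell, which starts at the pole ([steer_cell], [steer_e3]).

Piecewise constant controls realize the propagators by Rodrigues' formula
([realization]), and states that agree almost everywhere with the continuous
representative have the same limits ([reach_weakly]). *)

(** * Square integrable functions *)

Section SquareIntegrable.
Context {R : realType}.
Local Notation mu := (@lebesgue_measure R).
Implicit Types (D E : set (measurableTypeR R)) (f g h c : R -> R).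

Definition sqint D g :=
  measurable_fun D g /\ mu.-integrable D (EFin \o (fun x => g x ^+ 2)).

Definition n2 D g : R := \int[mu]_(x in D) (g x ^+ 2).

Lemma n2_ge0 D g : 0 <= n2 D g.
Proof. by apply: Rintegral_ge0 => x _; rewrite sqr_ge0. Qed.

Lemma eq_n2 D g h : {in D, g =1 h} -> n2 D g = n2 D h.
Proof. by move=> gh; apply: eq_Rintegral => x xD; rewrite gh. Qed.

Lemma le_integrableR D f g : measurable D -> measurable_fun D f ->
  (forall x, D x -> `|f x| <= g x) ->
  mu.-integrable D (EFin \o g) -> mu.-integrable D (EFin \o f).
Proof.
move=> mD mf fg; apply: le_integrable => //; first exact/measurable_EFinP.
move=> x Dx /=; rewrite lee_fin; apply: (le_trans (fg _ Dx)).
exact: ler_norm.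
Qed.

Lemma integrableDR D f g : measurable D -> mu.-integrable D (EFin \o f) ->
  mu.-integrable D (EFin \o g) -> mu.-integrable D (EFin \o (fun x => f x + g x)).
Proof. by move=> mD fi gi; have := integrableD mD fi gi. Qed.

Lemma integrableBR D f g : measurable D -> mu.-integrable D (EFin \o f) ->
  mu.-integrable D (EFin \o g) -> mu.-integrable D (EFin \o (fun x => f x - g x)).
Proof. by move=> mD fi gi; have := integrableB mD fi gi. Qed.

Lemma integrableZR D f (k : R) : measurable D -> mu.-integrable D (EFin \o f) ->
  mu.-integrable D (EFin \o (fun x => k * f x)).
Proof. by move=> mD fi; have := integrableZl mD k fi. Qed.

Lemma integrableR_cst D (k : R) : measurable D -> (mu D < +oo)%E ->
  mu.-integrable D (EFin \o (fun=> k)).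
Proof.
move=> mD fD; apply: measurable_bounded_integrable => //.
exact: bounded_cst.
Qed.

Lemma sqintD D g h : measurable D -> sqint D g -> sqint D h ->
  sqint D (fun x => g x + h x).
Proof.
move=> mD [mg ig] [mh ih]; split; first exact: measurable_funD.
apply: (@le_integrableR _ _ (fun x => 2 * g x ^+ 2 + 2 * h x ^+ 2)) => //.
- by apply: measurable_funX; exact: measurable_funD.
- move=> x _; rewrite ger0_norm ?sqr_ge0//.
  have : 0 <= (g x - h x) ^+ 2 by rewrite sqr_ge0.
  nra.
- by apply: integrableDR => //; exact: integrableZR.
Qed.

Lemma n2D D g h : measurable D -> sqint D g -> sqint D h ->
  n2 D (fun x => g x + h x) <= 2 * n2 D g + 2 * n2 D h.
Proof.
move=> mD sg sh; have [mg ig] := sg; have [mh ih] := sh.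
rewrite /n2 -!RintegralZl// -RintegralD//; try exact: integrableZR.
apply: le_Rintegral => //.
- by have [] := sqintD mD sg sh.
- by apply: integrableDR => //; exact: integrableZR.
move=> x _; have : 0 <= (g x - h x) ^+ 2 by rewrite sqr_ge0.
nra.
Qed.

Lemma sqintM D c g (K : R) : measurable D -> measurable_fun D c ->
  (forall x, D x -> `|c x| <= K) -> sqint D g -> sqint D (fun x => c x * g x).
Proof.
move=> mD mc cK [mg ig]; split; first exact: measurable_funM.
apply: (@le_integrableR _ _ (fun x => K ^+ 2 * g x ^+ 2)) => //.
- by apply: measurable_funX; exact: measurable_funM.
- move=> x Dx; rewrite ger0_norm ?sqr_ge0// exprMn ler_wpM2r ?sqr_ge0//.
  by rewrite -[leLHS]real_normK ?num_real// lerXn2r ?nnegrE// ?(le_trans _ (cK _ Dx)) ?cK.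
- exact: integrableZR.
Qed.

Lemma n2M D c g (K : R) : measurable D -> measurable_fun D c ->
  (forall x, D x -> `|c x| <= K) -> sqint D g ->
  n2 D (fun x => c x * g x) <= K ^+ 2 * n2 D g.
Proof.
move=> mD mc cK sg; have [mg ig] := sg.
rewrite /n2 -RintegralZl//; apply: le_Rintegral => //.
- by have [] := sqintM mD mc cK sg.
- exact: integrableZR.
move=> x Dx; rewrite exprMn ler_wpM2r ?sqr_ge0//.
by rewrite -[leLHS]real_normK ?num_real// lerXn2r ?nnegrE// ?(le_trans _ (cK _ Dx)) ?cK.
Qed.

Lemma sqintZ D g (k : R) : measurable D -> sqint D g -> sqint D (fun x => k * g x).
Proof. by move=> mD; apply: (@sqintM D (cst k) g `|k|). Qed.

Lemma sqintN D g : measurable D -> sqint D g -> sqint D (fun x => - g x).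
Proof. by move=> mD /(sqintZ (-1) mD); under eq_fun do rewrite mulN1r. Qed.

Lemma sqintB D g h : measurable D -> sqint D g -> sqint D h ->
  sqint D (fun x => g x - h x).
Proof. by move=> mD sg /(sqintN mD); exact: sqintD. Qed.

Lemma n2N D g : n2 D (fun x => - g x) = n2 D g.
Proof. by rewrite /n2; under eq_Rintegral do rewrite sqrrN. Qed.

Lemma sqint_bounded D c (K : R) : measurable D -> (mu D < +oo)%E ->
  measurable_fun D c -> (forall x, D x -> `|c x| <= K) -> sqint D c.
Proof.
move=> mD fD mc cK; split => //.
apply: (@le_integrableR _ _ (fun=> K ^+ 2)) => //; first exact: measurable_funX.
  move=> x Dx; rewrite normrX lerXn2r ?nnegrE// ?(le_trans _ (cK _ Dx)) ?cK//.
exact: integrableR_cst.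
Qed.

Lemma n2_bounded D c (K : R) : measurable D -> (mu D < +oo)%E ->
  measurable_fun D c -> (forall x, D x -> `|c x| <= K) ->
  n2 D c <= K ^+ 2 * fine (mu D).
Proof.
move=> mD fD mc cK; have [_ ic] := sqint_bounded mD fD mc cK.
rewrite -Rintegral_cst//; apply: le_Rintegral => //; first exact: integrableR_cst.
by move=> x Dx; rewrite -[leLHS]real_normK ?num_real// lerXn2r ?nnegrE// ?(le_trans _ (cK _ Dx)) ?cK.
Qed.

Lemma sqint_integrable D g : measurable D -> (mu D < +oo)%E -> sqint D g ->
  mu.-integrable D (EFin \o g).
Proof.
move=> mD fD [mg ig]; apply: (@le_integrableR _ _ (fun x => 1 + g x ^+ 2)) => //.
  move=> x _; rewrite -[_ ^+ 2]real_normK ?num_real//.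
  have : 0 <= (`|g x| - 1) ^+ 2 by rewrite sqr_ge0.
  have := normr_ge0 (g x); nra.
by apply: integrableDR => //; exact: integrableR_cst.
Qed.

Lemma sqint_prod D g h : measurable D -> sqint D g -> sqint D h ->
  mu.-integrable D (EFin \o (fun x => g x * h x)).
Proof.
move=> mD [mg ig] [mh ih].
apply: (@le_integrableR _ _ (fun x => g x ^+ 2 + h x ^+ 2)) => //.
- exact: measurable_funM.
- move=> x _; rewrite normrM -[g x ^+ 2]real_normK ?num_real// -[h x ^+ 2]real_normK ?num_real//.
  have : 0 <= (`|g x| - `|h x|) ^+ 2 by rewrite sqr_ge0.
  have := sqr_ge0 `|g x|; have := sqr_ge0 `|h x|; nra.
- exact: integrableDR.
Qed.

Lemma sqintS D E g : measurable D -> measurable E -> E `<=` D ->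
  sqint D g -> sqint E g.
Proof.
move=> mD mE ED [mg ig]; split; first exact: measurable_funS mg.
exact: integrableS ig.
Qed.

Lemma n2S D E g : measurable D -> measurable E -> E `<=` D -> sqint D g ->
  n2 E g <= n2 D g.
Proof.
move=> mD mE ED [mg ig]; rewrite /n2 /Rintegral fine_le//.
- by apply: integrable_fin_num => //; exact: integrableS ig.
- exact: integrable_fin_num.
- apply: ge0_subset_integral => //.
  + by case/integrableP : ig.
  + by move=> x _ /=; rewrite lee_fin sqr_ge0.
Qed.

(** A weighted form of the Cauchy-Schwarz inequality against the constant 1, with
no square root: [e] will be small and [n2 D g] much smaller. *)
Lemma Rintegral_n2 D g (e : R) : 0 < e -> measurable D -> (mu D < +oo)%E ->
  sqint D g ->
  \int[mu]_(x in D) `|g x| <= e * fine (mu D) + e^-1 * n2 D g.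
Proof.
move=> e0 mD fD sg; have [mg ig] := sg.
rewrite -Rintegral_cst// /n2 -RintegralZl// -RintegralD//; last 2 first.
- exact: integrableR_cst.
- exact: integrableZR.
apply: le_Rintegral => //.
- have := integrable_norm (sqint_integrable mD fD sg); exact.
- by apply: integrableDR => //; [exact: integrableR_cst|exact: integrableZR].
move=> x _; rewrite -[_ ^+ 2]real_normK ?num_real//.
rewrite -subr_ge0.
have -> : e + e^-1 * `|g x| ^+ 2 - `|g x| = e * ((e^-1 * `|g x| - 2^-1) ^+ 2 + 3/4).
  by field; rewrite gt_eqF.
by rewrite mulr_ge0 ?ltW// ltr_wpDl ?sqr_ge0// divr_gt0.
Qed.

End SquareIntegrable.

(** * Weierstrass' theorem *)

Section PolynomialDensity.
Context {R : realType}.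
Local Notation mu := (@lebesgue_measure R).

Lemma uniform_continuous_itv (F : R -> R) (a b : R) :
  (forall x, a <= x <= b -> {for x, continuous F}) ->
  forall e : R, 0 < e -> exists2 d, 0 < d & forall x y, a <= x <= b -> a <= y <= b ->
    `|x - y| < d -> `|F x - F y| <= e.
Proof.
move=> cF e e0.
pose P (d x : R) := forall y, a <= y <= b -> `|x - y| < d -> `|F x - F y| <= e.
have : near_covering `[a, b] by apply/compact_near_coveringP/segment_compact.
move=> /(_ _ (0 : R)^'+ P _) covP.
have : \forall d \near (0 : R)^'+, `[a, b] `<=` P d.
  apply: covP => x /=; rewrite in_itv/= => xab.
  have /cvgrPdist_le/(_ (e / 2)) := cF x xab.
  rewrite divr_gt0// => /(_ isT) /nbhs_ballP[r /= r0 Fr].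
  exists (ball x (r / 2), [set d | d < r / 2]) => /=.
    split; first by apply: nbhsx_ballx; rewrite divr_gt0.
    by apply: nbhs_right_lt; rewrite divr_gt0.
  move=> [x' d] /= [] xx' dr y yab x'yd.
  have F1 := Fr x'; have F2 := Fr y.
  rewrite /ball/= in F1 F2 xx'.
  have -> : F x' - F y = (F x - F y) - (F x - F x') by ring.
  rewrite (le_trans (ler_normB _ _))// [leRHS]splitr lerD//.
    apply: F2; have -> : x - y = (x - x') + (x' - y) by ring.
    by rewrite (le_lt_trans (ler_normD _ _))// [ltRHS]splitr ltrD// (lt_trans x'yd).
  by apply: F1; rewrite (lt_le_trans xx')// ler_pdivrMr// ler_pMr// ler1n.
case/nbhs_ballP => d /= d0 dP; exists (d / 2); first by rewrite divr_gt0.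
move=> x y xab yab xyd; apply: (dP (d / 2)) => //=.
- rewrite /ball/= sub0r normrN gtr0_norm ?divr_gt0//.
  by rewrite ltr_pdivrMr// ltr_pMr// ltr1n.
- by rewrite divr_gt0.
Qed.

Lemma continuous_bounded_itv (F : R -> R) (a b : R) :
  (forall x, a <= x <= b -> {for x, continuous F}) ->
  exists2 K : R, 0 < K & forall x, a <= x <= b -> `|F x| <= K.
Proof.
move=> cF; have cF' : {within `[a, b], continuous F}.
  by apply: continuous_in_subspaceT => x; rewrite inE/= in_itv/= => /cF.
have /compact_bounded[M [_ MK]] := continuous_compact cF' (@segment_compact _ a b).
exists (`|M| + 1) => [|x xab]; first by rewrite ltr_wpDl.
apply: (MK (`|M| + 1)); first by rewrite ltr_pwDr// ler_norm.
by exists x => //=; rewrite in_itv.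
Qed.

(** The expectation of [phi] at a sum of [n] independent Bernoulli variables of
parameter [q]: a Bernstein polynomial in [q], written by conditioning on the
first variable, so that its moments come by induction on [n] with no binomial
coefficient. *)
Fixpoint bernstein (n : nat) (phi : nat -> R) (q : {poly R}) : {poly R} :=
  if n is n'.+1 then
    q * bernstein n' (phi \o S) q + (1 - q) * bernstein n' phi q
  else (phi 0%N)%:P.

Lemma bernstein_var n (c : R) q x : (bernstein n (fun k => (k%:R - c) ^+ 2) q).[x]
  = (n%:R * q.[x] - c) ^+ 2 + n%:R * q.[x] * (1 - q.[x]).
Proof.
elim: n c => [|n ih] c /=; first by rewrite hornerC; ring.
rewrite hornerD !hornerM hornerD hornerN hornerC.
have -> : (fun k => (k%:R - c) ^+ 2) \o S = (fun k => (k%:R - (c - 1)) ^+ 2).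
  by apply/funext => k /=; rewrite -natr1; ring.
by rewrite !ih -natr1; ring.
Qed.

Lemma bernstein_le n (phi psi : nat -> R) q x : 0 <= q.[x] <= 1 ->
  (forall k, (k <= n)%N -> phi k <= psi k) ->
  (bernstein n phi q).[x] <= (bernstein n psi q).[x].
Proof.
move=> /andP[q0 q1]; elim: n phi psi => [|n ih] phi psi pp /=.
  by rewrite !hornerC pp.
rewrite !(hornerD, hornerM, hornerN, hornerC) lerD// ler_wpM2l ?subr_ge0//.
- by apply: ih => k kn; apply: pp.
- by apply: ih => k kn; apply: pp; rewrite (leq_trans kn).
Qed.

Lemma bernstein_lin n (phi psi : nat -> R) (c : R) q x :
  (bernstein n (fun k => phi k + c * psi k) q).[x]
  = (bernstein n phi q).[x] + c * (bernstein n psi q).[x].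
Proof.
elim: n phi psi => [|n ih] phi psi /=; first by rewrite !hornerC.
rewrite (_ : (fun k => phi k + c * psi k) \o S =
  (fun k => (phi \o S) k + c * (psi \o S) k))//.
by rewrite !(hornerD, hornerM, hornerN, hornerC) !ih; ring.
Qed.

Lemma bernstein_cst n (c : R) q x : (bernstein n (fun=> c) q).[x] = c.
Proof.
elim: n => [|n ih] /=; first by rewrite hornerC.
rewrite (_ : (fun=> c) \o S = (fun=> c))//.
by rewrite !(hornerD, hornerM, hornerN, hornerC) !ih; ring.
Qed.

(** Weierstrass' theorem, by Chebyshev's inequality: the mean of [n] Bernoulli
variables of parameter [q] has variance at most [1 / (4 n)]. *)
Lemma weierstrass (F : R -> R) (a b : R) : a < b ->
  (forall x, a <= x <= b -> {for x, continuous F}) ->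
  forall e : R, 0 < e -> exists p : {poly R}, forall x, a <= x <= b -> `|F x - p.[x]| <= e.
Proof.
move=> ab cF e e0.
have ba0 : 0 < b - a by rewrite subr_gt0.
have [K K0 FK] := continuous_bounded_itv cF.
have e20 : 0 < e / 2 by rewrite divr_gt0.
have [d d0 Fd] := uniform_continuous_itv cF e20.
pose q : {poly R} := (b - a)^-1 *: ('X - a%:P).
have qE x : q.[x] = (x - a) / (b - a).
  by rewrite /q hornerZ hornerXsubC mulrC.
have [N N0 NK] : exists2 N : nat, (0 < N)%N & 4 * K * (b - a) ^+ 2 / (d ^+ 2 * e) <= N%:R.
  exists (Num.truncn (4 * K * (b - a) ^+ 2 / (d ^+ 2 * e))).+1 => //.
  by apply/ltW; rewrite truncnS_gt.
pose node (k : nat) := a + (b - a) * (k%:R / N%:R).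
exists (bernstein N (F \o node) q) => x xab.
have q01 : 0 <= q.[x] <= 1.
  case/andP: xab => ax xb; rewrite qE divr_ge0 ?subr_ge0 ?(ltW ab)//=.
  by rewrite ler_pdivrMr// mul1r lerD2r.
have NR0 : 0 < N%:R :> R by rewrite ltr0n.
have node_ab k : (k <= N)%N -> a <= node k <= b.
  move=> kN; rewrite /node lerDl mulr_ge0 ?(ltW ba0)//= ?divr_ge0//.
  have : k%:R / N%:R <= 1 :> R by rewrite ler_pdivrMr// mul1r ler_nat.
  have := ltW ba0; nra.
(* [C (k - N q) ^ 2] is [2 K (node k - x) ^ 2 / d ^ 2], at least [2 K] for a node
   at distance at least [d] from [x] *)
pose C := 2 * K * (b - a) ^+ 2 / (d ^+ 2 * N%:R ^+ 2).
have C0 : 0 <= C.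
  by rewrite /C; apply: divr_ge0; apply: mulr_ge0; rewrite ?sqr_ge0// mulr_ge0// ltW.
have devE k : node k - x = (b - a) / N%:R * (k%:R - N%:R * q.[x]).
  by rewrite /node qE; field; rewrite ?gt_eqF.
have dev k : (k <= N)%N ->
    `|F (node k) - F x| <= e / 2 + C * (k%:R - N%:R * q.[x]) ^+ 2.
  move=> /node_ab kab; have [lt_d|le_d] := ltP `|node k - x| d.
    by rewrite (le_trans (Fd _ _ kab xab lt_d))// lerDl mulr_ge0 ?sqr_ge0.
  rewrite (@le_trans _ _ (2 * K))//.
    by rewrite (le_trans (ler_normB _ _))// mulr_natl mulr2n lerD ?FK.
  rewrite -[leLHS]add0r lerD ?(ltW e20)//.
  have -> : C * (k%:R - N%:R * q.[x]) ^+ 2 = 2 * K * ((node k - x) ^+ 2 / d ^+ 2).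
    by rewrite devE /C; field; rewrite ?gt_eqF.
  rewrite ler_pMr ?mulr_gt0// ler_pdivlMr ?exprn_gt0// mul1r.
  by rewrite -[leRHS]real_normK ?num_real// lerXn2r ?nnegrE// ltW.
have varE : (bernstein N (fun k => (k%:R - N%:R * q.[x]) ^+ 2) q).[x]
    = N%:R * q.[x] * (1 - q.[x]) by rewrite bernstein_var subrr expr0n add0r.
have var : C * (N%:R * q.[x] * (1 - q.[x])) <= e / 2.
  have qq : q.[x] * (1 - q.[x]) <= 1 by case/andP: q01 => ? ?; nra.
  rewrite (@le_trans _ _ (C * N%:R))//.
    by rewrite ler_wpM2l// -mulrA ler_piMr// ltW.
  have -> : C * N%:R = 2 * K * (b - a) ^+ 2 / d ^+ 2 / N%:R.
    by rewrite /C; field; rewrite ?gt_eqF.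
  rewrite ler_pdivrMr//.
  have -> : 2 * K * (b - a) ^+ 2 / d ^+ 2 =
      (e / 2) * (4 * K * (b - a) ^+ 2 / (d ^+ 2 * e)).
    by field; rewrite ?gt_eqF.
  by rewrite ler_wpM2l// ltW.
rewrite ler_norml; apply/andP; split.
- rewrite lerBDr -lerBDl opprK addrC.
  apply: (@le_trans _ _ (bernstein N (fun k => F x + e / 2 + C * (k%:R - N%:R * q.[x]) ^+ 2) q).[x]).
    apply: bernstein_le => // k kN /=.
    by have := dev _ kN; rewrite ler_norml => /andP[_]; lra.
  by rewrite bernstein_lin bernstein_cst varE; lra.
- rewrite lerBlDr.
  apply: (@le_trans _ _ (e + (bernstein N (fun k => F x - e / 2 + (- C) * (k%:R - N%:R * q.[x]) ^+ 2) q).[x])).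
    by rewrite bernstein_lin bernstein_cst varE; lra.
  rewrite lerD2l; apply: bernstein_le => // k kN /=.
  by have := dev _ kN; rewrite ler_norml => /andP[+ _]; lra.
Qed.

End PolynomialDensity.

(** * Density of polynomials in L2 *)

Section L2Density.
Context {R : realType}.
Local Notation mu := (@lebesgue_measure R).
Implicit Types (D : set (measurableTypeR R)).

Lemma dominated_cvg_Rintegral D (f_ : nat -> R -> R) (f g : R -> R) :
  measurable D -> (forall n, measurable_fun D (f_ n)) ->
  (forall x, D x -> f_ n x @[n --> \oo] --> f x) ->
  mu.-integrable D (EFin \o g) ->
  (forall n x, D x -> `|f_ n x| <= g x) ->
  mu.-integrable D (EFin \o f) /\
  \int[mu]_(x in D) f_ n x @[n --> \oo] --> \int[mu]_(x in D) f x.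
Proof.
move=> mD mf ff ig fg.
have mlim : measurable_fun D f.
  by apply: (@measurable_fun_cvg _ _ _ D f_).
have [|||||i1 _ i3] := @dominated_convergence _ _ _ mu D mD
    (fun n => EFin \o f_ n) (EFin \o f) (EFin \o g).
- by move=> n; exact/measurable_EFinP.
- exact/measurable_EFinP.
- by apply: aeW => x Dx; apply: cvg_EFin; [exact: nearW|exact: ff].
- exact: ig.
- by apply: aeW => x n Dx /=; rewrite lee_fin fg.
split => //.
rewrite /Rintegral; apply: fine_cvg.
by rewrite fineK//; exact: integrable_fin_num.
Qed.

Definition clip (K x : R) : R := Num.max (- K) (Num.min x K).

Lemma clipP K x : 0 <= K -> [\/ [/\ clip K x = x, - K <= x & x <= K],
  [/\ clip K x = K, K < x & - K <= x] | [/\ clip K x = - K, x < - K & x <= K]].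
Proof.
move=> K0; rewrite /clip; have [xK|Kx] := leP x K.
  have [Kx|xK'] := leP (- K) x; first by constructor 1.
  by constructor 3.
have KK : - K <= K by lra.
by constructor 2; rewrite max_r//; split => //; exact: (le_trans KK (ltW Kx)).
Qed.

Lemma clip_lip K x y : 0 <= K -> `|clip K x - clip K y| <= `|x - y|.
Proof.
move=> K0; rewrite ler_norml.
have := ler_norm (x - y); have := ler_norm (y - x); rewrite (distrC y x).
by case: (clipP x K0) => -[-> ? ?]; case: (clipP y K0) => -[-> ? ?] => *;
  apply/andP; split; lra.
Qed.

Lemma clip_bound K x : 0 <= K -> `|clip K x| <= K.
Proof.
by move=> K0; rewrite ler_norml; case: (clipP x K0) => -[-> ? ?]; lra.
Qed.

Lemma clip_id K x : `|x| <= K -> clip K x = x.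
Proof.
move=> xK; have K0 : 0 <= K by rewrite (le_trans _ xK).
move: xK; rewrite ler_norml => /andP[? ?].
by case: (clipP x K0) => -[-> ? ?]; lra.
Qed.

Lemma clip_dist K x : 0 <= K -> `|x - clip K x| <= `|x|.
Proof.
move=> K0; rewrite ler_norml; have := ler_norm x; have := ler_norm (- x); rewrite normrN.
by case: (clipP x K0) => -[-> ? ?] *; apply/andP; split; lra.
Qed.

Lemma clip_continuous K : 0 <= K -> continuous (clip K).
Proof.
move=> K0 x; apply/cvgrPdist_lt => e e0; near=> y.
by rewrite (le_lt_trans (clip_lip _ _ K0))//; near: y; exact: cvgr_dist_lt.
Unshelve. all: by end_near. Qed.

Lemma measurable_clip D K (f : R -> R) : 0 <= K -> measurable_fun D f ->
  measurable_fun D (fun x => clip K (f x)).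
Proof.
move=> K0 mf; apply: (measurableT_comp _ mf).
by apply: continuous_measurable_fun; exact: clip_continuous.
Qed.

(** Truncation at a high level is small in L2, by dominated convergence. *)
Lemma n2_clip D g : measurable D -> sqint D g -> forall e : R, 0 < e ->
  exists2 K : R, 0 < K & n2 D (fun x => g x - clip K (g x)) <= e.
Proof.
move=> mD sg e e0; have [mg ig] := sg.
have [||||_ cv] := @dominated_cvg_Rintegral D
  (fun n x => (g x - clip n.+1%:R (g x)) ^+ 2) (cst 0) (fun x => g x ^+ 2) mD.
- move=> n; apply: measurable_funX; apply: measurable_funB => //.
  exact: measurable_clip.
- move=> x _; apply/cvgrPdist_le => r r0; near=> n.
  rewrite clip_id ?subrr ?expr0n/= ?subrr ?normr0 ?(ltW r0)//.
  rewrite (@le_trans _ _ (Num.truncn `|g x|).+1%:R)//; first exact/ltW/truncnS_gt.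
  by rewrite ler_nat; near: n; exact: nbhs_infty_ge.
- by [].
- move=> n x _; rewrite ger0_norm ?sqr_ge0//.
  rewrite -[leLHS]real_normK ?num_real// -[leRHS]real_normK ?num_real//.
  by rewrite lerXn2r ?nnegrE// clip_dist.
move: cv; rewrite Rintegral_cst// mul0r => /cvgrPdist_le/(_ e e0)[n _].
move=> /(_ n (leqnn n)); rewrite sub0r normrN ger0_norm; last exact: n2_ge0.
by move=> gn; exists n.+1%:R.
Unshelve. all: by end_near. Qed.

Context (a b : R) (ab : a < b).
Local Notation I := (`]a, b[%classic : set (measurableTypeR R)).

Lemma mI : measurable I. Proof. exact: measurable_itv. Qed.

Lemma muI : (mu I < +oo)%E.
Proof. by rewrite lebesgue_measure_itv/= lte_fin ab -EFinD ltry. Qed.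

Lemma fine_muI : fine (mu I) = b - a.
Proof. by rewrite lebesgue_measure_itv/= lte_fin ab. Qed.

(** Truncation reduces the claim to bounded functions, for which density in L1
implies density in L2; Weierstrass' theorem then replaces continuous functions
by polynomials. *)
Lemma L2_poly g : sqint I g -> forall e : R, 0 < e ->
  exists p : {poly R}, n2 I (fun x => g x - p.[x]) <= e.
Proof.
move=> sg e e0; have [mg ig] := sg.
have e40 : 0 < e / 16 by rewrite divr_gt0.
have [K K0 gK] := n2_clip mI sg e40.
pose gk x := clip K (g x).
have mgk : measurable_fun I gk by apply: measurable_clip => //; exact: ltW.
have gkb x : I x -> `|gk x| <= K by move=> _; rewrite clip_bound// ltW.
have sgk : sqint I gk by apply: sqint_bounded gkb; [exact: mI|exact: muI|].
have igk := sqint_integrable mI muI sgk.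
have [h_ [ch ih]] := approximation_continuous_integrable mI muI igk.
move=> /fine_cvgP[_] /cvgrPdist_le/(_ (e / 16 / (2 * K)))[|n _ /(_ n (leqnn n))].
  by rewrite !divr_gt0// mulr_gt0.
rewrite sub0r normrN => hn.
pose h x := clip K (h_ n x).
have cth : continuous h.
  by move=> x; apply: (@continuous_comp _ _ _ (h_ n) (clip K)); [exact: (ch n x)|apply: clip_continuous; exact: ltW].
have mh : measurable_fun I h.
  by apply: measurable_funS (continuous_measurable_fun cth).
have hb x : I x -> `|h x| <= K by move=> _; rewrite clip_bound// ltW.
have sh : sqint I h by apply: sqint_bounded hb; [exact: mI|exact: muI|].
have n2h : n2 I (fun x => gk x - h x) <= e / 16.
  have mhn : measurable_fun I (h_ n).
    by apply: measurable_funS (continuous_measurable_fun (ch n)).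
  have idh : mu.-integrable I (EFin \o (fun x => `|gk x - h_ n x|)).
    apply: (@le_integrableR _ _ _ (fun x => `|gk x - h_ n x|)) => //.
    - by apply: measurableT_comp => //; exact: measurable_funB.
    - by move=> x _; rewrite normr_id.
    - exact: (integrable_norm (integrableBR mI igk (ih n))).
  apply: (@le_trans _ _ (2 * K * \int[mu]_(x in I) `|gk x - h_ n x|)).
    rewrite -RintegralZl//.
    apply: le_Rintegral; first exact: mI.
    - by have [] := sqintB mI sgk sh.
    - by apply: integrableZR => //; exact: mI.
    move=> x Ix; rewrite -[leLHS]real_normK ?num_real// expr2 ler_pM//.
      by rewrite (le_trans (ler_normB _ _))// mulr_natl mulr2n lerD ?gkb ?hb.
    by rewrite -[gk x in leLHS](@clip_id K) ?gkb//; exact/clip_lip/ltW.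
  have -> : e / 16 = 2 * K * (e / 16 / (2 * K)) by field; rewrite gt_eqF.
  rewrite ler_wpM2l ?mulr_ge0 ?(ltW K0)//.
  by apply: le_trans hn; exact: ler_norm.
have e2 : 0 < Num.min 1 (e / (4 * (b - a))) .
  by rewrite lt_min ltr01 divr_gt0// mulr_gt0// subr_gt0.
have [p hp] := @weierstrass R h a b ab (fun x _ => cth x) _ e2.
have mp : measurable_fun I (horner p).
  apply: measurable_funS (continuous_measurable_fun _) => //.
  by move=> x; exact: continuous_horner.
have pb x : I x -> `|h x - p.[x]| <= Num.min 1 (e / (4 * (b - a))).
  by rewrite /= in_itv/= => /andP[/ltW ? /ltW ?]; apply: hp; apply/andP.
have mhp : measurable_fun I (fun x => h x - p.[x]) by exact: measurable_funB.
have shp : sqint I (fun x => h x - p.[x]).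
  by apply: sqint_bounded pb; [exact: mI|exact: muI|].
have n2p : n2 I (fun x => h x - p.[x]) <= e / 4.
  rewrite (le_trans (n2_bounded mI muI mhp pb))// fine_muI.
  rewrite (@le_trans _ _ (e / (4 * (b - a)) * (b - a)))//.
    rewrite ler_wpM2r ?subr_ge0 ?(ltW ab)// expr2.
    rewrite -[leRHS]mul1r ler_pM ?ge_min ?lexx ?orbT// ltW//.
  by rewrite le_eqVlt; apply/orP; left; apply/eqP; field; rewrite ?subr_eq0 gt_eqF.
exists p.
have -> : (fun x => g x - p.[x])
    = (fun x => ((g x - gk x) + (gk x - h x)) + (h x - p.[x])).
  by apply/funext => x; ring.
have s1 := sqintB mI sg sgk; have s2 := sqintB mI sgk sh.
have s3 := sqintD mI s1 s2.
rewrite (le_trans (n2D mI s3 shp))//.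
have := n2D mI s1 s2.
rewrite /= in gK n2h n2p *; rewrite -/gk in gK; lra.
Qed.

End L2Density.

(** * H1 functions of one variable *)

Section FundamentalTheorem.
Context {R : realType}.
Local Notation mu := (@lebesgue_measure R).
Implicit Types (f g F : R -> R).

Lemma is_derive_continuous F (x l : R) : is_derive x 1 F l -> {for x, continuous F}.
Proof.
by move=> dF; apply/differentiable_continuous/derivable1_diffP; case: dF.
Qed.

Lemma is_derive_mul f g (x df dg : R) : is_derive x 1 f df -> is_derive x 1 g dg ->
  is_derive x 1 (fun y => f y * g y) (df * g x + f x * dg).
Proof.
move=> hf hg; have := is_deriveM hf hg.
by move=> /is_derive_eq; apply; rewrite /GRing.scale/= addrC (mulrC (g x)).
Qed.

Lemma is_derive_add f g (x df dg : R) : is_derive x 1 f df -> is_derive x 1 g dg ->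
  is_derive x 1 (fun y => f y + g y) (df + dg).
Proof. by move=> hf hg; have := is_deriveD hf hg. Qed.

Lemma FTC2_oo F f (c d : R) : c <= d ->
  (forall x, c <= x <= d -> is_derive x 1 F (f x)) ->
  (forall x, c <= x <= d -> {for x, continuous f}) ->
  mu.-integrable `[c, d] (EFin \o f) /\ \int[mu]_(x in `]c, d[) f x = F d - F c.
Proof.
move=> cd dF cf.
have wf : {within `[c, d], continuous f}.
  by apply: continuous_in_subspaceT => x; rewrite inE/= in_itv/= => /cf.
have ifcd : mu.-integrable `[c, d] (EFin \o f).
  apply: continuous_compact_integrable => //; exact: segment_compact.
split => //; have [<-{d cd dF cf wf ifcd}|] := eqVneq c d.
  by rewrite set_itvoo0 Rintegral_set0 subrr.
rewrite neq_lt => /orP[cd'|]; last by rewrite ltNge cd.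
have cF x : c <= x <= d -> {for x, continuous F} by move=> /dF /is_derive_continuous.
have ioo : mu.-integrable `]c, d[ (EFin \o f).
  by apply: integrableS ifcd => //; exact: subset_itv_oo_cc.
have ico : mu.-integrable `[c, d[ (EFin \o f).
  by apply: integrableS ifcd => //; exact: subset_itv_co_cc.
rewrite Rintegral_itv_obnd_cbnd// Rintegral_itv_bndo_bndc// /Rintegral.
rewrite (@continuous_FTC2 _ f F)//.
- split.
  + move=> x; rewrite in_itv/= => /andP[cx xd].
    by have [] := dF x; rewrite ?(ltW cx) ?(ltW xd).
  + by apply/cvg_at_right_filter/cF; rewrite lexx.
  + by apply/cvg_at_left_filter/cF; rewrite lexx cd.
- move=> x; rewrite in_itv/= => /andP[cx xd]; rewrite derive1E.
  by have [] := dF x; rewrite ?(ltW cx) ?(ltW xd).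
Qed.

End FundamentalTheorem.

Section Sobolev.
Context {R : realType} (a b : R) (ab : a < b).
Local Notation mu := (@lebesgue_measure R).
Local Notation I := (`]a, b[%classic : set (measurableTypeR R)).
Implicit Types (f g h k c : R -> R).

(** H1(]a, b[), by continuous representatives: [f] is absolutely continuous up to
the endpoints, with square integrable derivative [g]. The corresponding
convergence is [ucvg] for the functions with [lcvg] for the derivatives. *)
Definition W f g :=
  sqint I g /\ forall x, a <= x <= b -> f x = f a + \int[mu]_(t in `]a, x[) g t.

Definition ucvg (f_ : nat -> R -> R) f := forall e : R, 0 < e ->
  \forall n \near \oo, forall x, a <= x <= b -> `|f_ n x - f x| <= e.

Definition lcvg (g_ : nat -> R -> R) g := forall e : R, 0 < e ->
  \forall n \near \oo, n2 I (fun x => g_ n x - g x) <= e.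

Lemma I_ab (x : R) : I x -> a <= x <= b.
Proof. by rewrite /= in_itv/= => /andP[/ltW -> /ltW ->]. Qed.

Lemma subI x : a <= x <= b -> `]a, x[ `<=` `]a, b[.
Proof. by move=> /andP[_ xb]; apply: subset_itvl; rewrite bnd_simp. Qed.

Lemma ucvgD (f_ : nat -> R -> R) f (g_ : nat -> R -> R) g : ucvg f_ f -> ucvg g_ g ->
  ucvg (fun n x => f_ n x + g_ n x) (fun x => f x + g x).
Proof.
move=> ff gg e e0; have e20 : 0 < e / 2 by rewrite divr_gt0.
near=> n => x xab.
have -> : f_ n x + g_ n x - (f x + g x) = (f_ n x - f x) + (g_ n x - g x) by ring.
rewrite (le_trans (ler_normD _ _))// [leRHS]splitr lerD//; move: x xab; near: n.
  exact: ff.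
exact: gg.
Unshelve. all: by end_near. Qed.

Lemma ucvgM (K : R) (f_ : nat -> R -> R) f (g_ : nat -> R -> R) g : 
  (forall x, a <= x <= b -> `|f x| <= K) -> (forall x, a <= x <= b -> `|g x| <= K) ->
  ucvg f_ f -> ucvg g_ g -> ucvg (fun n x => f_ n x * g_ n x) (fun x => f x * g x).
Proof.
move=> fK gK ff gg e e0.
have K0 : 0 <= K by rewrite (le_trans _ (fK a _))// lexx ltW.
pose d := Num.min 1 (e / (2 * K + 1)).
have K1 : 0 < 2 * K + 1 by rewrite ltr_wpDl// mulr_ge0.
have d0 : 0 < d by rewrite lt_min ltr01 divr_gt0.
near=> n => x xab.
have fd : `|f_ n x - f x| <= d by move: x xab; near: n; exact: ff.
have gd : `|g_ n x - g x| <= d by move: {fd} x xab; near: n; exact: gg.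
have -> : f_ n x * g_ n x - f x * g x = (f_ n x - f x) * (g_ n x - g x)
   + f x * (g_ n x - g x) + (f_ n x - f x) * g x by ring.
have d1 : d <= 1 by rewrite ge_min lexx.
have de : d * (2 * K + 1) <= e.
  by rewrite -ler_pdivlMr// ge_min lexx orbT.
have dd : `|f_ n x - f x| * `|g_ n x - g x| <= d * 1.
  by rewrite ler_pM// (le_trans gd).
have fk : `|f x| * `|g_ n x - g x| <= K * d by rewrite ler_pM// fK.
have gk : `|f_ n x - f x| * `|g x| <= d * K by rewrite ler_pM// gK.
rewrite (le_trans (ler_normD _ _))// normrM.
have := ler_normD ((f_ n x - f x) * (g_ n x - g x)) (f x * (g_ n x - g x)).
rewrite !normrM; lra.
Unshelve. all: by end_near. Qed.

Lemma ucvg_comp (m0 m K : R) F (f_ : nat -> R -> R) f : m0 < m ->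
  (forall t, m0 < t -> {for t, continuous F}) ->
  (forall x, a <= x <= b -> m <= f x <= K) ->
  ucvg f_ f -> ucvg (fun n x => F (f_ n x)) (fun x => F (f x)).
Proof.
move=> m0m cF fK ff e e0.
pose r := (m - m0) / 2.
have r0 : 0 < r by rewrite divr_gt0// subr_gt0.
have [|d d0 Fd] := @uniform_continuous_itv R F (m - r) (K + 1) _ e e0.
  move=> x /andP[mx _]; apply: cF; apply: lt_le_trans mx.
  by rewrite /r; lra.
pose d' := Num.min (d / 2) (Num.min r 1).
have d'0 : 0 < d' by rewrite !lt_min r0 ltr01 divr_gt0.
near=> n => x xab.
have fd : `|f_ n x - f x| <= d' by move: x xab; near: n; exact: ff.
have /andP[mf fKx] := fK x xab.
move: (fd); rewrite !le_min => /and3P[fd2 fr f1].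
move: fr => /ler_normlP[? ?]; move: f1 => /ler_normlP[? ?].
apply: Fd.
- apply/andP; split; lra.
- apply/andP; split; lra.
- by rewrite (le_lt_trans fd2)// ltr_pdivrMr// ltr_pMr// ltr1n.
Unshelve. all: by end_near. Qed.

Lemma lcvgD (f_ : nat -> R -> R) f (g_ : nat -> R -> R) g : (forall n, sqint I (f_ n)) -> sqint I f ->
  (forall n, sqint I (g_ n)) -> sqint I g -> lcvg f_ f -> lcvg g_ g ->
  lcvg (fun n x => f_ n x + g_ n x) (fun x => f x + g x).
Proof.
move=> sf_ sf sg_ sg ff gg e e0; have e40 : 0 < e / 4 by rewrite divr_gt0.
near=> n.
have -> : (fun x => f_ n x + g_ n x - (f x + g x))
    = (fun x => (f_ n x - f x) + (g_ n x - g x)) by apply/funext => x; ring.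
have hf : n2 I (fun x => f_ n x - f x) <= e / 4 by near: n; exact: ff.
have hg : n2 I (fun x => g_ n x - g x) <= e / 4 by near: n; exact: gg.
have := n2D (mI a b) (sqintB (mI a b) (sf_ n) sf) (sqintB (mI a b) (sg_ n) sg).
lra.
Unshelve. all: by end_near. Qed.

Lemma lcvgM (K : R) (c_ : nat -> R -> R) c (g_ : nat -> R -> R) g :
  (forall n, measurable_fun I (c_ n)) -> measurable_fun I c ->
  (forall x, a <= x <= b -> `|c x| <= K) ->
  (forall n, sqint I (g_ n)) -> sqint I g -> ucvg c_ c -> lcvg g_ g ->
  lcvg (fun n x => c_ n x * g_ n x) (fun x => c x * g x).
Proof.
move=> mc_ mc cK sg_ sg cc gg e e0.
have K0 : 0 <= K by rewrite (le_trans _ (cK a _))// lexx ltW.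
have ng0 := n2_ge0 I g.
pose d := Num.min 1 (e / (4 * (n2 I g + 1))).
have n1 : 0 < n2 I g + 1 by rewrite ltr_wpDl.
have d0 : 0 < d by rewrite lt_min ltr01 divr_gt0// mulr_gt0.
have d1 : d <= 1 by rewrite ge_min lexx.
have de : d * (4 * (n2 I g + 1)) <= e.
  by rewrite -ler_pdivlMr ?mulr_gt0// ge_min lexx orbT.
have K1 : 0 < 4 * (K + 1) ^+ 2 by rewrite mulr_gt0// exprn_gt0// ltr_wpDl.
near=> n.
have cd x : I x -> `|c_ n x - c x| <= d.
  by move=> /I_ab; move: x; near: n; exact: cc.
have gd : n2 I (fun x => g_ n x - g x) <= e / (4 * (K + 1) ^+ 2).
  by near: n; apply: gg; rewrite divr_gt0.
have -> : (fun x => c_ n x * g_ n x - c x * g x)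
    = (fun x => c_ n x * (g_ n x - g x) + (c_ n x - c x) * g x).
  by apply/funext => x; ring.
have cK1 x : I x -> `|c_ n x| <= K + 1.
  move=> Ix; have -> : c_ n x = c x + (c_ n x - c x) by ring.
  by rewrite (le_trans (ler_normD _ _))// lerD ?cK ?I_ab// (le_trans (cd _ Ix)).
have sgn := sqintB (mI a b) (sg_ n) sg.
have mcc : measurable_fun I (fun x => c_ n x - c x) by exact: measurable_funB.
have := n2D (mI a b) (sqintM (mI a b) (mc_ n) cK1 sgn) (sqintM (mI a b) mcc cd sg).
have h1 := n2M (mI a b) (mc_ n) cK1 sgn.
have h2 := n2M (mI a b) mcc cd sg.
have h3 : (K + 1) ^+ 2 * n2 I (fun x => g_ n x - g x) <= e / 4.
  have -> : e / 4 = (K + 1) ^+ 2 * (e / (4 * (K + 1) ^+ 2)).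
    by field; rewrite gt_eqF// ltr_wpDl.
  by rewrite ler_wpM2l ?sqr_ge0.
have h4 : d ^+ 2 * n2 I g <= e / 4.
  have : d ^+ 2 * n2 I g <= d * (n2 I g + 1).
    rewrite expr2 -mulrA ler_wpM2l ?(ltW d0)//.
    by rewrite (@le_trans _ _ (n2 I g)) ?lerDl// ler_piMl.
  lra.
lra.
Unshelve. all: by end_near. Qed.

Lemma ucvg_lcvg (c_ : nat -> R -> R) c : (forall n, measurable_fun I (c_ n)) -> measurable_fun I c ->
  ucvg c_ c -> lcvg c_ c.
Proof.
move=> mc_ mc cc e e0.
have ba0 : 0 < b - a by rewrite subr_gt0.
pose d := Num.min 1 (e / (b - a)).
have d0 : 0 < d by rewrite lt_min ltr01 divr_gt0.
near=> n.
have cd x : I x -> `|c_ n x - c x| <= d.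
  by move=> /I_ab; move: x; near: n; exact: cc.
have mcc : measurable_fun I (fun x => c_ n x - c x) by exact: measurable_funB.
rewrite (le_trans (n2_bounded (mI a b) (muI ab) mcc cd))// (fine_muI ab).
rewrite (@le_trans _ _ (d * (b - a)))//.
  by rewrite ler_wpM2r ?(ltW ba0)// expr2 ler_piMl ?(ltW d0)// ge_min lexx.
by rewrite -ler_pdivlMr// ge_min lexx orbT.
Unshelve. all: by end_near. Qed.

Lemma measurable_C1 f : (forall x, a <= x <= b -> {for x, continuous f}) ->
  measurable_fun I f.
Proof.
move=> cf; apply: open_continuous_measurable_fun.
  exact: interval_open.
by move=> x; rewrite inE => /I_ab; exact: cf.
Qed.

Lemma W_C1 f f' : (forall x, a <= x <= b -> is_derive x 1 f (f' x)) ->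
  (forall x, a <= x <= b -> {for x, continuous f'}) -> W f f'.
Proof.
move=> df cf'; split.
  have [K K0 fK] := continuous_bounded_itv cf'.
  apply: (@sqint_bounded _ _ _ K (mI a b) (muI ab)); first exact: measurable_C1.
  by move=> x /I_ab; exact: fK.
move=> x /andP[ax xb]; have [||_ ->] := @FTC2_oo R f f' a x ax; last by ring.
- by move=> t /andP[at_ tx]; apply: df; rewrite at_ (le_trans tx).
- by move=> t /andP[at_ tx]; apply: cf'; rewrite at_ (le_trans tx).
Qed.

Lemma W_sqint f g : W f g -> sqint I g. Proof. by case. Qed.

Lemma W_int f g x : W f g -> a <= x <= b -> mu.-integrable `]a, x[ (EFin \o g).
Proof.
move=> [sg _] xab; apply: (@integrableS _ _ _ _ I) => //.
  by move=> t; exact: subI.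
exact: sqint_integrable (mI a b) (muI ab) sg.
Qed.

Lemma int_n2 g (e : R) x : 0 < e -> a <= x <= b -> sqint I g ->
  `|\int[mu]_(t in `]a, x[) g t| <= e * (b - a) + e^-1 * n2 I g.
Proof.
move=> e0 xab sg.
have ig := sqint_integrable (mI a b) (muI ab) sg.
have sub := subI xab.
have iax : mu.-integrable `]a, x[ (EFin \o g).
  by apply: (@integrableS _ _ _ _ I) => //.
rewrite (le_trans (le_normr_Rintegral _ iax))//.
have sgx : sqint `]a, x[ g by apply: (@sqintS _ I) => //.
have mx : (mu `]a, x[ < +oo)%E.
  by rewrite lebesgue_measure_itv/=; case: ifPn => // _; rewrite -EFinD ltry.
rewrite (le_trans (Rintegral_n2 e0 _ mx sgx))// lerD//.
- rewrite ler_wpM2l ?(ltW e0)//= lebesgue_measure_itv/= lte_fin.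
  by case/andP: xab => ax xb; case: ifPn => _ /=; [rewrite lerB|rewrite subr_ge0 ltW].
- by rewrite ler_wpM2l ?invr_ge0 ?(ltW e0)//; apply: (@n2S _ I).
Qed.

(** Convergence in L2 implies convergence in L1 on the bounded interval. *)
Lemma lcvg_int (g_ : nat -> R -> R) g : (forall n, sqint I (g_ n)) -> sqint I g -> lcvg g_ g ->
  ucvg (fun n x => \int[mu]_(t in `]a, x[) g_ n t) (fun x => \int[mu]_(t in `]a, x[) g t).
Proof.
move=> sg_ sg gg e e0.
have ba0 : 0 < b - a by rewrite subr_gt0.
pose r := e / (2 * (b - a)).
have r0 : 0 < r by rewrite divr_gt0// mulr_gt0.
near=> n => x xab.
have gn : n2 I (fun x => g_ n x - g x) <= r * (e / 2).
  by near: n; apply: gg; rewrite mulr_gt0// divr_gt0.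
rewrite -RintegralB//.
- have := int_n2 r0 xab (sqintB (mI a b) (sg_ n) sg).
  have -> : r * (b - a) = e / 2 by rewrite /r; field; rewrite ?subr_eq0 ?gt_eqF.
  move=> /le_trans; apply.
  rewrite [leRHS]splitr lerD2l -ler_pdivlMl ?invr_gt0// invrK.
  exact: gn.
- by apply: (@integrableS _ _ _ _ I); rewrite //; [exact: subI|exact: sqint_integrable (mI a b) (muI ab) (sg_ n)].
- by apply: (@integrableS _ _ _ _ I); rewrite //; [exact: subI|exact: sqint_integrable (mI a b) (muI ab) sg].
Unshelve. all: by end_near. Qed.

Lemma ucvg_pt (f_ : nat -> R -> R) f x : a <= x <= b -> ucvg f_ f -> f_ n x @[n --> \oo] --> f x.
Proof.
move=> xab ff; apply/cvgrPdist_le => e e0; near=> n.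
by rewrite distrC; move: x xab; near: n; exact: ff.
Unshelve. all: by end_near. Qed.

(** Both sides of the integral formula pass to the limit. *)
Lemma W_closed (f_ : nat -> R -> R) (g_ : nat -> R -> R) f g : (forall n, W (f_ n) (g_ n)) -> ucvg f_ f -> sqint I g ->
  lcvg g_ g -> W f g.
Proof.
move=> Wn ff sg gg; split => // x xab.
have sg_ n : sqint I (g_ n) by have [] := Wn n.
have aab : a <= a <= b by rewrite lexx ltW.
have c1 := ucvg_pt xab ff.
have c2 : f_ n a + \int[mu]_(t in `]a, x[) g_ n t @[n --> \oo] -->
    f a + \int[mu]_(t in `]a, x[) g t.
  exact: cvgD (ucvg_pt aab ff) (ucvg_pt xab (lcvg_int sg_ sg gg)).
have e12 : (fun n => f_ n x) = (fun n => f_ n a + \int[mu]_(t in `]a, x[) g_ n t).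
  by apply/funext => n; have [_ ->] := Wn n.
by rewrite e12 in c1; exact: (cvg_unique _ c1 c2).
Qed.

End Sobolev.

(** * The algebra of H1 functions *)

Section SobolevAlgebra.
Context {R : realType} (a b : R) (ab : a < b).
Local Notation mu := (@lebesgue_measure R).
Local Notation I := (`]a, b[%classic : set (measurableTypeR R)).
Local Notation W := (W a b).
Local Notation ucvg := (ucvg a b).
Local Notation lcvg := (lcvg a b).
Implicit Types (f g h k c F : R -> R).

Definition primitive (q : {poly R}) : {poly R} :=
  \poly_(i < (size q).+1) (if i is j.+1 then q`_j / j.+1%:R else 0).

Lemma deriv_primitive q : (primitive q)^`() = q.
Proof.
apply/polyP => i; rewrite coef_deriv coef_poly ltnS.
case: ltnP => iq; last by rewrite mul0rn nth_default.
by rewrite -mulrnAr -[_ *+ _]mulr_natr mulVf ?mulr1// pnatr_eq0.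
Qed.

Lemma is_derive_horner (p : {poly R}) (x : R) :
  is_derive x 1 (horner p) (p^`()).[x].
Proof.
by apply: DeriveDef; [exact: derivable_horner|rewrite derivE derive1E].
Qed.

Lemma for_continuous_horner (p : {poly R}) (x : R) : {for x, continuous (horner p)}.
Proof. exact: is_derive_continuous (is_derive_horner p x). Qed.

Lemma W_horner (p : {poly R}) : W (horner p) (horner p^`()).
Proof.
by apply: W_C1 => // x _; exact: for_continuous_horner.
Qed.

Lemma near_shift (P : nat -> Prop) N : (\forall n \near \oo, P n) ->
  \forall n \near \oo, P (n + N)%N.
Proof.
by case=> M _ MP; exists M => // n /= Mn; apply: MP; rewrite /= (leq_trans Mn) ?leq_addr.
Qed.

(** If polynomials approach [g] in L2, their primitives with the same value as [f]
at [a] approach [f] uniformly. *)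
Lemma W_approx f g (r : R) : 0 < r -> W f g -> exists p_ : nat -> {poly R},
  [/\ ucvg (fun n => horner (p_ n)) f, lcvg (fun n => horner (p_ n)^`()) g &
      forall n x, a <= x <= b -> `|(p_ n).[x] - f x| <= r].
Proof.
move=> r0 Wf; have [sg fg] := Wf.
have /choice[q_ q_g] (n : nat) : exists q : {poly R}, n2 I (fun x => g x - q.[x]) <= n.+1%:R^-1.
  by apply: (L2_poly ab sg); rewrite invr_gt0.
have qg : lcvg (fun n => horner (q_ n)) g.
  move=> e e0; near=> n.
  rewrite -n2N (_ : (fun x => _) = (fun x => g x - (q_ n).[x])); last first.
    by apply/funext => x; ring.
  apply: (le_trans (q_g n)); rewrite -[leRHS]invrK lef_pV2 ?posrE ?invr_gt0//.
  rewrite (@le_trans _ _ (Num.truncn e^-1).+1%:R)//; first exact/ltW/truncnS_gt.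
  by rewrite ler_nat ltnS; near: n; exact: nbhs_infty_ge.
pose p_ n := primitive (q_ n) + (f a - (primitive (q_ n)).[a])%:P.
have pq n : (p_ n)^`() = q_ n by rewrite derivD derivC addr0 deriv_primitive.
have aab : a <= a <= b by rewrite lexx ltW.
have pf : ucvg (fun n => horner (p_ n)) f.
  have sq n : sqint I (horner (q_ n)).
    by have [] := W_horner (p_ n); rewrite pq.
  move=> e e0; have := lcvg_int ab sq sg qg e0.
  apply: filterS => n h x xab; have := h x xab.
  have [_ /(_ x xab)] := W_horner (p_ n); rewrite pq => ->.
  rewrite fg// (_ : (p_ n).[a] = f a); last by rewrite /p_ hornerD hornerC; ring.
  by congr (`|_| <= _); ring.
have [N _ Nr] := pf r r0.
exists (fun n => p_ (n + N)%N); split.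
- by move=> e /pf; exact: near_shift.
- move=> e /qg /(@near_shift _ N); apply: filterS => n.
  by rewrite pq.
- by move=> n x xab; apply: Nr => //=; exact: leq_addl.
Unshelve. all: by end_near. Qed.

Lemma measurable_horner (p : {poly R}) : measurable_fun I (horner p).
Proof. by apply: measurable_C1 => x _; exact: for_continuous_horner. Qed.

Lemma W_measurable f g : W f g -> measurable_fun I f.
Proof.
move=> /(W_approx ltr01)[p_ [pf _ _]].
apply: (@measurable_fun_cvg _ _ _ I (fun n => horner (p_ n))).
  by move=> n; exact: measurable_horner.
by move=> x /I_ab xab; exact: (ucvg_pt xab pf).
Qed.

Lemma W_bounded f g : W f g -> exists2 K : R, 0 < K & forall x, a <= x <= b -> `|f x| <= K.
Proof.
move=> /(W_approx ltr01)[p_ [_ _ pf]].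
have [K K0 pK] := @continuous_bounded_itv R (horner (p_ 0%N)) a b
  (fun x _ => @for_continuous_horner _ x).
exists (K + 1); first by rewrite addr_gt0.
move=> x xab; have -> : f x = (p_ 0%N).[x] - ((p_ 0%N).[x] - f x) by ring.
by rewrite (le_trans (ler_normB _ _))// lerD ?pK// pf.
Qed.

Lemma W_uniform_continuous f g : W f g -> forall e : R, 0 < e -> exists2 d : R, 0 < d &
  forall x y, a <= x <= b -> a <= y <= b -> `|x - y| < d -> `|f x - f y| <= e.
Proof.
move=> Wf e e0; have e30 : 0 < e / 3 by rewrite divr_gt0.
have [p_ [_ _ pf]] := W_approx e30 Wf.
have [d d0 pd] := @uniform_continuous_itv R (horner (p_ 0%N)) a b
  (fun x _ => @for_continuous_horner _ x) _ e30.
exists d => // x y xab yab xyd.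
have -> : f x - f y = ((p_ 0%N).[x] - (p_ 0%N).[y]) - ((p_ 0%N).[x] - f x)
   + ((p_ 0%N).[y] - f y) by ring.
have h1 := pd _ _ xab yab xyd; have h2 := pf 0%N x xab; have h3 := pf 0%N y yab.
rewrite (le_trans (ler_normD _ _))//.
rewrite (le_trans (lerD (ler_normB _ _) (lexx _)))//; lra.
Qed.

Lemma eq_W f g f' g' : (forall x, a <= x <= b -> f x = f' x) ->
  (forall x, I x -> g x = g' x) -> W f g -> W f' g'.
Proof.
move=> ff gg [[mg ig] fg]; split; first split.
- by apply: eq_measurable_fun mg => x; rewrite inE; exact: gg.
- by apply: eq_integrable ig => // x; rewrite inE => Ix /=; rewrite gg.
move=> x xab; rewrite -!ff ?lexx ?(ltW ab)// fg//; congr (_ + _).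
by apply: eq_Rintegral => t; rewrite inE => /= tax; apply: gg; exact: (subI xab).
Qed.

Lemma W_cst (r : R) : W (cst r) (cst 0).
Proof. by apply: W_C1 => // x _; exact: cst_continuous. Qed.

Lemma W_add f g h k : W f g -> W h k -> W (fun x => f x + h x) (fun x => g x + k x).
Proof.
move=> Wf Wh; have [sg fg] := Wf; have [sk hk] := Wh.
split; first exact: (sqintD (mI a b)).
move=> x xab; rewrite RintegralD//; last 2 first.
- exact: (W_int ab Wf).
- exact: (W_int ab Wh).
by rewrite fg// hk//; ring.
Qed.

Definition wcvg (f_ g_ : nat -> R -> R) f g :=
  [/\ forall n, W (f_ n) (g_ n), W f g, ucvg f_ f & lcvg g_ g].

Lemma W_wcvg f g : W f g -> exists p_ : nat -> {poly R},
  wcvg (fun n => horner (p_ n)) (fun n => horner (p_ n)^`()) f g.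
Proof.
move=> Wf; have [p_ [pf pg _]] := W_approx ltr01 Wf.
by exists p_; split => // n; exact: W_horner.
Qed.

Lemma leibniz_cvg (f_ g_ : nat -> R -> R) f g (h_ k_ : nat -> R -> R) h k :
  wcvg f_ g_ f g -> wcvg h_ k_ h k ->
  [/\ ucvg (fun n x => f_ n x * h_ n x) (fun x => f x * h x),
    sqint I (fun x => g x * h x + f x * k x) &
    lcvg (fun n x => g_ n x * h_ n x + f_ n x * k_ n x) (fun x => g x * h x + f x * k x)].
Proof.
have sqint_mul f1 g1 h1 k1 : W f1 g1 -> W h1 k1 -> sqint I (fun x => f1 x * k1 x).
  move=> Wf Wh; have [K _ fK] := W_bounded Wf.
  apply: (sqintM (mI a b) (W_measurable Wf) (fun x Ix => fK x (I_ab Ix))).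
  exact: (W_sqint Wh).
have lcvg_mul (f1_ g1_ : nat -> R -> R) f1 g1 (h1_ k1_ : nat -> R -> R) h1 k1 :
    wcvg f1_ g1_ f1 g1 -> wcvg h1_ k1_ h1 k1 ->
    lcvg (fun n x => f1_ n x * k1_ n x) (fun x => f1 x * k1 x).
  move=> [Wf_ Wf ff _] [Wh_ Wh _ kk]; have [K _ fK] := W_bounded Wf.
  apply: (lcvgM ab _ (W_measurable Wf) fK _ (W_sqint Wh) ff kk) => n.
    exact: (W_measurable (Wf_ n)).
  exact: (W_sqint (Wh_ n)).
move=> cf ch; have [Wf_ Wf ff gg] := cf; have [Wh_ Wh hh kk] := ch.
have -> : (fun x => g x * h x + f x * k x) = (fun x => h x * g x + f x * k x).
  by apply/funext => x; rewrite (mulrC (g x)).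
have -> : (fun n x => g_ n x * h_ n x + f_ n x * k_ n x)
   = (fun n x => h_ n x * g_ n x + f_ n x * k_ n x).
  by apply/funext => n; apply/funext => x; rewrite (mulrC (g_ n x)).
have s1 := sqint_mul _ _ _ _ Wh Wf; have s2 := sqint_mul _ _ _ _ Wf Wh.
split.
- have [K1 K10 fK1] := W_bounded Wf; have [K2 K20 hK2] := W_bounded Wh.
  apply: (@ucvgM _ _ _ ab (K1 + K2)) => // x xab.
    by rewrite (le_trans (fK1 _ xab))// lerDl ltW.
  by rewrite (le_trans (hK2 _ xab))// lerDr ltW.
- exact: (sqintD (mI a b)).
- apply: (@lcvgD _ a b (fun n x => h_ n x * g_ n x) (fun x => h x * g x)
    (fun n x => f_ n x * k_ n x) (fun x => f x * k x)) => //.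
  + by move=> n; exact: (sqint_mul _ _ _ _ (Wh_ n) (Wf_ n)).
  + by move=> n; exact: (sqint_mul _ _ _ _ (Wf_ n) (Wh_ n)).
  + exact: (lcvg_mul _ _ _ _ _ _ _ _ ch cf).
  + exact: (lcvg_mul _ _ _ _ _ _ _ _ cf ch).
Qed.

(** Leibniz' rule, true of polynomials, extends by density. *)
Lemma W_mul f g h k : W f g -> W h k ->
  W (fun x => f x * h x) (fun x => g x * h x + f x * k x).
Proof.
move=> /W_wcvg[p_ cp] /W_wcvg[q_ cq]; have [u s l] := leibniz_cvg cp cq.
apply: (W_closed ab _ u s l) => n.
apply: eq_W (W_horner (p_ n * q_ n)) => x _; first by rewrite hornerM.
by rewrite derivM hornerD !hornerM; ring.
Qed.

(** The chain rule, true of polynomials, extends by density. [F] is only assumed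
to be C1 to the right of [m0], to cover the inverse function; the polynomials are
taken so close to [f] that they stay above [m0] as well. *)
Lemma W_comp (m0 m : R) F F' f g : m0 < m ->
  (forall t, m0 < t -> is_derive t 1 F (F' t)) ->
  (forall t, m0 < t -> {for t, continuous F'}) ->
  (forall x, a <= x <= b -> m <= f x) ->
  W f g -> W (fun x => F (f x)) (fun x => F' (f x) * g x).
Proof.
move=> m0m dF cF' mf Wf; have sg := W_sqint Wf.
have r0 : 0 < (m - m0) / 2 by rewrite divr_gt0// subr_gt0.
have [p_ [pf pg pr]] := W_approx r0 Wf.
have p0 n x : a <= x <= b -> m0 < (p_ n).[x].
  by move=> xab; have := pr n x xab; have := mf x xab => ? /ler_normlP[? ?]; lra.
have [K K0 fK] := W_bounded Wf.
have fmK x : a <= x <= b -> m <= f x <= K.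
  by move=> xab; rewrite mf//= (le_trans (ler_norm _))// fK.
have cF t : m0 < t -> {for t, continuous F} by move=> /dF /is_derive_continuous.
have cvF' := ucvg_comp m0m cF' fmK pf.
have mF'p n : measurable_fun I (fun x => F' (p_ n).[x]).
  apply: measurable_C1 => x xab.
  apply: (@continuous_comp _ _ _ (horner (p_ n)) F'); first exact: for_continuous_horner.
  by apply: cF'; exact: p0.
have mF'f : measurable_fun I (fun x => F' (f x)).
  apply: (@measurable_fun_cvg _ _ _ I (fun n x => F' (p_ n).[x])) => //.
  by move=> x /I_ab xab; exact: (ucvg_pt xab cvF').
have [K' K'0 F'K] : exists2 K' : R, 0 < K' & forall x, a <= x <= b -> `|F' (f x)| <= K'.
  have [K' K'0 h] : exists2 K' : R, 0 < K' & forall t, m <= t <= K -> `|F' t| <= K'.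
    apply: continuous_bounded_itv => t /andP[mt _]; apply: cF'.
    exact: lt_le_trans mt.
  by exists K' => // x /fmK /h.
have sFg : sqint I (fun x => F' (f x) * g x).
  exact: (sqintM (mI a b) mF'f (fun x Ix => F'K _ (I_ab Ix))).
apply: (@W_closed _ _ _ ab (fun n x => F (p_ n).[x])
  (fun n x => F' (p_ n).[x] * (p_ n)^`().[x])) => //.
- move=> n; apply: W_C1 => // x xab.
    by apply: (@is_derive1_comp _ F (horner (p_ n))); apply: dF; exact: p0.
  apply: (@continuousM _ _ (fun x => F' (p_ n).[x])).
    apply: (@continuous_comp _ _ _ (horner (p_ n)) F'); first exact: for_continuous_horner.
    by apply: cF'; exact: p0.
  exact: for_continuous_horner.
- exact: (ucvg_comp m0m cF fmK pf).
- apply: (lcvgM ab _ mF'f F'K) => // n; exact: W_sqint (W_horner _).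
Qed.

(** Integration by parts: the boundary terms vanish with the test function. *)
Lemma W_weak f g : W f g -> weak_derivative a b f g.
Proof.
move=> Wf phi [dphi _ supp].
have phi0 x : ~ `]a, b[%classic x -> phi x = 0.
  move=> nI; apply: contrapT => /eqP px; apply: nI; apply: supp.
  exact: subset_closure.
have dp x : derivable phi x 1 by have := dphi 0%N x.
have dp' x : derivable (derive1 phi) x 1 by have := dphi 1%N x.
have Wphi : W phi (derive1 phi).
  apply: W_C1 => // x _.
    by apply: DeriveDef => //; rewrite derive1E.
  by apply/differentiable_continuous/derivable1_diffP.
have [sp _] := W_mul Wf Wphi.
have [_ /(_ b)] := W_mul Wf Wphi.
rewrite lexx ltW// => /(_ isT).
rewrite !phi0 ?mulr0 ?add0r; last 2 first.
- by rewrite /= in_itv/= ltxx.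
- by rewrite /= in_itv/= ltxx andbF.
have [K1 _ fK1] := W_bounded Wf; have [K2 _ hK2] := W_bounded Wphi.
rewrite RintegralD//.
- by move=> /eqP; rewrite eq_sym addrC addr_eq0 => /eqP.
- apply: (sqint_integrable (mI a b) (muI ab)).
  rewrite (_ : (fun x => g x * phi x) = (fun x => phi x * g x)); last by apply/funext => x; rewrite mulrC.
  exact: (sqintM (mI a b) (W_measurable Wphi) (fun x Ix => hK2 _ (I_ab Ix)) (W_sqint Wf)).
- apply: (sqint_integrable (mI a b) (muI ab)).
  exact: (sqintM (mI a b) (W_measurable Wf) (fun x Ix => fK1 _ (I_ab Ix)) (W_sqint Wphi)).
Qed.

Definition clamp (c d x : R) : R := Num.max c (Num.min x d).

Lemma W_between f g (c x : R) : W f g -> a <= c -> c <= x -> x <= b ->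
  f x = f c + \int[mu]_(t in `]c, x[) g t.
Proof.
move=> Wf ac cx xb.
have xab : a <= x <= b by rewrite xb (le_trans ac).
have cab : a <= c <= b by rewrite ac (le_trans cx).
have [_ fg] := Wf; rewrite (fg x)// (fg c)// -addrA; congr (_ + _).
have ix := W_int ab Wf xab; have ic := W_int ab Wf cab.
have [<-|neq] := eqVneq c x; first by rewrite set_itvoo0 Rintegral_set0 addr0.
have cx' : c < x by rewrite lt_neqAle neq.
rewrite -(@Rintegral_itvB _ g (BRight a) (BLeft x) c)//.
by rewrite -(@Rintegral_itv_bndo_bndc _ _ c)// addrC subrK.
Qed.

(** Freezing a function outside [[c, d]] removes its derivative there. *)
Lemma W_clamp f g (c d : R) : W f g -> a <= c -> c <= d -> d <= b ->
  W (fun x => f (clamp c d x)) (g \_ `]c, d[).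
Proof.
move=> Wf ac cd db; have [[mg ig] _] := Wf.
split; first split.
- apply/measurable_restrict => //.
  by apply: measurable_funS mg => // x [].
- apply: (@le_integrableR _ I _ (fun x => g x ^+ 2)) => //.
    apply: measurable_funX; apply/measurable_restrict => //.
    by apply: measurable_funS mg => // x [].
  move=> x _; rewrite patchE; case: ifP => _; first by rewrite ger0_norm ?sqr_ge0.
  by rewrite expr0n/= normr0 sqr_ge0.
move=> x /andP[ax xb].
have -> : clamp c d a = c by rewrite /clamp min_l ?max_l// (le_trans ac).
rewrite -Rintegral_mkcondr.
have [xc|cx] := leP x c.
  rewrite /clamp min_l ?(le_trans xc)// max_l// (_ : _ `&` _ = set0) ?Rintegral_set0 ?addr0//.
  rewrite -subset0 => t []/=; rewrite !in_itv/= => /andP[_ tx] /andP[ct _].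
  by have := lt_trans ct tx; rewrite ltNge xc.
have [xd|dx] := leP x d.
  rewrite /clamp min_l// max_r ?(ltW cx)// (_ : _ `&` _ = `]c, x[%classic).
    by apply: W_between => //; exact: ltW.
  apply/seteqP; split => t /=; rewrite !in_itv/=.
    by move=> [/andP[_ ->] /andP[-> _]].
  by move=> /andP[ct tx]; rewrite tx ct (le_lt_trans ac ct) (lt_le_trans tx).
rewrite /clamp min_r ?(ltW dx)// max_r// (_ : _ `&` _ = `]c, d[%classic).
  exact: W_between.
apply/seteqP; split => t /=; rewrite !in_itv/=.
  by move=> [_ ->].
by move=> /andP[ct td]; rewrite ct td (le_lt_trans ac ct) (lt_trans td).
Qed.

End SobolevAlgebra.

(** * Smooth cutoffs *)

Section Bumps.
Context {R : realType}.
Implicit Types (x s : R) (q : {poly R}).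

(** For the derivatives of the flat functions at the origin *)
Lemma is_derive_quadratic (f : R -> R) (C : R) : f 0 = 0 ->
  (forall x, `|x| <= 1 -> `|f x| <= C * x ^+ 2) -> is_derive (0 : R) 1 f 0.
Proof.
move=> f0 fC.
have cv : h^-1 *: (f (h *: 1 + 0) - f 0) @[h --> (0:R)^'] --> (0 : R).
  apply: (@cvg_to_0_linear R _ C 1) => // h /andP[h0 h1].
  rewrite f0 subr0 addr0 /GRing.scale/= mulr1 normrM normfV.
  rewrite ler_pdivrMl// (le_trans (fC _ (ltW h1)))//.
  by rewrite -real_normK ?num_real// expr2 mulrA [leRHS]mulrC.
by apply: DeriveDef; [apply/cvg_ex; exists 0|exact: cvg_lim cv].
Qed.

(** The flat functions [q(1/x) exp (- 1 / (s x))], extended by 0 to the left of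
the origin: this family is stable under differentiation. *)
Definition flat s q x : R := if 0 < x then q.[x^-1] * expR (- (s * x)^-1) else 0.

Definition flat_deriv s q : {poly R} := (s^-1 *: q - q^`()) * 'X^2.

(** [exp z >= z] with [z = y / (s m)], raised to the power [m] *)
Lemma expR_dominates s (m : nat) (y : R) : 0 < s -> 0 <= y ->
  y ^+ m <= (s * m%:R) ^+ m * expR (y / s).
Proof.
move=> s0 y0; case: m => [|m]; first by rewrite !expr0 mul1r -expR0 ler_expR divr_ge0 ?(ltW s0).
have m0 : 0 < m.+1%:R :> R by rewrite ltr0n.
have -> : expR (y / s) = expR (y / s / m.+1%:R) ^+ m.+1.
  by rewrite -expRM_natl; congr expR; field; rewrite gt_eqF//= gt_eqF.
rewrite -exprMn lerXn2r ?nnegrE ?mulr_ge0 ?(ltW s0) ?(ltW m0) ?expR_ge0//.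
have -> : y = s * m.+1%:R * (y / s / m.+1%:R) by field; rewrite gt_eqF//= gt_eqF.
rewrite ler_wpM2l ?mulr_ge0 ?(ltW s0) ?(ltW m0)//.
have -> : s * m.+1%:R * (y / s / m.+1%:R) / s / m.+1%:R = y / s / m.+1%:R.
  by field; rewrite gt_eqF//= gt_eqF.
by rewrite (le_trans _ (expR_ge1Dx _))// lerDr.
Qed.

Lemma flat_quadratic s q : 0 < s -> exists C : R, forall x, `|x| <= 1 ->
  `|flat s q x| <= C * x ^+ 2.
Proof.
move=> s0; pose A := \sum_(i < size q) `|q`_i|.
have A0 : 0 <= A by apply: sumr_ge0.
exists (A * (s * (size q).+2%:R) ^+ (size q).+2) => x x1.
rewrite /flat; case: ifPn => [x0|_]; last first.
  rewrite normr0 mulr_ge0 ?sqr_ge0// mulr_ge0// exprn_ge0// mulr_ge0// ltW//.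
have y1 : 1 <= x^-1 by rewrite invf_ge1// (le_trans (ler_norm _)).
have y0 : 0 <= x^-1 by rewrite invr_ge0 ltW.
have qA : `|q.[x^-1]| <= A * x^-1 ^+ size q.
  rewrite horner_coef (le_trans (ler_norm_sum _ _ _))// /A mulr_suml.
  apply: ler_sum => i _; rewrite normrM ler_wpM2l// normrX ger0_norm//.
  by apply: ler_weXn2l => //; exact: ltnW.
have := expR_dominates (size q).+2 s0 y0.
have -> : x^-1 / s = (s * x)^-1 by rewrite invfM mulrC.
move=> dom.
rewrite normrM [`|expR _|]ger0_norm ?expR_ge0// expRN.
rewrite ler_pdivrMr ?expR_gt0// (le_trans qA)//.
set K := (s * _) ^+ _ in dom *.
have -> : A * K * x ^+ 2 * expR (s * x)^-1 = A * (x ^+ 2 * (K * expR (s * x)^-1)) by ring.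
rewrite ler_wpM2l//.
have -> : x^-1 ^+ size q = x ^+ 2 * x^-1 ^+ (size q).+2.
  by rewrite -[in RHS](addn2 (size q)) exprD mulrCA -exprMn mulfV ?gt_eqF// expr1n mulr1.
by rewrite ler_wpM2l ?sqr_ge0.
Qed.

Lemma is_derive_flat s q x : 0 < s -> is_derive x 1 (flat s q) (flat s (flat_deriv s q) x).
Proof.
move=> s0; have [x0|x0|->] := ltgtP x 0.
- rewrite [X in is_derive _ _ _ X]/flat ltNge (ltW x0)/=.
  apply: (@near_eq_is_derive _ _ _ (cst 0)).
  by near=> y; rewrite /flat ltNge ltW//=; near: y; exact: lt_nbhsl.
- rewrite [X in is_derive _ _ _ X]/flat x0.
  apply: (@near_eq_is_derive _ _ _ (fun x => q.[x^-1] * expR (- (s * x)^-1))).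
    near=> y; rewrite /flat ifT//; near: y; exact: lt_nbhsr.
  have xn0 : x != 0 by rewrite gt_eqF.
  have dV : is_derive x 1 (fun y : R => y^-1) (- x ^- 2).
    by have := @is_deriveV R id x 1 1 xn0 (is_derive_id _ _); rewrite /GRing.scale/= mulr1.
  have d1 := @is_derive1_comp R (horner q) (fun y => y^-1) x _ _ (is_derive_horner q x^-1) dV.
  have d2 : is_derive x 1 (fun y : R => - (s * y)^-1) (s^-1 * x ^- 2).
    have -> : (fun y : R => - (s * y)^-1) = (fun y => (- s^-1) * y^-1).
      by apply/funext => y; rewrite invfM mulNr.
    have := @is_derive_mul R (cst (- s^-1)) (fun y => y^-1) x 0 (- x ^- 2) (is_derive_cst _ _ _) dV.
    by move/is_derive_eq; apply; rewrite /cst/=; ring.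
  have d3 := @is_derive1_comp R expR (fun y => - (s * y)^-1) x _ _ (is_derive_expR _) d2.
  have := is_derive_mul d1 d3; move/is_derive_eq; apply.
  rewrite /flat_deriv !(hornerE, hornerXn) /= -!exprVn; ring.
- rewrite [X in is_derive _ _ _ X]/flat ltxx.
  have [C fC] := flat_quadratic q s0.
  by apply: (is_derive_quadratic _ fC); rewrite /flat ltxx.
Unshelve. all: by end_near. Qed.

Definition smooth (f : R -> R) := forall n x, derivable (derive1n n f) x 1.

Lemma smooth_closed (S : set (R -> R)) :
  (forall f, S f -> exists g, S g /\ forall x, is_derive x 1 f (g x)) ->
  forall f, S f -> smooth f.
Proof.
move=> SS f Sf n; elim: n f Sf => [|n ih] f Sf x.
  by have [g [_ fg]] := SS _ Sf; case: (fg x).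
have [g [Sg fg]] := SS _ Sf.
rewrite derive1Sn (_ : derive1 f = g); first exact: ih.
by apply/funext => y; rewrite derive1E; have [] := fg y.
Qed.

(** A family that contains the cutoffs and is closed under differentiation, hence
consists of smooth functions by [smooth_closed] *)
Inductive flat_products s (c d : R) : (R -> R) -> Prop :=
| flat_prod q1 q2 : flat_products s c d (fun x => flat s q1 (x - c) * flat s q2 (d - x))
| flat_scale (k : R) f : flat_products s c d f -> flat_products s c d (fun x => k * f x)
| flat_add f g : flat_products s c d f -> flat_products s c d g ->
    flat_products s c d (fun x => f x + g x).

Lemma flat_products_derive s c d f : 0 < s -> flat_products s c d f ->
  exists g, flat_products s c d g /\ forall x, is_derive x 1 f (g x).
Proof.
move=> s0; elim => {f} [q1 q2|k f _ [g [Sg fg]]|f1 f2 _ [g1 [S1 fg1]] _ [g2 [S2 fg2]]].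
- exists (fun x => flat s (flat_deriv s q1) (x - c) * flat s q2 (d - x) +
    (-1) * (flat s q1 (x - c) * flat s (flat_deriv s q2) (d - x))); split.
    by apply: flat_add; [exact: flat_prod|apply: flat_scale; exact: flat_prod].
  move=> x.
  have d1 : is_derive x 1 (fun y => flat s q1 (y - c)) (flat s (flat_deriv s q1) (x - c)).
    have := @is_derive1_comp R (flat s q1) (fun y => y - c) x _ 1 (is_derive_flat _ _ s0).
    rewrite mulr1; apply.
    have := is_derive_add (is_derive_id x 1) (is_derive_cst (- c) x 1).
    by rewrite addr0.
  have d2 : is_derive x 1 (fun y => flat s q2 (d - y)) (- flat s (flat_deriv s q2) (d - x)).
    have := @is_derive1_comp R (flat s q2) (fun y => d - y) x _ (-1) (is_derive_flat _ _ s0).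
    rewrite mulrN1; apply.
    have := is_derive_add (is_derive_cst d x 1) (is_deriveN (is_derive_id x 1)).
    by rewrite add0r.
  have := is_derive_mul d1 d2; move/is_derive_eq; apply; ring.
- exists (fun x => k * g x); split; first exact: flat_scale.
  move=> x; have := is_derive_mul (is_derive_cst k x 1) (fg x).
  by move/is_derive_eq; apply; rewrite /cst; ring.
- exists (fun x => g1 x + g2 x); split; first exact: flat_add.
  by move=> x; exact: is_derive_add.
Qed.

Definition cutoff s (c d x : R) := flat s 1 (x - c) * flat s 1 (d - x).

Lemma cutoff_out s c d x : ~~ (c < x < d) -> cutoff s c d x = 0.
Proof.
rewrite negb_and -!leNgt /cutoff /flat => /orP[xc|dx].
  by rewrite subr_gt0 ltNge xc mul0r.
by rewrite [in X in _ * X]subr_gt0 [in X in _ * X]ltNge dx mulr0.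
Qed.

Lemma cutoff_in s c d x : c < x < d ->
  cutoff s c d x = expR (- (s * (x - c))^-1) * expR (- (s * (d - x))^-1).
Proof.
by move=> /andP[cx xd]; rewrite /cutoff /flat !subr_gt0 cx xd !hornerC !mul1r.
Qed.

Lemma cutoff_ge0 s c d x : 0 <= cutoff s c d x.
Proof.
have [xcd|/cutoff_out->//] := boolP (c < x < d).
by rewrite cutoff_in// mulr_ge0 ?expR_ge0.
Qed.

Lemma cutoff_gt0 s c d x : c < x < d -> 0 < cutoff s c d x.
Proof. by move=> xcd; rewrite cutoff_in// mulr_gt0 ?expR_gt0. Qed.

Lemma cutoff_le1 s c d x : 0 < s -> cutoff s c d x <= 1.
Proof.
move=> s0; have [|/cutoff_out->//] := boolP (c < x < d).
move=> /[dup] xcd /andP[cx xd]; rewrite cutoff_in//.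
by rewrite -[leRHS]mulr1 ler_pM ?expR_ge0// -expR0 ler_expR oppr_le0 invr_ge0
  mulr_ge0 ?(ltW s0)// subr_ge0 ltW.
Qed.

Lemma cutoff_near1 s c d x : 0 < s -> c < x < d ->
  1 - (s * (x - c))^-1 - (s * (d - x))^-1 <= cutoff s c d x.
Proof.
move=> s0 /[dup] xcd /andP[cx xd]; rewrite cutoff_in//.
have h1 := expR_ge1Dx (- (s * (x - c))^-1); have h2 := expR_ge1Dx (- (s * (d - x))^-1).
have u1 : expR (- (s * (x - c))^-1) <= 1.
  by rewrite -expR0 ler_expR oppr_le0 invr_ge0 mulr_ge0 ?(ltW s0)// subr_ge0 ltW.
have u2 : expR (- (s * (d - x))^-1) <= 1.
  by rewrite -expR0 ler_expR oppr_le0 invr_ge0 mulr_ge0 ?(ltW s0)// subr_ge0 ltW.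
nra.
Qed.

Lemma smooth_cutoff s c d : 0 < s -> smooth (cutoff s c d).
Proof.
move=> s0; apply: (@smooth_closed (flat_products s c d)); last exact: flat_prod.
by move=> f; exact: flat_products_derive.
Qed.

End Bumps.

(** * Weak derivatives *)

Section DuBoisReymond.
Context {R : realType} (a b : R) (ab : a < b).
Local Notation mu := (@lebesgue_measure R).
Local Notation I := (`]a, b[%classic : set (measurableTypeR R)).
Local Notation W := (W a b).
Implicit Types (f g w theta : R -> R).

Lemma sqint_L2 f : sqint I f -> L2 a b f.
Proof.
move=> [mf iff]; rewrite /L2 inE; apply/andP; split; rewrite inE/=.
  exact/(measurable_restrictT _ (mI a b)).
rewrite /finite_norm unlock /Lnorm poweR_lty//.
rewrite (_ : (fun x => _) = (fun x => ((f \_ I) x ^+ 2)%:E)); last first.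
  by apply/funext => x /=; rewrite powR_mulrn// -normrX ger0_norm ?sqr_ge0.
have := integrableP _ _ _ iff => -[_].
rewrite [in X in (X < _)%E]integral_mkcond; apply: le_lt_trans.
apply: ge0_le_integral => //.
- by move=> x _; rewrite lee_fin sqr_ge0.
- apply/measurable_EFinP; apply: measurable_funX.
  exact/(measurable_restrictT _ (mI a b)).
- apply/(measurable_restrictT _ (mI a b)).
  by apply: measurableT_comp => //; exact/measurable_EFinP/measurable_funX.
- move=> x _; rewrite !patchE; case: ifP => _; last by rewrite expr0n.
  by rewrite /= lee_fin ger0_norm ?sqr_ge0.
Qed.

Lemma L2_sqint f : L2 a b f -> sqint I f.
Proof.
move=> Lf; have := Lf; rewrite /L2 inE => /andP[]; rewrite inE/= => mf _.
split; first exact/(measurable_restrictT _ (mI a b)).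
have := Lfun2_integrable_sqr Lf => /(integrableS measurableT (mI a b) (@subsetT _ _)).
by apply: eq_integrable; [exact: mI|move=> x xI /=; rewrite patchE xI].
Qed.

Lemma smooth_continuous f : smooth f -> forall x, {for x, continuous f}.
Proof.
by move=> sf x; apply/differentiable_continuous/derivable1_diffP; exact: (sf 0%N x).
Qed.

Lemma integrable_continuous f c d : (forall x, {for x, continuous f}) ->
  mu.-integrable `[c, d] (EFin \o f).
Proof.
move=> cf; apply: continuous_compact_integrable; first exact: segment_compact.
by apply: continuous_subspaceT => x; exact: cf.
Qed.

(** The primitive from [a] vanishes before [c], and also after [d] because the
mean is 0. *)
Lemma test_primitive theta c d : a < c -> c < d -> d < b -> smooth theta ->
  (forall x, ~~ (c < x < d) -> theta x = 0) -> \int[mu]_(x in I) theta x = 0 ->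
  exists2 phi, test_function a b phi & derive1 phi = theta.
Proof.
move=> ac cd db st out mean0.
have ct := smooth_continuous st.
pose phi x := \int[mu]_(t in `[a, x]) theta t.
have phi_lt x : x <= c -> phi x = 0.
  move=> xc; rewrite /phi (@eq_Rintegral _ _ _ _ _ (cst 0)) ?Rintegral_cst ?mul0r//.
  move=> t; rewrite inE/= in_itv/= => /andP[_ tx]; apply: out.
  by rewrite negb_and -leNgt (le_trans tx).
have iab : mu.-integrable `[a, b] (EFin \o theta) by exact: integrable_continuous.
have phi_gt x : d <= x -> phi x = 0.
  move=> dx; have adx : a <= x by rewrite (le_trans _ dx)// ltW// (lt_trans ac).
  have split_at y : d <= y -> phi y = phi d.
    move=> dy; apply/eqP; rewrite -subr_eq0; apply/eqP; rewrite /phi.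
    rewrite (@Rintegral_itvB _ theta (BLeft a) (BRight y) d)//.
    - rewrite (@eq_Rintegral _ _ _ _ _ (cst 0)) ?Rintegral_cst ?mul0r//.
      move=> t; rewrite inE/= in_itv/= => /andP[dt _]; apply: out.
      by rewrite negb_and -!leNgt (ltW dt) orbT.
    - exact: integrable_continuous.
    - by rewrite bnd_simp ltW// (lt_trans ac).
  rewrite split_at// -(split_at b (ltW db)) /phi -[RHS]mean0.
  have ico : mu.-integrable `[a, b[ (EFin \o theta).
    by apply: integrableS iab => //; exact: subset_itv_co_cc.
  have ioo : mu.-integrable `]a, b[ (EFin \o theta).
    by apply: integrableS iab => //; exact: subset_itv_oo_cc.
  by rewrite -Rintegral_itv_bndo_bndc// -Rintegral_itv_obnd_cbnd.
have dphi (x : R) : is_derive x 1 phi (theta x).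
  have [xc|cx] := ltP x c.
    rewrite out; last by rewrite negb_and -leNgt ltW.
    apply: (@near_eq_is_derive _ _ _ (cst 0)).
    by near=> y; rewrite phi_lt// ltW//; near: y; exact: lt_nbhsl.
  have [||||d1 d2] := @continuous_FTC1_closed R theta a x (x + 1).
  - by rewrite ltrDl.
  - exact: integrable_continuous.
  - exact: lt_le_trans ac cx.
  - exact: ct.
  by apply: DeriveDef; [exact: d1|rewrite -derive1E; exact: d2].
have dE : derive1 phi = theta.
  by apply/funext => x; rewrite derive1E; have [] := dphi x.
have supp : closure [set x | phi x != 0] `<=` `[c, d].
  have <- : closure `[c, d]%classic = `[c, d]%classic by apply/esym/closure_id/interval_closed.
  apply: closure_subset => x /= px; rewrite in_itv/=.
  by rewrite leNgt [x <= d]leNgt; apply/andP; split; apply/negP => /ltW h;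
    move: px; rewrite ?(phi_lt _ h) ?(phi_gt _ h) eqxx.
exists phi; last exact: dE.
split.
- case=> [|n] x; first by case: (dphi x).
  by rewrite derive1Sn dE; exact: st.
- apply: (@subclosed_compact _ _ `[c, d]) => //; first exact: closed_closure.
  exact: segment_compact.
- by move=> x /supp /=; rewrite !in_itv/= => /andP[cx xd]; rewrite (lt_le_trans ac)//= (le_lt_trans xd).
Unshelve. all: by end_near. Qed.

Lemma smooth_lin f g (k : R) : smooth f -> smooth g -> smooth (fun x => f x - k * g x).
Proof.
move=> sf sg.
pose S := [set h | exists f g, [/\ smooth f, smooth g & h = (fun x => f x - k * g x)]].
apply: (@smooth_closed _ S); last by exists f, g.
move=> _ [{}f [{}g [{}sf {}sg ->]]].
have smooth_derive1 h : smooth h -> smooth (derive1 h).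
  by move=> sh n x; have := sh n.+1 x; rewrite derive1Sn.
exists (fun x => derive1 f x - k * derive1 g x); split.
  by exists (derive1 f), (derive1 g); split; [exact: smooth_derive1|exact: smooth_derive1|reflexivity].
move=> x.
have df : is_derive x 1 f (derive1 f x).
  by apply: DeriveDef; [exact: (sf 0%N x)|rewrite derive1E].
have dg : is_derive x 1 g (derive1 g x).
  by apply: DeriveDef; [exact: (sg 0%N x)|rewrite derive1E].
have := is_derive_add df (is_derive_mul (is_derive_cst (- k) x 1) dg).
move/is_derive_eq; rewrite /cst => /(_ (derive1 f x - k * derive1 g x)).
rewrite (_ : (fun y => f y + - k * g y) = (fun y => f y - k * g y)); last first.
  by apply/funext => y; rewrite mulNr.
by apply; ring.
Qed.

(** The cutoffs of the intervals [[c_n, d]], made of mean 0 by subtracting a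
multiple of a fixed bump [psi], are derivatives of test functions. When [c_n]
tends to [a], they tend boundedly to the indicator of ]a, d[. *)
Lemma orthogonal_const w : sqint I w ->
  (forall phi, test_function a b phi -> \int[mu]_(x in I) (w x * derive1 phi x) = 0) ->
  exists C : R, forall d, a < d -> d < b -> \int[mu]_(x in `]a, d[) (w x - C) = 0.
Proof.
move=> sw orth.
have iw := sqint_integrable (mI a b) (muI ab) sw.
pose c0 := (2 * a + b) / 3; pose d0 := (a + 2 * b) / 3.
have ab' := ab.
have ac0 : a < c0 by rewrite /c0; lra.
have cd0 : c0 < d0 by rewrite /c0 /d0; lra.
have db0 : d0 < b by rewrite /d0; lra.
clearbody c0 d0.
pose psi := cutoff 1 c0 d0.
have spsi : smooth psi by exact: smooth_cutoff.
have cutoff_int s c d : 0 < s -> mu.-integrable I (EFin \o cutoff s c d).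
  move=> s0; have icc : mu.-integrable `[a, b] (EFin \o cutoff s c d).
    by apply: integrable_continuous; exact/smooth_continuous/smooth_cutoff.
  by apply: integrableS icc => //; exact: subset_itv_oo_cc.
have cutoff_meas s c d : 0 < s -> measurable_fun I (cutoff s c d).
  by move=> s0; apply: measurable_C1 => x _; exact/smooth_continuous/smooth_cutoff.
have wcutoff_int s c d : 0 < s -> mu.-integrable I (EFin \o (fun x => w x * cutoff s c d x)).
  move=> s0; apply: (@le_integrableR _ _ _ (fun x => `|w x|)) => //.
  - by apply: measurable_funM; [case: sw|exact: cutoff_meas].
  - by move=> x _; rewrite normrM ler_piMr// ger0_norm ?cutoff_ge0// cutoff_le1.
  - exact: integrable_norm iw.
pose m := \int[mu]_(x in I) psi x.
have m0 : m != 0.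
  rewrite gt_eqF// /m lt_neqAle Rintegral_ge0 ?andbT; last by move=> x _; exact: cutoff_ge0.
  (* a positive minimum of the cutoff on the middle of its support *)
  pose l := (2 * c0 + d0) / 3; pose r := (c0 + 2 * d0) / 3.
  have cl : c0 < l by rewrite /l; lra.
  have lr : l < r by rewrite /l /r; lra.
  have rd : r < d0 by rewrite /r; lra.
  have [e elr emin] : exists2 e, e \in `[l, r] & forall t, t \in `[l, r] -> psi e <= psi t.
    apply: EVT_min; first exact: ltW.
    by apply: continuous_subspaceT => x; exact: smooth_continuous.
  have pe : 0 < psi e.
    apply: cutoff_gt0; move: elr; rewrite in_itv/= => /andP[le er].
    by rewrite (lt_le_trans cl)//= (le_lt_trans er).
  rewrite eq_sym gt_eqF//.
  have sub : `[l, r] `<=` I.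
    move=> x /=; rewrite !in_itv/= => /andP[lx xr].
    by rewrite (lt_le_trans (lt_trans ac0 cl) lx) (le_lt_trans xr (lt_trans rd db0)).
  apply: (@lt_le_trans _ _ (psi e * (r - l))); first by rewrite mulr_gt0// subr_gt0.
  have -> : psi e * (r - l) = \int[mu]_(x in I) ((fun=> psi e) \_ `[l, r]) x.
    rewrite -Rintegral_mkcondr (_ : I `&` `[l, r] = `[l, r]%classic); last exact/setIidPr.
    rewrite Rintegral_cst//= lebesgue_measure_itv/= lte_fin lr//.
  apply: le_Rintegral => //.
  - apply: (@le_integrableR _ _ _ (cst (psi e))) => //.
    + apply/measurable_restrict => //; exact: measurable_cst.
    + move=> x _; rewrite patchE; case: ifP => _; first by rewrite ger0_norm// ltW.
      by rewrite normr0 /cst ltW.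
    + by apply: integrableR_cst => //; exact: (muI ab).
  - exact: cutoff_int.
  - move=> x _; rewrite patchE; case: ifPn => [|_]; last exact: cutoff_ge0.
    by rewrite inE => /emin.
pose C := (\int[mu]_(x in I) (w x * psi x)) / m.
exists C => d ad db.
have key s c : 0 < s -> a < c -> c < d ->
    \int[mu]_(x in I) (w x * cutoff s c d x) = C * \int[mu]_(x in I) cutoff s c d x.
  move=> s0 ac cd; pose k := (\int[mu]_(x in I) cutoff s c d x) / m.
  pose theta x := cutoff s c d x - k * psi x.
  have [||||||phi tphi dphi] := @test_primitive theta (Num.min c c0) (Num.max d d0).
  - by rewrite lt_min ac.
  - by rewrite gt_min lt_max cd.
  - by rewrite gt_max db.
  - by apply: smooth_lin; [exact: smooth_cutoff|exact: spsi].
  - move=> x nx; rewrite /theta /psi !cutoff_out ?mulr0 ?subrr//; apply: contra nx => /andP[? ?];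
      by rewrite gt_min lt_max; apply/andP; split; apply/orP; (try by left); right.
  - rewrite /theta RintegralB//; last 2 first.
    + exact: cutoff_int.
    + by apply: integrableZR => //; exact: cutoff_int.
    rewrite RintegralZl//; last exact: cutoff_int.
    by rewrite /k -/m divfK// subrr.
  have := orth _ tphi; rewrite dphi /theta.
  under eq_Rintegral => x _ do rewrite mulrBr [w x * (k * _)]mulrCA.
  rewrite RintegralB//; last 2 first.
  - exact: wcutoff_int.
  - by apply: integrableZR => //; exact: wcutoff_int.
  rewrite RintegralZl//; last exact: wcutoff_int.
  move=> /eqP; rewrite subr_eq0 => /eqP ->.
  by rewrite /k /C; ring.
pose c_ (n : nat) := a + (d - a) / n.+2%:R.
have da0 : 0 < d - a by rewrite subr_gt0.
have ac_ n : a < c_ n by rewrite ltrDl divr_gt0.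
have cd_ n : c_ n < d.
  by rewrite /c_ -ltrBrDl ltr_pdivrMr// ltr_pMr// ltr1n.
pose ind (x : R) : R := if x \in `]a, d[ then 1 else 0.
have bcv (x : R) : I x -> cutoff n.+1%:R (c_ n) d x @[n --> \oo] --> ind x.
  move=> _; rewrite /ind; case: ifPn; last first.
    rewrite in_itv/= => xad.
    apply: cvg_near_cst; apply: nearW => n; apply: cutoff_out.
    by apply: contra xad => /andP[cx ->]; rewrite andbT (lt_trans (ac_ n)).
  rewrite in_itv/= => /andP[ax xd].
  apply/cvgrPdist_le => e e0.
  pose r := Num.min ((x - a) / 2) (d - x).
  have r0 : 0 < r by rewrite lt_min divr_gt0 ?subr_gt0.
  near=> n.
  have cx : c_ n <= x - (x - a) / 2.
    have : (d - a) / n.+2%:R <= (x - a) / 2.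
      rewrite ler_pdivrMr// -ler_pdivrMl ?divr_gt0 ?subr_gt0//.
      rewrite (@le_trans _ _ (Num.truncn (((x - a) / 2)^-1 * (d - a))).+1%:R)//.
        exact/ltW/truncnS_gt.
      rewrite ler_nat ltnS; apply: leqW; near: n; exact: nbhs_infty_ge.
    by rewrite /c_; set t := _ / n.+2%:R => h; clearbody t; lra.
  have cxd : c_ n < x < d.
    by rewrite xd andbT (le_lt_trans cx)// ltrBlDr ltrDl divr_gt0// subr_gt0.
  have s0 : 0 < n.+1%:R :> R by [].
  have lo := cutoff_near1 s0 cxd; have up := @cutoff_le1 _ _ (c_ n) d x s0.
  have inv_le t : r <= t -> (n.+1%:R * t)^-1 <= e / 2.
    move=> rt; have t0 := lt_le_trans r0 rt.
    rewrite -[leRHS]invrK lef_pV2 ?posrE ?invr_gt0 ?mulr_gt0 ?divr_gt0//.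
    rewrite (@le_trans _ _ (n.+1%:R * r))//; last by rewrite ler_pM2l.
    rewrite -ler_pdivrMr//.
    rewrite (@le_trans _ _ (Num.truncn ((e / 2)^-1 / r)).+1%:R)//.
      exact/ltW/truncnS_gt.
    by rewrite ler_nat ltnS; near: n; exact: nbhs_infty_ge.
  have i1 : (n.+1%:R * (x - c_ n))^-1 <= e / 2.
    apply: inv_le; rewrite ge_min; apply/orP; left; lra.
  have i2 : (n.+1%:R * (d - x))^-1 <= e / 2.
    by apply: inv_le; rewrite ge_min lexx orbT.
  rewrite ger0_norm ?subr_ge0// lerBlDl -lerBlDr; apply: le_trans lo.
  by rewrite -addrA -opprD lerD2l lerN2 [leRHS]splitr lerD.
have nS0 n : 0 < n.+1%:R :> R by [].
have [||||iind cv1] := @dominated_cvg_Rintegral _ I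
    (fun n => cutoff n.+1%:R (c_ n) d) ind (cst 1) (mI a b).
- by move=> n; exact: cutoff_meas.
- exact: bcv.
- by apply: integrableR_cst => //; exact: (muI ab).
- by move=> n x _; rewrite ger0_norm ?cutoff_ge0// cutoff_le1.
have [||||iwind cv2] := @dominated_cvg_Rintegral _ I
    (fun n x => w x * cutoff n.+1%:R (c_ n) d x) (fun x => w x * ind x) (fun x => `|w x|) (mI a b).
- by move=> n; apply: measurable_funM; [case: sw|exact: cutoff_meas].
- by move=> x Ix; apply: cvgMr; exact: bcv.
- exact: integrable_norm iw.
- by move=> n x _; rewrite normrM ler_piMr// ger0_norm ?cutoff_ge0// cutoff_le1.
have lim : \int[mu]_(x in I) (w x * ind x) = C * \int[mu]_(x in I) ind x.
  have e12 : (fun n => \int[mu]_(x in I) (w x * cutoff n.+1%:R (c_ n) d x)) =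
      (fun n => C * \int[mu]_(x in I) cutoff n.+1%:R (c_ n) d x).
    by apply/funext => n; rewrite key.
  rewrite e12 in cv2; apply: (cvg_unique _ cv2 _) => //.
  exact: cvgMr.
have sub : `]a, d[ `<=` I by apply: subset_itvl; rewrite bnd_simp ltW.
have -> : `]a, d[%classic = I `&` `]a, d[%classic by apply/esym/setIidPr.
rewrite Rintegral_mkcondr.
have -> : \int[mu]_(x in I) ((fun x => w x - C) \_ `]a, d[) x =
    \int[mu]_(x in I) (w x * ind x - C * ind x).
  by apply: eq_Rintegral => x _; rewrite /ind patchE mem_setE; case: ifP => _; rewrite ?mulr1 ?mulr0 ?subrr.
rewrite RintegralB//; last exact: integrableZR.
by rewrite RintegralZl// lim subrr.
Unshelve. all: by end_near. Qed.

(** Du Bois-Reymond's lemma: the difference between [f] and an indefinite integral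
of [g] is orthogonal to all derivatives of test functions, so that
[orthogonal_const] and Lebesgue's differentiation theorem make it constant almost
everywhere. *)
Lemma weak_derivative_W f g : sqint I f -> sqint I g -> weak_derivative a b f g ->
  exists2 fc, W fc g & {ae mu, forall x, I x -> f x = fc x}.
Proof.
move=> sf sg wfg.
pose f0 x := \int[mu]_(t in `]a, x[) g t.
have Wf0 : W f0 g.
  by split => // x xab; rewrite /f0 set_itvoo0 Rintegral_set0 add0r.
have [K0 _ f0K] := W_bounded ab Wf0.
have sf0 : sqint I f0.
  apply: (@sqint_bounded _ _ _ K0 (mI a b) (muI ab)); first exact: W_measurable Wf0.
  by move=> x /I_ab; exact: f0K.
pose w x := f x - f0 x.
have sw : sqint I w by exact: (sqintB (mI a b) sf sf0).
have test_int h phi : sqint I h -> test_function a b phi ->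
    mu.-integrable I (EFin \o (fun x => h x * derive1 phi x)).
  move=> sh [sphi _ _]; apply: sqint_prod => //.
  have cphi x : {for x, continuous (derive1 phi)}.
    by apply/differentiable_continuous/derivable1_diffP; exact: (sphi 1%N x).
  have [K _ phiK] := @continuous_bounded_itv _ _ a b (fun x _ => cphi x).
  apply: (@sqint_bounded _ _ _ K (mI a b) (muI ab)).
    by apply: measurable_C1 => x _; exact: cphi.
  by move=> x /I_ab; exact: phiK.
have [|C wC] := @orthogonal_const w sw.
  move=> phi tphi; rewrite /w.
  under eq_Rintegral => x _ do rewrite mulrBl.
  rewrite RintegralB//; last 2 first.
  - exact: test_int.
  - exact: test_int.
  by rewrite wfg// (W_weak ab Wf0)// subrr.
exists (fun x => f0 x + C).
  have := W_add ab Wf0 (W_cst ab C); apply: eq_W => // x _; first exact: addr0.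
pose v := (fun x => w x - C) \_ I.
have iv : mu.-integrable I (EFin \o (fun x => w x - C)).
  apply: integrableBR => //; first exact: (sqint_integrable (mI a b) (muI ab)).
  by apply: integrableR_cst => //; exact: (muI ab).
have ivT : mu.-integrable setT (EFin \o v).
  by have := iv; rewrite integrable_mkcond ?restrict_EFin//; exact: mI.
have [||] := @FTC1 R v (BRight a).
- move=> y; apply: integrableS ivT => //.
- exact: (integrable_locally (mI a b) iv).
move=> N [mN N0 subN]; exists N; split => // x /= nx; apply: subN => /= h; apply: nx => Ix.
move: (Ix); rewrite /= in_itv/= => /andP[ax xb].
case: h => [|_]; first by rewrite lte_fin.
suff -> : derive1 (fun y => \int[mu]_(t in `]a, y]) v t) x = 0.
  rewrite /v patchE mem_set//= => /eqP; rewrite eq_sym subr_eq0 => /eqP.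
  by rewrite /w => <-; ring.
rewrite derive1E; suff : is_derive x 1 (fun y => \int[mu]_(t in `]a, y]) v t) 0 by case.
apply: (@near_eq_is_derive _ _ _ (cst 0)).
near=> y.
have ay : a < y by near: y; exact: lt_nbhsr.
have yb : y < b by near: y; exact: lt_nbhsl.
have sub : `]a, y[ `<=` I by apply: subset_itvl; rewrite bnd_simp ltW.
rewrite -Rintegral_itv_bndo_bndc; last by apply: integrableS ivT.
have -> : \int[mu]_(t in `]a, y[) v t = \int[mu]_(t in `]a, y[) (w t - C).
  by apply: eq_Rintegral => t; rewrite inE => /sub It; rewrite /v patchE mem_set.
by rewrite wC.
Unshelve. all: by end_near. Qed.

End DuBoisReymond.

(** * C1 functions *)

Section C1Functions.
Context {R : realType}.
Implicit Types (f g : R -> R).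

Definition C1 f :=
  (forall x, derivable f x 1) /\ (forall x, {for x, continuous (derive1 f)}).

Lemma is_derive_derive1 f f' : (forall x : R, is_derive x 1 f (f' x)) -> derive1 f = f'.
Proof. by move=> df; apply/funext => x; rewrite derive1E; have [] := df x. Qed.

Lemma C1_is_derive f f' : (forall x : R, is_derive x 1 f (f' x)) ->
  (forall x, {for x, continuous f'}) -> C1 f.
Proof.
move=> df cf'; split; first by move=> x; have [] := df x.
by rewrite (is_derive_derive1 df).
Qed.

Lemma C1_derive f (x : R) : C1 f -> is_derive x 1 f (derive1 f x).
Proof. by case=> df _; apply: DeriveDef; [exact: df|rewrite derive1E]. Qed.

Lemma C1_continuous f (x : R) : C1 f -> {for x, continuous f}.
Proof. by move=> /(C1_derive x) /is_derive_continuous. Qed.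

Lemma C1_continuous' f (x : R) : C1 f -> {for x, continuous (derive1 f)}.
Proof. by case. Qed.

Lemma derive1_cstE (k : R) : derive1 (fun=> k : R) = (fun=> 0) :> (R -> R).
Proof. by apply: is_derive_derive1 => x; exact: is_derive_cst. Qed.

Lemma C1_cst (k : R) : C1 (fun=> k).
Proof.
apply: (@C1_is_derive _ (fun=> 0)) => x; exact: cst_continuous.
Qed.

Lemma C1_id : C1 (fun x => x).
Proof.
apply: (@C1_is_derive _ (fun=> 1)) => x; exact: cst_continuous.
Qed.

Lemma derive1_idE : derive1 (fun x : R => x) = (fun=> 1) :> (R -> R).
Proof. by apply: is_derive_derive1 => x; exact: is_derive_id. Qed.

Lemma derive1_add f g : C1 f -> C1 g ->
  derive1 (fun x => f x + g x) = (fun x => derive1 f x + derive1 g x).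
Proof.
by move=> Cf Cg; apply: is_derive_derive1 => x; apply: is_derive_add; exact: C1_derive.
Qed.

Lemma C1_add f g : C1 f -> C1 g -> C1 (fun x => f x + g x).
Proof.
move=> Cf Cg; apply: (@C1_is_derive _ (fun x => derive1 f x + derive1 g x)) => x.
  by apply: is_derive_add; exact: C1_derive.
by apply: continuousD; exact: C1_continuous'.
Qed.

Lemma derive1_mul f g : C1 f -> C1 g ->
  derive1 (fun x => f x * g x) = (fun x => derive1 f x * g x + f x * derive1 g x).
Proof.
by move=> Cf Cg; apply: is_derive_derive1 => x; apply: is_derive_mul; exact: C1_derive.
Qed.

Lemma C1_mul f g : C1 f -> C1 g -> C1 (fun x => f x * g x).
Proof.
move=> Cf Cg.
apply: (@C1_is_derive _ (fun x => derive1 f x * g x + f x * derive1 g x)) => x.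
  by apply: is_derive_mul; exact: C1_derive.
by apply: continuousD; apply: continuousM;
  (exact: C1_continuous' || exact: C1_continuous).
Qed.

Lemma derive1_scale (k : R) f : C1 f -> derive1 (fun x => k * f x) = (fun x => k * derive1 f x).
Proof.
move=> Cf; rewrite (derive1_mul (C1_cst k) Cf) derive1_cstE.
by apply/funext => x; rewrite mul0r add0r.
Qed.

Lemma C1_scale (k : R) f : C1 f -> C1 (fun x => k * f x).
Proof. exact: C1_mul (C1_cst k). Qed.

Lemma derive1_compE f g : C1 f -> C1 g ->
  derive1 (fun x => f (g x)) = (fun x => derive1 f (g x) * derive1 g x).
Proof.
move=> Cf Cg; apply: is_derive_derive1 => x.
by apply: (@is_derive1_comp _ f g); exact: C1_derive.
Qed.

Lemma C1_compose f g : C1 f -> C1 g -> C1 (fun x => f (g x)).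
Proof.
move=> Cf Cg; apply: (@C1_is_derive _ (fun x => derive1 f (g x) * derive1 g x)) => x.
  by apply: (@is_derive1_comp _ f g); exact: C1_derive.
apply: (@continuousM _ _ (fun x => derive1 f (g x))); last exact: C1_continuous'.
by apply: (@continuous_comp _ _ _ g (derive1 f)); [exact: C1_continuous|exact: C1_continuous'].
Qed.

Lemma derive1_sin : derive1 (@sin R) = cos.
Proof. by apply: is_derive_derive1 => x; exact: is_derive_sin. Qed.

Lemma derive1_cos : derive1 (@cos R) = (fun x => - sin x).
Proof. by apply: is_derive_derive1 => x; exact: is_derive_cos. Qed.

Lemma C1_sin : C1 (@sin R).
Proof.
apply: (@C1_is_derive _ cos) => x; exact: continuous_cos.
Qed.

Lemma C1_cos : C1 (@cos R).
Proof.
apply: (@C1_is_derive _ (fun x => - sin x)) => x.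
by apply: continuousN; exact: continuous_sin.
Qed.

Lemma C1_horner (p : {poly R}) : C1 (horner p).
Proof.
by apply: (@C1_is_derive _ (horner p^`())) => x; exact: for_continuous_horner.
Qed.

Lemma C1_exprn (n : nat) : C1 (fun x => x ^+ n).
Proof.
rewrite (_ : (fun x => x ^+ n) = horner 'X^n); first exact: C1_horner.
by apply/funext => x; rewrite hornerXn.
Qed.

Lemma C1_inv f : (forall x, 0 < f x) -> C1 f -> C1 (fun x => (f x)^-1).
Proof.
move=> f0 Cf; apply: (@C1_is_derive _ (fun x => - f x ^- 2 * derive1 f x)) => x.
  by apply: (@is_deriveV R f x (derive1 f x) 1); rewrite ?gt_eqF//; exact: C1_derive.
apply: (@continuousM _ _ (fun x => - f x ^- 2)); last exact: C1_continuous'.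
apply: continuousN; apply: (@continuousV _ _ (fun x => f x ^+ 2)).
  by rewrite expf_eq0/= gt_eqF.
by rewrite /GRing.exp/=; apply: continuousM; exact: C1_continuous.
Qed.

Lemma C1_sqrt f : (forall x, 0 < f x) -> C1 f -> C1 (fun x => Num.sqrt (f x)).
Proof.
move=> f0 Cf.
apply: (@C1_is_derive _ (fun x => (2 * Num.sqrt (f x))^-1 * derive1 f x)) => x.
  by apply: (@is_derive1_comp _ Num.sqrt f); [exact: is_derive1_sqrt|exact: C1_derive].
apply: (@continuousM _ _ (fun x => (2 * Num.sqrt (f x))^-1)); last exact: C1_continuous'.
apply: (@continuousV _ _ (fun x => 2 * Num.sqrt (f x))).
  by rewrite mulf_neq0// gt_eqF// sqrtr_gt0.
apply: (@continuousM _ _ (fun=> 2)); first exact: cst_continuous.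
by apply: (@continuous_comp _ _ _ f Num.sqrt); [exact: C1_continuous|exact: sqrt_continuous].
Qed.

Lemma lipschitz_derive f f' (M : R) : (forall x : R, is_derive x 1 f (f' x)) ->
  forall x y : R, (forall z, Num.min x y <= z <= Num.max x y -> `|f' z| <= M) ->
  `|f x - f y| <= M * `|x - y|.
Proof.
move=> df.
have wlog_xy x y : x <= y -> (forall z, x <= z <= y -> `|f' z| <= M) ->
    `|f x - f y| <= M * `|x - y|.
  move=> xy fM; have [|c cxy fc] := @MVT_segment R f f' x y xy (fun z _ => df z).
    by apply: continuous_subspaceT => z; exact: is_derive_continuous (df z).
  rewrite distrC fc normrM [`|y - x|]distrC ler_wpM2r//.
  by apply: fM; move: cxy; rewrite in_itv.
move=> x y; have [xy|/ltW yx] := leP x y; first exact: wlog_xy.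
by rewrite distrC [`|x - y|]distrC; exact: wlog_xy.
Qed.

Lemma sin_lipschitz (x y : R) : `|sin x - sin y| <= `|x - y|.
Proof.
rewrite -[leRHS]mul1r; apply: (@lipschitz_derive _ cos) => z _; exact: cos_max.
Qed.

Lemma cos_lipschitz (x y : R) : `|cos x - cos y| <= `|x - y|.
Proof.
rewrite -[leRHS]mul1r; apply: (@lipschitz_derive _ (fun z => - sin z)) => z _.
by rewrite normrN; exact: sin_max.
Qed.

Lemma norm_sin_le (x : R) : `|sin x| <= `|x|.
Proof. by have := sin_lipschitz x 0; rewrite sin0 !subr0. Qed.

Lemma between0 (x z : R) : Num.min x 0 <= z <= Num.max x 0 -> `|z| <= `|x|.
Proof.
have [x0|x0] := leP x 0 => /andP[h1 h2].
  by rewrite !ler0_norm// lerN2.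
by rewrite !ger0_norm// ltW.
Qed.

Lemma cos_quadratic (x : R) : `|1 - cos x| <= x ^+ 2.
Proof.
rewrite distrC -{1}(@cos0 R) -[leRHS]real_normK ?num_real// expr2 -[x in _ * `|x|]subr0.
apply: (@lipschitz_derive _ (fun z => - sin z)) => z.
by move=> /between0; rewrite normrN; apply: le_trans; exact: norm_sin_le.
Qed.

Lemma sin_quadratic (x : R) : `|sin x - x| <= x ^+ 2.
Proof.
have -> : sin x - x = (sin x - x) - (sin 0 - 0) by rewrite sin0 !subr0.
rewrite -[leRHS]real_normK ?num_real// expr2 -[x in _ * `|x|]subr0.
apply: (@lipschitz_derive (fun z => sin z - z) (fun z => cos z - 1)) => z.
move=> /between0; apply: le_trans; rewrite -(@cos0 R).
by have := cos_lipschitz z 0; rewrite subr0.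
Qed.

End C1Functions.

Section MatrixNorm.
Context {R : realType}.

Lemma norm_mx_le m n (X : 'M[R]_(m, n)) (e : R) : 0 <= e ->
  (forall i j, `|X i j| <= e) -> `|X| <= e.
Proof.
move=> e0 Xe; rewrite [leLHS]/Num.norm/= mx_normrE.
by apply: bigmax_le => // -[i j] _; exact: Xe.
Qed.

Lemma norm_mx_entry m n (X : 'M[R]_(m, n)) i j : `|X i j| <= `|X|.
Proof.
rewrite [leRHS]/Num.norm/= mx_normrE.
by apply/bigmax_geP; right; exists (i, j).
Qed.

Lemma norm_mulmx m n p (X : 'M[R]_(m, n)) (Y : 'M[R]_(n, p)) :
  `|X *m Y| <= n%:R * (`|X| * `|Y|).
Proof.
apply: norm_mx_le => [|i j]; first by rewrite !mulr_ge0.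
rewrite mxE (le_trans (ler_norm_sum _ _ _))//.
apply: (@le_trans _ _ (\sum_(k < n) (`|X| * `|Y|))).
  by apply: ler_sum => k _; rewrite normrM ler_pM ?norm_mx_entry.
by rewrite sumr_const card_ord mulr_natl.
Qed.

End MatrixNorm.

(** * C1 families of matrices *)

Section C1Matrices.
Context {R : realType}.
Implicit Types (A B : R -> 'M[R]_3) (f : R -> R) (w : R).

Definition mC1 A := forall i j, C1 (fun w => A w i j).

Definition dmx A w : 'M[R]_3 := \matrix_(i, j) derive1 (fun w => A w i j) w.

(** The value and the derivative of [A] in one matrix: products of matrix
functions become products of matrices, so that a C1 estimate of a product is an
estimate in a normed algebra. *)
Definition jet A w : 'M[R]_(3 + 3) := block_mx (A w) (dmx A w) 0 (A w).

Lemma C1_sum n (F : 'I_n -> R -> R) : (forall i, C1 (F i)) ->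
  C1 (fun x => \sum_i F i x) /\
  derive1 (fun x => \sum_i F i x) = (fun x => \sum_i derive1 (F i) x).
Proof.
elim: n F => [|n ih] F CF.
  have -> : (fun x => \sum_i F i x) = (fun=> 0) by apply/funext => x; rewrite big_ord0.
  split; first exact: C1_cst.
  by rewrite derive1_cstE; apply/funext => x; rewrite big_ord0.
have [C1s dE] := ih (fun i => F (lift ord0 i)) (fun i => CF _).
have -> : (fun x => \sum_i F i x) = (fun x => F ord0 x + \sum_i F (lift ord0 i) x).
  by apply/funext => x; rewrite big_ord_recl.
split; first exact: C1_add.
rewrite derive1_add// dE; apply/funext => x; rewrite big_ord_recl//.
Qed.

Lemma mC1_mul A B : mC1 A -> mC1 B -> mC1 (fun w => A w *m B w).
Proof.
move=> CA CB i j.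
have -> : (fun w => (A w *m B w) i j) = (fun w => \sum_k A w i k * B w k j).
  by apply/funext => w; rewrite mxE.
by apply: (proj1 (C1_sum _)) => k; exact: C1_mul.
Qed.

Lemma dmx_mul A B w : mC1 A -> mC1 B ->
  dmx (fun w => A w *m B w) w = dmx A w *m B w + A w *m dmx B w.
Proof.
move=> CA CB; apply/matrixP => i j; rewrite !mxE.
have -> : (fun w => (A w *m B w) i j) = (fun w => \sum_k A w i k * B w k j).
  by apply/funext => x; rewrite mxE.
rewrite (proj2 (C1_sum (fun k => C1_mul (CA i k) (CB k j)))) -big_split/=.
by apply: eq_bigr => k _; rewrite !mxE derive1_mul.
Qed.

Lemma jet_mul A B w : mC1 A -> mC1 B ->
  jet (fun w => A w *m B w) w = jet A w *m jet B w.
Proof.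
move=> CA CB; rewrite /jet mulmx_block dmx_mul//.
by rewrite !mul0mx !mulmx0 !addr0 add0r [X in block_mx _ X _ _]addrC.
Qed.

Lemma mC1_cst (A : 'M[R]_3) : mC1 (fun=> A).
Proof. by move=> i j; exact: C1_cst. Qed.

Lemma dmx_cst (A : 'M[R]_3) w : dmx (fun=> A) w = 0.
Proof. by apply/matrixP => i j; rewrite !mxE derive1_cstE. Qed.

Lemma jet_cst (A : 'M[R]_3) w : jet (fun=> A) w = block_mx A 0 0 A.
Proof. by rewrite /jet dmx_cst. Qed.

Lemma mC1_add A B : mC1 A -> mC1 B -> mC1 (fun w => A w + B w).
Proof.
move=> CA CB i j.
have -> : (fun w => (A w + B w) i j) = (fun w => A w i j + B w i j).
  by apply/funext => w; rewrite mxE.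
exact: C1_add.
Qed.

Lemma jet_add A B w : mC1 A -> mC1 B -> jet (fun w => A w + B w) w = jet A w + jet B w.
Proof.
move=> CA CB; rewrite /jet add_block_mx addr0; congr block_mx.
apply/matrixP => i j; rewrite !mxE.
have -> : (fun w => (A w + B w) i j) = (fun w => A w i j + B w i j).
  by apply/funext => x; rewrite mxE.
by rewrite derive1_add.
Qed.

Lemma mC1_scale f (A : 'M[R]_3) : C1 f -> mC1 (fun w => f w *: A).
Proof.
move=> Cf i j.
have -> : (fun w => (f w *: A) i j) = (fun w => A i j * f w).
  by apply/funext => w; rewrite mxE mulrC.
exact: C1_scale.
Qed.

Lemma jet_scale f (A : 'M[R]_3) w : C1 f -> jet (fun w => f w *: A) w
  = f w *: block_mx A 0 0 A + derive1 f w *: block_mx 0 A 0 0.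
Proof.
move=> Cf; rewrite /jet !scale_block_mx add_block_mx !scaler0 !addr0 add0r.
congr block_mx; apply/matrixP => i j; rewrite !mxE.
have -> : (fun w => (f w *: A) i j) = (fun w => A i j * f w).
  by apply/funext => x; rewrite mxE mulrC.
by rewrite derive1_scale// mulrC.
Qed.

Lemma norm_block (A B : 'M[R]_3) (e : R) : 0 <= e -> `|A| <= e -> `|B| <= e ->
  `|block_mx A B 0 A| <= e.
Proof.
move=> e0 Ae Be; apply: norm_mx_le => // i j.
rewrite -[i]fintype.splitK -[j]fintype.splitK.
case: (fintype.split i) => i'; case: (fintype.split j) => j' /=.
- by rewrite block_mxEul (le_trans (norm_mx_entry _ _ _)).
- by rewrite block_mxEur (le_trans (norm_mx_entry _ _ _)).
- by rewrite block_mxEdl mxE normr0.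
- by rewrite block_mxEdr (le_trans (norm_mx_entry _ _ _)).
Qed.

Lemma jet_entry A B w i j : `|A w i j - B w i j| <= `|jet A w - jet B w|.
Proof.
have -> : A w i j - B w i j = (jet A w - jet B w) (lshift 3 i) (lshift 3 j).
  by rewrite /jet opp_block_mx add_block_mx block_mxEul !mxE.
exact: norm_mx_entry.
Qed.

Lemma jet_entry' A B w i j :
  `|derive1 (fun w => A w i j) w - derive1 (fun w => B w i j) w| <= `|jet A w - jet B w|.
Proof.
have -> : derive1 (fun w => A w i j) w - derive1 (fun w => B w i j) w
    = (jet A w - jet B w) (lshift 3 i) (rshift 3 j).
  by rewrite /jet opp_block_mx add_block_mx block_mxEur !mxE.
exact: norm_mx_entry.
Qed.

Lemma jet_close A B w (e : R) : 0 <= e ->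
  (forall i j, `|A w i j - B w i j| <= e) ->
  (forall i j, `|derive1 (fun w => A w i j) w - derive1 (fun w => B w i j) w| <= e) ->
  `|jet A w - jet B w| <= e.
Proof.
move=> e0 AB AB'; rewrite /jet opp_block_mx add_block_mx subrr.
apply: norm_block => //; apply: norm_mx_le => // i j; by rewrite !mxE ?AB ?AB'.
Qed.

Context (a b : R).

Lemma jet_bounded A : mC1 A ->
  exists2 K : R, 0 < K & forall w, a <= w <= b -> `|jet A w| <= K.
Proof.
move=> CA.
have /choice[K HK] (ij : 'I_3 * 'I_3) : exists K : R, 0 < K /\ forall w, a <= w <= b ->
    `|A w ij.1 ij.2| <= K /\ `|derive1 (fun w => A w ij.1 ij.2) w| <= K.
  have [K1 K10 h1] := @continuous_bounded_itv R (fun w => A w ij.1 ij.2) a b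
    (fun w _ => @C1_continuous R _ w (CA ij.1 ij.2)).
  have [K2 K20 h2] := @continuous_bounded_itv R (derive1 (fun w => A w ij.1 ij.2)) a b
    (fun w _ => @C1_continuous' R _ w (CA ij.1 ij.2)).
  exists (K1 + K2); split; first exact: addr_gt0.
  move=> w wab; split; [apply: (le_trans (h1 _ wab))|apply: (le_trans (h2 _ wab))].
    by rewrite lerDl ltW.
  by rewrite lerDr ltW.
have Kij ij : K ij <= \sum_ij K ij.
  by rewrite (bigD1 ij)//= lerDl sumr_ge0// => kl _; have [/ltW] := HK kl.
exists (\sum_ij K ij).
  by have [K0 _] := HK (ord0, ord0); exact: lt_le_trans K0 (Kij _).
have K0 : 0 <= \sum_ij K ij by apply: sumr_ge0 => kl _; have [/ltW] := HK kl.
move=> w wab; apply: norm_block => //; apply: norm_mx_le => // i j.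
  have [_ /(_ w wab)[h _]] := HK (i, j).
  exact: le_trans h (Kij (i, j)).
rewrite mxE; have [_ /(_ w wab)[_ h]] := HK (i, j).
exact: le_trans h (Kij (i, j)).
Qed.

Definition C1_close (e : R) A B := forall w, a <= w <= b -> `|jet A w - jet B w| <= e.

Lemma C1_close_trans e1 e2 A B C : C1_close e1 A B -> C1_close e2 B C -> C1_close (e1 + e2) A C.
Proof.
move=> AB BC w wab.
have -> : jet A w - jet C w = (jet A w - jet B w) + (jet B w - jet C w) by rewrite subrKA.
exact: (le_trans (ler_normD _ _) (lerD (AB w wab) (BC w wab))).
Qed.

(** The sup norm of 6 x 6 matrices is submultiplicative up to the factor 6. *)
Lemma norm_mul6 (X Y : 'M[R]_(3 + 3)) (x y : R) : `|X| <= x -> `|Y| <= y ->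
  `|X *m Y| <= 6 * (x * y).
Proof.
move=> Xx Yy; have h : `|X| * `|Y| <= x * y by apply: ler_pM.
by apply: (le_trans (norm_mulmx _ _)); exact: (ler_wpM2l (ler0n R 6) h).
Qed.

End C1Matrices.

(** * Pulses and rotations *)

Section Propagators.
Context {R : realType}.
Implicit Types (w p q t s : R).

(** The generalized Rabi frequency: the angular velocity of the rotation generated
by [gen w p q]. *)
Definition rabi w p q : R := Num.sqrt (p ^+ 2 + q ^+ 2 + w ^+ 2).

Definition gen w p q : 'M[R]_3 := w *: Omega_z + p *: Omega_x + q *: Omega_y.

(** Rodrigues' formula for [exp (t gen)]; at the singular point [rabi = 0] the
generator vanishes, and so do the terms with a division by 0. *)
Definition pulse (t p q w : R) : 'M[R]_3 :=
  1%:M + (sin (t * rabi w p q) / rabi w p q) *: gen w p q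
  + ((1 - cos (t * rabi w p q)) / rabi w p q ^+ 2) *: (gen w p q *m gen w p q).

Lemma rabi_sqr w p q : rabi w p q ^+ 2 = p ^+ 2 + q ^+ 2 + w ^+ 2.
Proof. by rewrite sqr_sqrtr// !addr_ge0 ?sqr_ge0. Qed.

Ltac mx3_ext := apply/matrixP => -[[|[|[|//]]] ?] -[[|[|[|//]]] ?];
  rewrite ?(mxE, big_ord_recl, big_ord0) /=.

Lemma mulmx3 (x11 x12 x13 x21 x22 x23 x31 x32 x33 y11 y12 y13 y21 y22 y23 y31 y32 y33 : R) :
  mx3 [:: [:: x11; x12; x13]; [:: x21; x22; x23]; [:: x31; x32; x33]] *m
  mx3 [:: [:: y11; y12; y13]; [:: y21; y22; y23]; [:: y31; y32; y33]] =
  mx3 [:: [:: x11 * y11 + x12 * y21 + x13 * y31; x11 * y12 + x12 * y22 + x13 * y32; x11 * y13 + x12 * y23 + x13 * y33];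
    [:: x21 * y11 + x22 * y21 + x23 * y31; x21 * y12 + x22 * y22 + x23 * y32; x21 * y13 + x22 * y23 + x23 * y33];
    [:: x31 * y11 + x32 * y21 + x33 * y31; x31 * y12 + x32 * y22 + x33 * y32; x31 * y13 + x32 * y23 + x33 * y33]].
Proof. by mx3_ext; ring. Qed.

Lemma scale_mx3 (k x11 x12 x13 x21 x22 x23 x31 x32 x33 : R) :
  k *: mx3 [:: [:: x11; x12; x13]; [:: x21; x22; x23]; [:: x31; x32; x33]] =
  mx3 [:: [:: k * x11; k * x12; k * x13]; [:: k * x21; k * x22; k * x23];
          [:: k * x31; k * x32; k * x33]].
Proof. by mx3_ext. Qed.

Lemma genE w p q : gen w p q = mx3 [:: [:: 0; - w; q]; [:: w; 0; - p]; [:: - q; p; 0]].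
Proof. by mx3_ext; ring. Qed.

Lemma gen_cube w p q : gen w p q *m gen w p q *m gen w p q = - (rabi w p q ^+ 2) *: gen w p q.
Proof.
rewrite genE !mulmx3 rabi_sqr scale_mx3.
by congr (mx3 [:: [:: _; _; _]; [:: _; _; _]; [:: _; _; _]]); ring.
Qed.

Lemma gen0 w p q : rabi w p q = 0 -> gen w p q = 0.
Proof.
move=> r0; have := rabi_sqr w p q; rewrite r0 expr0n/= => /esym/eqP.
rewrite paddr_eq0 ?addr_ge0 ?sqr_ge0// paddr_eq0 ?sqr_ge0// !sqrf_eq0.
move=> /andP[/andP[/eqP -> /eqP ->] /eqP ->].
by rewrite /gen !scale0r !addr0.
Qed.

Lemma pulse0 p q w : pulse 0 p q w = 1%:M.
Proof. by rewrite /pulse mul0r sin0 cos0 subrr !mul0r !scale0r !addr0. Qed.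

(** Rodrigues' formula for [exp (s Om)] when [Om ^ 3 = - Om] *)
Definition rotation (Om : 'M[R]_3) (s : R) : 'M[R]_3 :=
  1%:M + sin s *: Om + (1 - cos s) *: (Om *m Om).

Lemma rotation_xE s : rotation Omega_x s =
  mx3 [:: [:: 1; 0; 0]; [:: 0; cos s; - sin s]; [:: 0; sin s; cos s]].
Proof. by rewrite /rotation /Omega_x mulmx3; mx3_ext; ring. Qed.

Lemma rotation_yE s : rotation Omega_y s =
  mx3 [:: [:: cos s; 0; sin s]; [:: 0; 1; 0]; [:: - sin s; 0; cos s]].
Proof. by rewrite /rotation /Omega_y mulmx3; mx3_ext; ring. Qed.

Lemma rotation_zE s : rotation Omega_z s =
  mx3 [:: [:: cos s; - sin s; 0]; [:: sin s; cos s; 0]; [:: 0; 0; 1]].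
Proof. by rewrite /rotation /Omega_z mulmx3; mx3_ext; ring. Qed.

Lemma rotation0 Om : rotation Om 0 = 1%:M.
Proof. by rewrite /rotation sin0 cos0 subrr !scale0r !addr0. Qed.

Lemma Omega_x_cube : Omega_x *m Omega_x *m Omega_x = - Omega_x :> 'M[R]_3.
Proof.
rewrite /Omega_x !mulmx3 -[RHS]scaleN1r scale_mx3.
by congr (mx3 [:: [:: _; _; _]; [:: _; _; _]; [:: _; _; _]]); ring.
Qed.

Lemma Omega_y_cube : Omega_y *m Omega_y *m Omega_y = - Omega_y :> 'M[R]_3.
Proof.
rewrite /Omega_y !mulmx3 -[RHS]scaleN1r scale_mx3.
by congr (mx3 [:: [:: _; _; _]; [:: _; _; _]; [:: _; _; _]]); ring.
Qed.

Lemma Omega_z_cube : Omega_z *m Omega_z *m Omega_z = - Omega_z :> 'M[R]_3.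
Proof.
rewrite /Omega_z !mulmx3 -[RHS]scaleN1r scale_mx3.
by congr (mx3 [:: [:: _; _; _]; [:: _; _; _]; [:: _; _; _]]); ring.
Qed.

Lemma rotationD (Om : 'M[R]_3) s t : Om *m Om *m Om = - Om ->
  rotation Om s *m rotation Om t = rotation Om (s + t).
Proof.
move=> cube.
have cube' : Om *m (Om *m Om) = - Om by rewrite mulmxA.
have four : Om *m Om *m (Om *m Om) = - (Om *m Om) by rewrite mulmxA cube mulNmx.
rewrite /rotation !(mulmxDl, mulmxDr) !mul1mx !mulmx1 -!scalemxAl -!scalemxAr.
rewrite cube cube' four sinD cosD.
apply/matrixP => i j; rewrite !mxE; ring.
Qed.

Lemma rotationV (Om : 'M[R]_3) s : Om *m Om *m Om = - Om -> rotation Om s *m rotation Om (- s) = 1%:M.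
Proof. by move=> cube; rewrite rotationD// subrr rotation0. Qed.

Lemma pulse_rot (Om : 'M[R]_3) (c t p q w : R) : gen w p q = c *: Om ->
  rabi w p q = `|c| -> Om *m Om *m Om = - Om -> pulse t p q w = rotation Om (t * c).
Proof.
move=> gE rE cube; have [c0|c0] := eqVneq c 0.
  by rewrite /pulse gE c0 !scale0r mul0mx !scaler0 !addr0 mulr0 rotation0.
rewrite /pulse /rotation gE rE -scalemxAl -scalemxAr !scalerA.
congr (1%:M + _ *: _ + _ *: _).
  have [cp|cn] := leP 0 c; first by rewrite ger0_norm// divfK.
  by rewrite ltr0_norm// mulrN sinN; field.
have -> : cos (t * `|c|) = cos (t * c).
  have [cp|cn] := leP 0 c; first by rewrite ger0_norm.
  by rewrite ltr0_norm// mulrN cosN.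
by rewrite real_normK ?num_real//; field.
Qed.

Lemma pulse_drift t w : pulse t 0 0 w = rotation Omega_z (t * w).
Proof.
apply: pulse_rot; last exact: Omega_z_cube.
  by rewrite /gen !scale0r !addr0.
by rewrite /rabi expr0n/= !add0r sqrtr_sqr.
Qed.

Lemma pulse_x t p : pulse t p 0 0 = rotation Omega_x (t * p).
Proof.
apply: pulse_rot; last exact: Omega_x_cube.
  by rewrite /gen !scale0r addr0 add0r.
by rewrite /rabi expr0n/= !addr0 sqrtr_sqr.
Qed.

Lemma pulse_y t q : pulse t 0 q 0 = rotation Omega_y (t * q).
Proof.
apply: pulse_rot; last exact: Omega_y_cube.
  by rewrite /gen !scale0r !add0r.
by rewrite /rabi expr0n/= add0r addr0 sqrtr_sqr.
Qed.

(** Compressing time by [s] amounts to scaling down the frequency. *)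
Lemma pulse_scale s t p q w : 0 < s ->
  pulse (s * t) (p / s) (q / s) w = pulse t p q (s * w).
Proof.
move=> s0.
have gE : gen (s * w) p q = s *: gen w (p / s) (q / s).
  rewrite /gen !scalerDr !scalerA; congr (_ + _ *: _ + _ *: _); field; exact: lt0r_neq0.
have rE : rabi (s * w) p q = s * rabi w (p / s) (q / s).
  rewrite /rabi -[X in X * Num.sqrt _](@ger0_norm _ s) ?ltW// -sqrtr_sqr -sqrtrM ?sqr_ge0//.
  by congr Num.sqrt; field; exact: lt0r_neq0.
rewrite /pulse gE rE -scalemxAl -scalemxAr !scalerA.
have sn0 := lt0r_neq0 s0.
have -> : t * (s * rabi w (p / s) (q / s)) = s * t * rabi w (p / s) (q / s) by ring.
set r := rabi w _ _.
have [r0|r0] := eqVneq r 0.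
  by rewrite (gen0 r0) mul0mx !scaler0.
congr (1%:M + _ *: _ + _ *: _); field; rewrite ?sn0 ?r0//.
Qed.

Lemma rot_mC1 Om (f : R -> R) : C1 f -> mC1 (fun w => rotation Om (f w)).
Proof.
move=> Cf; rewrite /rotation; apply: mC1_add; first apply: mC1_add.
- exact: mC1_cst.
- by apply: mC1_scale; apply: (C1_compose C1_sin).
- apply: mC1_scale; apply: C1_add; first exact: C1_cst.
  have -> : (fun x => - cos (f x)) = (fun x => (-1) * cos (f x)).
    by apply/funext => x; rewrite mulN1r.
  by apply: C1_scale; exact: (C1_compose C1_cos).
Qed.

(** A combination of five fixed matrices: estimates of jets of rotations reduce to
estimates of the scalar coefficients. *)
Lemma jet_rot Om (f : R -> R) w : C1 f -> jet (fun w => rotation Om (f w)) w =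
  1%:M + (sin (f w) *: block_mx Om 0 0 Om
    + (derive1 f w * cos (f w)) *: block_mx 0 Om 0 0)
  + ((1 - cos (f w)) *: block_mx (Om *m Om) 0 0 (Om *m Om)
    + (derive1 f w * sin (f w)) *: block_mx 0 (Om *m Om) 0 0).
Proof.
move=> Cf.
have Csin : C1 (fun w => sin (f w)) by exact: (C1_compose C1_sin).
have Ccos' : C1 (fun w => -1 * cos (f w)) by apply: C1_scale; exact: (C1_compose C1_cos).
have E : (fun w => rotation Om (f w)) = (fun w => (1%:M + sin (f w) *: Om) +
    (1 + (-1) * cos (f w)) *: (Om *m Om)).
  by apply/funext => x; rewrite /rotation mulN1r.
have Cc : C1 (fun w => 1 + (-1) * cos (f w)) by apply: C1_add; [exact: C1_cst|].
rewrite E jet_add; last 2 first.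
- by apply: mC1_add; [exact: mC1_cst|exact: mC1_scale].
- exact: mC1_scale.
rewrite jet_add; last 2 first.
- exact: mC1_cst.
- exact: mC1_scale.
rewrite !jet_scale// jet_cst -scalar_mx_block mulN1r.
rewrite (derive1_compE C1_sin Cf) derive1_sin.
rewrite (derive1_add (C1_cst 1) Ccos') derive1_cstE add0r.
rewrite derive1_scale; last exact: (C1_compose C1_cos).
rewrite (derive1_compE C1_cos Cf) derive1_cos.
by rewrite /= !mulN1r mulNr opprK !(mulrC (derive1 f w)).
Qed.

Lemma pulse_mC1 t p q : 0 < p ^+ 2 + q ^+ 2 -> mC1 (pulse t p q).
Proof.
move=> pq0.
have r20 w : 0 < p ^+ 2 + q ^+ 2 + w ^+ 2 by rewrite ltr_wpDr ?sqr_ge0.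
have Cr2 : C1 (fun w => p ^+ 2 + q ^+ 2 + w ^+ 2).
  by apply: C1_add; [exact: C1_cst|exact: C1_exprn].
have Cr : C1 (fun w => rabi w p q) by exact: C1_sqrt.
have r0 w : 0 < rabi w p q by rewrite sqrtr_gt0.
have Cg : mC1 (fun w => gen w p q).
  rewrite /gen; apply: mC1_add; last exact: mC1_cst.
  by apply: mC1_add; [exact: mC1_scale C1_id|exact: mC1_cst].
have CrV : C1 (fun w => (rabi w p q)^-1) by exact: C1_inv.
have Ctr : C1 (fun w => t * rabi w p q) by exact: C1_scale.
have mC1_fscale (f : R -> R) (A : R -> 'M[R]_3) : C1 f -> mC1 A -> mC1 (fun w => f w *: A w).
  move=> Cf CA i j; have -> : (fun w => (f w *: A w) i j) = (fun w => f w * A w i j).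
    by apply/funext => w; rewrite mxE.
  exact: (C1_mul Cf (CA i j)).
rewrite /pulse; apply: mC1_add; first apply: mC1_add.
- exact: mC1_cst.
- exact: (mC1_fscale _ _ (C1_mul (C1_compose C1_sin Ctr) CrV) Cg).
- apply: mC1_fscale; last exact: (mC1_mul Cg Cg).
  have -> : (fun w => (1 - cos (t * rabi w p q)) / rabi w p q ^+ 2)
      = (fun w => (1 + (-1) * cos (t * rabi w p q)) * ((rabi w p q)^-1 * (rabi w p q)^-1)).
    by apply/funext => w; rewrite mulN1r expr2 invfM.
  apply: C1_mul; last exact: (C1_mul CrV CrV).
  exact: (C1_add (C1_cst 1) (C1_scale (-1) (C1_compose C1_cos Ctr))).
Qed.

End Propagators.

(** * Attainable families of propagators *)

Section Attainable.
Context {R : realType} (a b : R).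
Implicit Types (A B H : R -> 'M[R]_3) (f g : R -> R).
Local Notation C1_close := (C1_close a b).

(** A sequence of constant controls [(duration, u, v)], the last one first. *)
Fixpoint propagator (l : seq (R * R * R)) (w : R) : 'M[R]_3 :=
  if l is x :: l' then pulse x.1.1 x.1.2 x.2 w *m propagator l' w else 1%:M.

Definition durations_ge0 (l : seq (R * R * R)) := all (fun x => 0 <= x.1.1) l.

Lemma propagator_cat l1 l2 w :
  propagator (l1 ++ l2) w = propagator l1 w *m propagator l2 w.
Proof. by elim: l1 => [|x l ih] /=; rewrite ?mul1mx// ih mulmxA. Qed.

(** The closure, in C1([a, b]), of the propagators of piecewise constant
controls *)
Definition attainable A := mC1 A /\ forall e : R, 0 < e -> exists l,
  [/\ durations_ge0 l, mC1 (propagator l) & C1_close e A (propagator l)].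

Lemma attainable_lim A : mC1 A ->
  (forall e : R, 0 < e -> exists2 B, attainable B & C1_close e A B) -> attainable A.
Proof.
move=> CA AB; split => // e e0; have e20 : 0 < e / 2 by rewrite divr_gt0.
have [B [_ HB] cAB] := AB _ e20; have [l [l0 Cl cBl]] := HB _ e20.
by exists l; split => //; rewrite [e]splitr; exact: C1_close_trans cAB cBl.
Qed.

Lemma attainable_mul A B : attainable A -> attainable B ->
  attainable (fun w => A w *m B w).
Proof.
move=> [CA HA] [CB HB]; split; first exact: mC1_mul.
move=> e e0.
have [KA KA0 AK] := jet_bounded a b CA; have [KB KB0 BK] := jet_bounded a b CB.
pose d := Num.min 1 (e / (6 * (KA + KB + 1))).
have K1 : 0 < 6 * (KA + KB + 1) by rewrite mulr_gt0// !addr_gt0.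
have d0 : 0 < d by rewrite lt_min ltr01 divr_gt0.
have d1 : d <= 1 by rewrite ge_min lexx.
have de : d * (6 * (KA + KB + 1)) <= e.
  by rewrite -ler_pdivlMr// ge_min lexx orbT.
have [l1 [l10 C1l cl1]] := HA _ d0; have [l2 [l20 C2l cl2]] := HB _ d0.
exists (l1 ++ l2).
have E : propagator (l1 ++ l2) = (fun w => propagator l1 w *m propagator l2 w).
  by apply/funext => w; rewrite propagator_cat.
split; first by rewrite /durations_ge0 all_cat; apply/andP.
  by rewrite E; exact: mC1_mul.
move=> w wab; rewrite E !jet_mul//.
have -> : jet A w *m jet B w - jet (propagator l1) w *m jet (propagator l2) w =
   (jet A w - jet (propagator l1) w) *m jet B w
   + jet (propagator l1) w *m (jet B w - jet (propagator l2) w).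
  by rewrite mulmxBl mulmxBr subrKA.
have h1 : `|jet (propagator l1) w| <= KA + 1.
  have -> : jet (propagator l1) w = jet A w - (jet A w - jet (propagator l1) w).
    by rewrite subKr.
  by rewrite (le_trans (ler_normB _ _))// lerD ?AK// (le_trans (cl1 _ wab)).
have h2 := norm_mul6 (cl1 w wab) (BK w wab).
have h3 := norm_mul6 h1 (cl2 w wab).
rewrite (le_trans (ler_normD _ _))// (le_trans (lerD h2 h3))//.
apply: le_trans de; nra.
Qed.

Lemma attainable_pulse t p q : 0 <= t -> mC1 (pulse t p q) -> attainable (pulse t p q).
Proof.
move=> t0 Cp; split => // e e0; exists [:: (t, p, q)].
have -> : propagator [:: (t, p, q)] = pulse t p q.
  by apply/funext => w /=; rewrite mulmx1.
by split => //; [rewrite /durations_ge0/= t0|move=> w _; rewrite subrr normr0 ltW].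
Qed.

(** The derivative of [A (s w)] carries a factor [s]. *)
Lemma scaling_close A : mC1 A -> forall e : R, 0 < e ->
  exists2 s : R, 0 < s & C1_close e (fun=> A 0) (fun w => A (s * w)).
Proof.
move=> CA e e0.
pose K := `|a| + `|b| + 1.
have K0 : 0 < K by rewrite ltr_wpDl// addr_ge0.
have wK w : a <= w <= b -> `|w| < K.
  move=> /andP[aw wb]; rewrite /K ltr_pwDr// ler_norml; apply/andP; split.
    rewrite opprD (@le_trans _ _ a)// -[leRHS]addr0 lerD ?oppr_le0//.
    by rewrite lerNl -normrN ler_norm.
  by rewrite (le_trans wb)// (le_trans (ler_norm b))// lerDr.
have small ij : \forall s \near (0 : R)^'+, forall w, a <= w <= b ->
    `|A (s * w) ij.1 ij.2 - A 0 ij.1 ij.2| <= e /\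
    `|derive1 (fun w => A w ij.1 ij.2) (s * w) * s| <= e.
  have Cij := CA ij.1 ij.2.
  have /cvgrPdist_le/(_ e e0)/nbhs_ballP[d1 /= d10 h1] := C1_continuous (x := 0) Cij.
  have /cvgrPdist_le/(_ 1 ltr01)/nbhs_ballP[d2 /= d20 h2] := C1_continuous' (x := 0) Cij.
  pose M := `|derive1 (fun w => A w ij.1 ij.2) 0| + 1.
  have M0 : 0 < M by rewrite ltr_wpDl.
  near=> s => w wab.
  have s0 : 0 < s by [].
  have swK : `|s * w| < s * K by rewrite normrM gtr0_norm// ltr_pM2l// wK.
  split.
    rewrite distrC; apply: h1; rewrite /ball/= sub0r normrN (lt_le_trans swK)//.
    rewrite -ler_pdivlMr//; near: s; apply: nbhs_right_le; exact: divr_gt0.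
  have sM : s * M <= e.
    rewrite -ler_pdivlMr//; near: s; apply: nbhs_right_le; exact: divr_gt0.
  rewrite normrM (gtr0_norm s0) mulrC (le_trans _ sM)// ler_pM2l//.
  have := h2 (s * w); rewrite /ball/= sub0r normrN => h2'.
  rewrite /M -lerBlDl (le_trans (lerB_dist _ _))// distrC; apply: h2'.
  rewrite (lt_le_trans swK)//.
  rewrite -ler_pdivlMr//; near: s; apply: nbhs_right_le; exact: divr_gt0.
have [s s0 hs] : exists2 s : R, 0 < s & forall ij, forall w, a <= w <= b ->
    `|A (s * w) ij.1 ij.2 - A 0 ij.1 ij.2| <= e /\
    `|derive1 (fun w => A w ij.1 ij.2) (s * w) * s| <= e.
  have : \forall s \near (0 : R)^'+, forall ij, forall w, a <= w <= b ->
    `|A (s * w) ij.1 ij.2 - A 0 ij.1 ij.2| <= e /\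
    `|derive1 (fun w => A w ij.1 ij.2) (s * w) * s| <= e by exact: filter_forall.
  move=> /nbhs_ballP[d /= d0 hd]; exists (d / 2); first exact: divr_gt0.
  apply: hd; rewrite /= ?divr_gt0// /ball/= sub0r normrN gtr0_norm ?divr_gt0//.
  by rewrite ltr_pdivrMr// ltr_pMr// ltr1n.
exists s => // w wab; apply: jet_close; first exact: ltW.
  by move=> i j; rewrite distrC; have [] := hs (i, j) w wab.
move=> i j; rewrite derive1_cstE sub0r normrN.
rewrite (derive1_compE (CA i j) (C1_scale s C1_id)) derive1_scale; last exact: C1_id.
by rewrite derive1_idE mulr1; have [] := hs (i, j) w wab.
Unshelve. all: by end_near. Qed.

(** A short and strong pulse is nearly insensitive to the frequency: it is a pulse
of unit length at the frequency [s w], with [s] small. *)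
Lemma attainable_strong p q : 0 < p ^+ 2 + q ^+ 2 ->
  attainable (fun=> pulse 1 p q 0).
Proof.
move=> pq; have Cp := pulse_mC1 1 pq.
split; first exact: mC1_cst.
move=> e e0; have [s s0 hs] := scaling_close Cp e0.
have E : propagator [:: (s * 1, p / s, q / s)] = (fun w => pulse 1 p q (s * w)).
  by apply/funext => w /=; rewrite mulmx1 pulse_scale.
exists [:: (s * 1, p / s, q / s)]; split.
- by rewrite /durations_ge0/= mulr1 ltW.
- move=> i j; rewrite E.
  exact: (C1_compose (Cp i j) (C1_scale s C1_id)).
- by rewrite E.
Qed.

Lemma attainable1 : attainable (fun=> 1%:M).
Proof.
split; first exact: mC1_cst.
move=> e e0; exists [::]; split => //; first exact: mC1_cst.
by move=> w _; rewrite subrr normr0 ltW.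
Qed.

Lemma attainable_rot_x (s : R) : attainable (fun=> rotation Omega_x s).
Proof.
have [->|s0] := eqVneq s 0; first by rewrite rotation0; exact: attainable1.
have := @attainable_strong s 0; rewrite pulse_x mul1r; apply.
by rewrite expr0n addr0 exprn_even_gt0.
Qed.

Lemma attainable_rot_y (s : R) : attainable (fun=> rotation Omega_y s).
Proof.
have [->|s0] := eqVneq s 0; first by rewrite rotation0; exact: attainable1.
have := @attainable_strong 0 s; rewrite pulse_y mul1r; apply.
by rewrite expr0n add0r exprn_even_gt0.
Qed.

Lemma rot_z_conj (s : R) : rotation Omega_y (- (pi / 2)) *m rotation Omega_x s *m rotation Omega_y (pi / 2)
  = rotation Omega_z s.
Proof.
rewrite rotation_xE rotation_zE !rotation_yE sinN cosN sin_pihalf cos_pihalf !mulmx3.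
by congr (mx3 [:: [:: _; _; _]; [:: _; _; _]; [:: _; _; _]]); ring.
Qed.

Lemma attainable_rot_z (s : R) : attainable (fun=> rotation Omega_z s).
Proof.
rewrite -rot_z_conj.
apply: (@attainable_mul (fun=> _) (fun=> _)); last exact: attainable_rot_y.
apply: (@attainable_mul (fun=> _) (fun=> _)); last exact: attainable_rot_x.
exact: attainable_rot_y.
Qed.

Lemma rot_z_reverse (s : R) :
  rotation Omega_x pi *m rotation Omega_z s *m rotation Omega_x pi = rotation Omega_z (- s).
Proof.
rewrite rotation_xE !rotation_zE sinN cosN sinpi cospi !mulmx3.
by congr (mx3 [:: [:: _; _; _]; [:: _; _; _]; [:: _; _; _]]); ring.
Qed.

(** The drift can be run backwards: a rotation of angle [pi] about the first
axis before and after it reverses the precession. *)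
Lemma attainable_drift (t phi : R) : attainable (fun w => rotation Omega_z (t * w + phi)).
Proof.
have pos s : 0 <= s -> attainable (fun w => rotation Omega_z (s * w)).
  move=> s0; have E : (fun w => rotation Omega_z (s * w)) = pulse s 0 0.
    by apply/funext => w; rewrite pulse_drift.
  rewrite E; apply: attainable_pulse => //; rewrite -E.
  by apply: rot_mC1; exact: C1_scale C1_id.
have any : attainable (fun w => rotation Omega_z (t * w)).
  have [t0|/ltW t0] := leP 0 t; first exact: pos.
  have -> : (fun w => rotation Omega_z (t * w)) =
      (fun w => rotation Omega_x pi *m rotation Omega_z (- t * w) *m rotation Omega_x pi).
    by apply/funext => w; rewrite rot_z_reverse mulNr opprK.
  apply: (@attainable_mul _ (fun=> _)); last exact: attainable_rot_x.
  apply: (@attainable_mul (fun=> _)); first exact: attainable_rot_x.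
  by apply: pos; rewrite oppr_ge0.
have -> : (fun w => rotation Omega_z (t * w + phi)) =
    (fun w => rotation Omega_z (t * w) *m rotation Omega_z phi).
  by apply/funext => w; rewrite rotationD//; exact: Omega_z_cube.
by apply: (@attainable_mul _ (fun=> _)) => //; exact: attainable_rot_z.
Qed.

(** [H] is an infinitesimal generator of the attainable set, at second order and
uniformly in C1([a, b]). *)
Definition tangent H := mC1 H /\ exists P : R -> R -> 'M[R]_3, exists C : R,
  forall e : R, 0 < e <= 1 -> attainable (P e) /\ forall w, a <= w <= b ->
    `|jet (P e) w - 1%:M - e *: jet H w| <= C * e ^+ 2.

(** The product of the two propagators has the sum of their generators at first
order; the constant collects the six remaining terms. *)
Lemma tangent_add H1 H2 : tangent H1 -> tangent H2 -> tangent (fun w => H1 w + H2 w).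
Proof.
move=> [C1H [P1 [c1 HP1]]] [C2H [P2 [c2 HP2]]]; split; first exact: mC1_add.
have [K1 K10 H1K] := jet_bounded a b C1H; have [K2 K20 H2K] := jet_bounded a b C2H.
exists (fun e w => P1 e w *m P2 e w).
exists (c1 + c2 + 6 * (`|c1| * K2) + 6 * (K1 * `|c2|) + 6 * (`|c1| * `|c2|) + 6 * (K1 * K2)).
move=> e /[dup] e01 /andP[e0 e1].
have [a1 h1] := HP1 e e01; have [a2 h2] := HP2 e e01.
split; first exact: attainable_mul.
have [[Cp1 _] [Cp2 _]] := (a1, a2).
move=> w wab; rewrite jet_mul// jet_add//.
have := h1 w wab; have := h2 w wab.
set X1 := jet (P1 e) w; set X2 := jet (P2 e) w; set Y1 := jet H1 w; set Y2 := jet H2 w.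
set r1 := X1 - _ - _; set r2 := X2 - _ - _ => r2e r1e.
have X1E : X1 = 1%:M + e *: Y1 + r1.
  have -> : r1 = X1 - (1%:M + e *: Y1) by rewrite opprD addrA.
  by rewrite addrC subrK.
have X2E : X2 = 1%:M + e *: Y2 + r2.
  have -> : r2 = X2 - (1%:M + e *: Y2) by rewrite opprD addrA.
  by rewrite addrC subrK.
clearbody r1 r2.
have E : X1 *m X2 - 1%:M - e *: (Y1 + Y2) = r1 + r2 + e *: (r1 *m Y2) + e *: (Y1 *m r2)
    + r1 *m r2 + e ^+ 2 *: (Y1 *m Y2).
  rewrite X1E X2E !(mulmxDl, mulmxDr) !mul1mx !mulmx1 -!scalemxAl -!scalemxAr scalerA.
  move: (r1 *m Y2) (Y1 *m r2) (r1 *m r2) (Y1 *m Y2) (1%:M : 'M[R]_(3 + 3)).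
  move=> r1Y2 Y1r2 r1r2 Y1Y2 id; apply/matrixP => i j; rewrite !mxE; ring.
have e2 : 0 <= e ^+ 2 by rewrite sqr_ge0.
have r1e' : `|r1| <= `|c1| * e ^+ 2 by rewrite (le_trans r1e)// ler_wpM2r// ler_norm.
have r2e' : `|r2| <= `|c2| * e ^+ 2 by rewrite (le_trans r2e)// ler_wpM2r// ler_norm.
have t1 := norm_mul6 r1e' (H2K w wab).
have t2 := norm_mul6 (H1K w wab) r2e'.
have t3 := norm_mul6 r1e' r2e'.
have t4 := norm_mul6 (H1K w wab) (H2K w wab).
have ee : e ^+ 2 * e ^+ 2 <= e ^+ 2 by rewrite ler_piMr// exprn_ile1// ltW.
have n1 := normr_ge0 (r1 *m Y2); have n2 := normr_ge0 (Y1 *m r2).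
have u1 : e * `|r1 *m Y2| <= 6 * (`|c1| * K2) * e ^+ 2.
  have : e * `|r1 *m Y2| <= `|r1 *m Y2| by rewrite ler_piMl.
  by move=> /le_trans; apply; apply: (le_trans t1); rewrite le_eqVlt; apply/orP; left; apply/eqP; ring.
have u2 : e * `|Y1 *m r2| <= 6 * (K1 * `|c2|) * e ^+ 2.
  have : e * `|Y1 *m r2| <= `|Y1 *m r2| by rewrite ler_piMl.
  by move=> /le_trans; apply; apply: (le_trans t2); rewrite le_eqVlt; apply/orP; left; apply/eqP; ring.
have u3 : `|r1 *m r2| <= 6 * (`|c1| * `|c2|) * e ^+ 2.
  apply: (le_trans t3).
  have -> : 6 * (`|c1| * e ^+ 2 * (`|c2| * e ^+ 2)) = 6 * (`|c1| * `|c2|) * (e ^+ 2 * e ^+ 2) by ring.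
  by rewrite ler_wpM2l// !mulr_ge0.
have u4 : e ^+ 2 * `|Y1 *m Y2| <= 6 * (K1 * K2) * e ^+ 2 by rewrite mulrC ler_wpM2r.
have -> : (c1 + c2 + 6 * (`|c1| * K2) + 6 * (K1 * `|c2|) + 6 * (`|c1| * `|c2|) + 6 * (K1 * K2)) * e ^+ 2
  = c1 * e ^+ 2 + c2 * e ^+ 2 + 6 * (`|c1| * K2) * e ^+ 2 + 6 * (K1 * `|c2|) * e ^+ 2
  + 6 * (`|c1| * `|c2|) * e ^+ 2 + 6 * (K1 * K2) * e ^+ 2 by ring.
rewrite E.
apply: (le_trans (ler_normD _ _)); apply: lerD; last by rewrite normrZ (ger0_norm e2).
apply: (le_trans (ler_normD _ _)); apply: lerD; last exact: u3.
apply: (le_trans (ler_normD _ _)); apply: lerD; last by rewrite normrZ (gtr0_norm e0).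
apply: (le_trans (ler_normD _ _)); apply: lerD; last by rewrite normrZ (gtr0_norm e0).
by apply: (le_trans (ler_normD _ _)); apply: lerD.
Qed.

Lemma tangent_conj H B B' : attainable B -> attainable B' ->
  (forall w, B w *m B' w = 1%:M) -> tangent H -> tangent (fun w => B w *m H w *m B' w).
Proof.
move=> aB aB' BB' [CH [P [c HP]]].
have [[CB _] [CB' _]] := (aB, aB').
split; first by apply: mC1_mul => //; exact: mC1_mul.
have [K K0 BK] := jet_bounded a b CB; have [K' K'0 B'K] := jet_bounded a b CB'.
exists (fun e w => B w *m P e w *m B' w); exists (6 * (6 * (K * c) * K')).
move=> e e01; have [aP hP] := HP e e01; have [CP _] := aP.
split; first by apply: attainable_mul => //; exact: attainable_mul.
move=> w wab; rewrite !(@jet_mul _ (fun w => B w *m _ w))//; try exact: mC1_mul.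
rewrite !jet_mul//.
have BB'J : jet B w *m jet B' w = 1%:M.
  rewrite -jet_mul//; have -> : (fun w => B w *m B' w) = (fun=> 1%:M) by apply/funext.
  by rewrite jet_cst -scalar_mx_block.
have -> : jet B w *m jet (P e) w *m jet B' w - 1%:M - e *: (jet B w *m jet H w *m jet B' w)
    = jet B w *m (jet (P e) w - 1%:M - e *: jet H w) *m jet B' w.
  rewrite !(mulmxBr, mulmxBl) mulmx1 BB'J.
  by rewrite -scalemxAr -scalemxAl.
have t := norm_mul6 (norm_mul6 (BK w wab) (hP w wab)) (B'K w wab).
rewrite (le_trans t)// le_eqVlt; apply/orP; left; apply/eqP; ring.
Qed.

End Attainable.

(** * Lie's product formula *)

Section Trotter.
Context {R : realType} (a b : R).
Implicit Types (A B H : R -> 'M[R]_3) (f g : R -> R) (Om : 'M[R]_3).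
Local Notation attainable := (attainable a b).
Local Notation tangent := (tangent a b).

(** Bounds the five matrices that appear in [jet_rot]. *)
Definition jet_size Om : R := `|(1%:M : 'M[R]_(3 + 3))| + `|block_mx Om 0 0 Om|
  + `|block_mx (0 : 'M[R]_3) Om (0 : 'M[R]_3) (0 : 'M[R]_3)| + `|block_mx (Om *m Om) 0 0 (Om *m Om)|
  + `|block_mx (0 : 'M[R]_3) (Om *m Om) (0 : 'M[R]_3) (0 : 'M[R]_3)|.

Lemma norm_jet_comb Om (c0 c1 c2 c3 c4 : R) :
  `|c0 *: (1%:M : 'M[R]_(3 + 3))
    + (c1 *: block_mx Om 0 0 Om + c2 *: block_mx 0 Om 0 0)
    + (c3 *: block_mx (Om *m Om) 0 0 (Om *m Om) + c4 *: block_mx 0 (Om *m Om) 0 0)|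
  <= jet_size Om * (`|c0| + `|c1| + `|c2| + `|c3| + `|c4|).
Proof.
rewrite /jet_size.
set X0 := (1%:M : 'M[R]_(3 + 3)); set X1 := block_mx Om _ _ _; set X2 := block_mx _ Om _ _.
set X3 := block_mx (Om *m Om) _ _ _; set X4 := block_mx _ (Om *m Om) _ _.
have h : `|c0 *: X0 + (c1 *: X1 + c2 *: X2) + (c3 *: X3 + c4 *: X4)| <=
   `|c0| * `|X0| + (`|c1| * `|X1| + `|c2| * `|X2|) + (`|c3| * `|X3| + `|c4| * `|X4|).
  rewrite -!normrZ; apply: (le_trans (ler_normD _ _)); apply: lerD; last exact: ler_normD.
  by apply: (le_trans (ler_normD _ _)); apply: lerD => //; exact: ler_normD.
apply: (le_trans h).
have := normr_ge0 X0; have := normr_ge0 X1; have := normr_ge0 X2; have := normr_ge0 X3.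
have := normr_ge0 X4; have := normr_ge0 c0; have := normr_ge0 c1; have := normr_ge0 c2.
have := normr_ge0 c3; have := normr_ge0 c4.
move: `|X0| `|X1| `|X2| `|X3| `|X4| `|c0| `|c1| `|c2| `|c3| `|c4| => x0 x1 x2 x3 x4 y0 y1 y2 y3 y4 *.
have := mulr_ge0; nra.
Qed.

Lemma jet_size_ge0 Om : 0 <= jet_size Om.
Proof. by rewrite !addr_ge0. Qed.

Lemma jet_rot_expansion Om f (F e w : R) : C1 f -> 0 < e <= 1 ->
  `|f w| <= F -> `|derive1 f w| <= F ->
  `|jet (fun w => rotation Om (e * f w)) w - 1%:M - e *: jet (fun w => f w *: Om) w|
    <= jet_size Om * (3 * F ^+ 2 + F ^+ 3) * e ^+ 2.
Proof.
move=> Cf /andP[e0 e1] fF f'F.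
have F0 : 0 <= F by exact: le_trans fF.
have Cef : C1 (fun w => e * f w) by exact: C1_scale.
rewrite jet_rot// jet_scale// derive1_scale//.
set g := f w; set g' := derive1 f w; rewrite -/g -/g' in fF f'F.
set X1 := block_mx Om _ _ _; set X2 := block_mx _ Om _ _.
set X3 := block_mx (Om *m Om) _ _ _; set X4 := block_mx _ (Om *m Om) _ _.
have -> : 1%:M + (sin (e * g) *: X1 + (e * g' * cos (e * g)) *: X2)
   + ((1 - cos (e * g)) *: X3 + (e * g' * sin (e * g)) *: X4) - 1%:M
   - e *: (g *: X1 + g' *: X2)
   = 0 *: (1%:M : 'M[R]_(3 + 3)) + ((sin (e * g) - e * g) *: X1
     + (- (e * g' * (1 - cos (e * g)))) *: X2)
   + ((1 - cos (e * g)) *: X3 + (e * g' * sin (e * g)) *: X4).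
  move: X1 X2 X3 X4 (1%:M : 'M[R]_(3 + 3)) => X1 X2 X3 X4 id.
  apply/matrixP => i j; rewrite !mxE; ring.
apply: (le_trans (norm_jet_comb _ _ _ _ _ _)); rewrite -[leRHS]mulrA.
apply: ler_wpM2l; first exact: jet_size_ge0.
rewrite normr0 add0r normrN !normrM (gtr0_norm e0).
have eg2 : (e * g) ^+ 2 <= F ^+ 2 * e ^+ 2.
  rewrite exprMn mulrC ler_wpM2r ?sqr_ge0//.
  by rewrite -[leLHS]real_normK ?num_real// lerXn2r ?nnegrE.
have s1 := le_trans (sin_quadratic (e * g)) eg2.
have s2 := le_trans (cos_quadratic (e * g)) eg2.
have s3 : `|sin (e * g)| <= e * F.
  by rewrite (le_trans (norm_sin_le _))// normrM (gtr0_norm e0) ler_pM2l.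
have s4 : e * `|g'| * `|1 - cos (e * g)| <= F ^+ 3 * e ^+ 2.
  have -> : F ^+ 3 * e ^+ 2 = F * (F ^+ 2 * e ^+ 2) by ring.
  apply: ler_pM => //; first by rewrite mulr_ge0// ltW.
  by rewrite (le_trans _ f'F)// ler_piMl.
have s5 : e * `|g'| * `|sin (e * g)| <= F ^+ 2 * e ^+ 2.
  have -> : F ^+ 2 * e ^+ 2 = (e * F) * (e * F) by ring.
  apply: ler_pM => //; first by rewrite mulr_ge0// ltW.
  by rewrite ler_pM2l.
lra.
Qed.

Lemma jet_rot_bounded Om f (F w : R) : C1 f -> `|derive1 f w| <= F ->
  `|jet (fun w => rotation Om (f w)) w| <= jet_size Om * (4 + 2 * F).
Proof.
move=> Cf f'F; rewrite jet_rot//.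
have -> : (1%:M : 'M[R]_(3 + 3)) = 1 *: 1%:M by rewrite scale1r.
apply: (le_trans (norm_jet_comb _ _ _ _ _ _)); apply: ler_wpM2l; first exact: jet_size_ge0.
rewrite normr1 !normrM.
have h1 := sin_max (f w); have h2 := cos_max (f w).
have h3 : `|1 - cos (f w)| <= 2.
  by rewrite (le_trans (ler_normB _ _))// normr1 [2]mulr2n lerD2l.
have h4 : `|derive1 f w| * `|cos (f w)| <= F by rewrite (le_trans _ f'F)// ler_piMr.
have h5 : `|derive1 f w| * `|sin (f w)| <= F by rewrite (le_trans _ f'F)// ler_piMr.
lra.
Qed.

Lemma jet_rot_lipschitz Om f g (w : R) : C1 f -> C1 g ->
  `|jet (fun w => rotation Om (f w)) w - jet (fun w => rotation Om (g w)) w| <=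
  jet_size Om * (2 * (`|f w - g w| + `|derive1 f w| * `|f w - g w|
                      + `|derive1 f w - derive1 g w|)).
Proof.
move=> Cf Cg; rewrite !jet_rot//.
set X1 := block_mx Om _ _ _; set X2 := block_mx _ Om _ _.
set X3 := block_mx (Om *m Om) _ _ _; set X4 := block_mx _ (Om *m Om) _ _.
set x := f w; set y := g w; set x' := derive1 f w; set y' := derive1 g w.
have -> : 1%:M + (sin x *: X1 + (x' * cos x) *: X2)
   + ((1 - cos x) *: X3 + (x' * sin x) *: X4) -
   (1%:M + (sin y *: X1 + (y' * cos y) *: X2)
   + ((1 - cos y) *: X3 + (y' * sin y) *: X4))
   = 0 *: (1%:M : 'M[R]_(3 + 3)) + ((sin x - sin y) *: X1
     + (x' * (cos x - cos y) + (x' - y') * cos y) *: X2)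
   + ((cos y - cos x) *: X3 + (x' * (sin x - sin y) + (x' - y') * sin y) *: X4).
  move: X1 X2 X3 X4 (1%:M : 'M[R]_(3 + 3)) => X1 X2 X3 X4 id.
  apply/matrixP => i j; rewrite !mxE; ring.
apply: (le_trans (norm_jet_comb _ _ _ _ _ _)); apply: ler_wpM2l; first exact: jet_size_ge0.
rewrite normr0 add0r.
have h1 := sin_lipschitz x y; have h2 := cos_lipschitz x y.
have h2' : `|cos y - cos x| <= `|x - y| by rewrite distrC.
have h3 : `|x' * (cos x - cos y) + (x' - y') * cos y| <= `|x'| * `|x - y| + `|x' - y'|.
  rewrite (le_trans (ler_normD _ _))// !normrM lerD//; first exact: ler_wpM2l.
  by rewrite ler_piMr// cos_max.
have h4 : `|x' * (sin x - sin y) + (x' - y') * sin y| <= `|x'| * `|x - y| + `|x' - y'|.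
  rewrite (le_trans (ler_normD _ _))// !normrM lerD//; first exact: ler_wpM2l.
  by rewrite ler_piMr// sin_max.
lra.
Qed.

Lemma sub_shift (V : zmodType) (x y z t : V) : x - z - t - (y - z - t) = x - y.
Proof. by rewrite -(addrA x) -(addrA y) -opprD opprB addrA subrK. Qed.

Lemma discrete_gronwall (d : nat -> R) (L c : R) : 0 <= L -> 0 <= c -> d 0%N <= 0 ->
  forall N, (forall k, (k < N)%N -> d k.+1 <= (1 + L) * d k + c) ->
  d N <= N%:R * c * (1 + L) ^+ N.
Proof.
move=> L0 c0 d0; elim=> [|N ih] dS; first by rewrite !mul0r.
have L1 : 1 <= 1 + L by rewrite lerDl.
apply: (le_trans (dS N (ltnSn N))).
have {}ih : d N <= N%:R * c * (1 + L) ^+ N by apply: ih => k kN; apply: dS; exact: ltnW.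
have h : 1 <= (1 + L) ^+ N.+1 by apply: exprn_ege1.
have -> : N.+1%:R * c * (1 + L) ^+ N.+1
    = (1 + L) * (N%:R * c * (1 + L) ^+ N) + c * (1 + L) ^+ N.+1.
  by rewrite -natr1 exprS; ring.
by apply: lerD; [apply: ler_wpM2l => //; exact: le_trans L1|rewrite ler_peMr].
Qed.

Fixpoint mxpow A (n : nat) : R -> 'M[R]_3 :=
  if n is n'.+1 then fun w => mxpow A n' w *m A w else fun=> 1%:M.

Lemma attainable_pow A n : attainable A -> attainable (mxpow A n).
Proof.
by move=> aA; elim: n => [|n ih] /=; [exact: attainable1|exact: attainable_mul].
Qed.

(** Lie's product formula: [n] steps of length [1 / n] along a tangent direction
[f Om] approach the rotation of angle [f]. With [D k] the distance in C1
between the [k]-th powers, one step multiplies [D k] by at most [1 + L / n] and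
adds an error of order [1 / n ^ 2]; the powers of the rotation stay bounded in C1,
being rotations of angle between 0 and [f]. *)
Lemma attainable_exp Om f : Om *m Om *m Om = - Om -> C1 f ->
  tangent (fun w => f w *: Om) -> attainable (fun w => rotation Om (f w)).
Proof.
move=> cube Cf [CH [P [c HP]]].
have CP e : 0 < e <= 1 -> mC1 (P e) by move=> /HP[[]].
apply: attainable_lim; first exact: rot_mC1.
move=> d d0.
have [K K0 HK] := jet_bounded a b CH.
have [F1 F10 fF1] := @continuous_bounded_itv R f a b (fun w _ => @C1_continuous R f w Cf).
have [F2 F20 fF2] := @continuous_bounded_itv R (derive1 f) a b
  (fun w _ => @C1_continuous' R f w Cf).
pose F := F1 + F2.
have fF w : a <= w <= b -> `|f w| <= F.
  by move=> /fF1 /le_trans; apply; rewrite lerDl ltW.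
have f'F w : a <= w <= b -> `|derive1 f w| <= F.
  by move=> /fF2 /le_trans; apply; rewrite lerDr ltW.
have F0 : 0 <= F by rewrite addr_ge0// ltW.
have js0 := jet_size_ge0 Om.
pose C := `|c| + jet_size Om * (3 * F ^+ 2 + F ^+ 3).
have C0 : 0 <= C by rewrite addr_ge0// mulr_ge0// addr_ge0 ?mulr_ge0 ?exprn_ge0.
pose KQ := jet_size Om * (4 + 2 * F).
have KQ0 : 0 <= KQ by rewrite mulr_ge0// addr_ge0// mulr_ge0.
pose L := 6 * (K + `|c|).
have L0 : 0 <= L by rewrite mulr_ge0// addr_ge0// ltW.
pose M := 6 * (KQ * C) * expR L.
pose N := (Num.truncn (M / d)).+1.
have N0 : 0 < N%:R :> R by rewrite ltr0n.
pose e : R := N%:R^-1.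
have e0 : 0 < e by rewrite invr_gt0.
have e1 : e <= 1 by rewrite invf_le1// ler1n.
have e01 : 0 < e <= 1 by rewrite e0.
exists (mxpow (P e) N); first by apply: attainable_pow; have [] := HP e e01.
pose Q (k : nat) w := rotation Om (k%:R * e * f w).
have CQ k : C1 (fun w => k%:R * e * f w) by exact: C1_scale.
have CmQ k : mC1 (Q k) by exact: rot_mC1.
have QN : Q N = (fun w => rotation Om (f w)).
  by apply/funext => w; rewrite /Q /e mulfV ?mul1r// gt_eqF.
have QS k w : jet (Q k.+1) w = jet (Q k) w *m jet (Q 1%N) w.
  rewrite -jet_mul//; congr jet; apply/funext => x; rewrite /Q rotationD//.
  by congr rotation; rewrite -natr1; ring.
have CPk k : mC1 (mxpow (P e) k).
  by elim: k => [|k ih] /=; [exact: mC1_cst|apply: mC1_mul => //; exact: CP].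
move=> w wab; rewrite -QN distrC.
pose D k := `|jet (mxpow (P e) k) w - jet (Q k) w|.
have [_ /(_ w wab) hP] := HP e e01.
have hPc : `|jet (P e) w - 1%:M - e *: jet (fun w => f w *: Om) w| <= `|c| * e ^+ 2.
  by rewrite (le_trans hP)// ler_wpM2r ?sqr_ge0// ler_norm.
have P1 : `|jet (P e) w - 1%:M| <= (K + `|c|) * e.
  rewrite -[X in `|X|](subrK (e *: jet (fun w => f w *: Om) w)).
  rewrite (le_trans (ler_normD _ _))// normrZ (gtr0_norm e0).
  have h1 := HK w wab.
  have h2 : e * `|jet (fun w => f w *: Om) w| <= e * K by rewrite ler_pM2l.
  have h3 : `|c| * e ^+ 2 <= `|c| * e by rewrite ler_wpM2l// expr2 ler_piMl// ltW.
  lra.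
have PQ : `|jet (P e) w - jet (Q 1%N) w| <= C * e ^+ 2.
  have hQ := jet_rot_expansion Om Cf e01 (fF w wab) (f'F w wab).
  have -> : jet (P e) w - jet (Q 1%N) w
      = (jet (P e) w - 1%:M - e *: jet (fun w => f w *: Om) w)
      - (jet (fun w => rotation Om (e * f w)) w - 1%:M - e *: jet (fun w => f w *: Om) w).
    have -> : Q 1%N = (fun w => rotation Om (e * f w)) by apply/funext => x; rewrite /Q mul1r.
    by rewrite sub_shift.
  rewrite (le_trans (ler_normB _ _))// /C mulrDl lerD//.
have QK k : (k <= N)%N -> `|jet (Q k) w| <= KQ.
  move=> kN; apply: jet_rot_bounded => //; rewrite derive1_scale//.
  have ke : k%:R * e <= 1 by rewrite /e ler_pdivrMr// mul1r ler_nat.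
  have ke0 : 0 <= k%:R * e by rewrite mulr_ge0// ltW.
  by rewrite normrM ger0_norm// (le_trans _ (f'F w wab))// ler_piMl.
have DS k : (k < N)%N -> D k.+1 <= (1 + L * e) * D k + 6 * (KQ * (C * e ^+ 2)).
  move=> kN; rewrite /D QS /= jet_mul//; last exact: CP.
  set X := jet (mxpow _ k) w; set Y := jet (Q k) w; set p := jet (P e) w; set q := jet (Q 1%N) w.
  have -> : X *m p - Y *m q = (X - Y) + (X - Y) *m (p - 1%:M) + Y *m (p - q).
    rewrite [(X - Y) *m (p - _)]mulmxBr mulmx1 (addrC (X - Y)) subrK.
    by rewrite mulmxBl mulmxBr subrKA.
  have h1 := norm_mul6 (lexx `|X - Y|) P1.
  have h2 := norm_mul6 (QK k (ltnW kN)) PQ.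
  rewrite (le_trans (ler_normD _ _))//.
  apply: lerD; last exact: h2.
  rewrite (le_trans (ler_normD _ _))// mulrDl mul1r lerD2l (le_trans h1)//.
  by rewrite le_eqVlt /L; apply/orP; left; apply/eqP; ring.
have Le0 : 0 <= L * e by rewrite mulr_ge0// ltW.
have cc0 : 0 <= 6 * (KQ * (C * e ^+ 2)) by rewrite mulr_ge0// mulr_ge0// mulr_ge0// sqr_ge0.
have D0 : D 0%N <= 0.
  rewrite /D /= (_ : Q 0%N = (fun=> 1%:M)) ?subrr ?normr0//.
  by apply/funext => x; rewrite /Q !mul0r rotation0.
have := discrete_gronwall Le0 cc0 D0 DS; move=> /le_trans; apply.
have hexp : (1 + L * e) ^+ N <= expR L.
  have -> : expR L = expR (L * e) ^+ N.
    by rewrite -expRM_natl; congr expR; rewrite /e; field; rewrite gt_eqF.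
  by rewrite lerXn2r ?nnegrE ?addr_ge0 ?expR_ge0// expR_ge1Dx.
rewrite (@le_trans _ _ (N%:R * (6 * (KQ * (C * e ^+ 2))) * expR L))//.
  by apply: ler_wpM2l => //; rewrite mulr_ge0// ltW.
have -> : N%:R * (6 * (KQ * (C * e ^+ 2))) * expR L = M * e.
  by rewrite /M /e; field; rewrite gt_eqF.
by rewrite /e ler_pdivrMr// mulrC -ler_pdivrMr// ltW// truncnS_gt.
Qed.

End Trotter.

(** * Rotations by polynomials of the frequency *)

Section AdmissibleAngles.
Context {R : realType} (a b : R).
Implicit Types (f g : R -> R).
Local Notation attainable := (attainable a b).
Local Notation tangent := (tangent a b).

(** Asking for all multiples of the angle makes this class a vector space. *)
Definition admissible f :=
  C1 f /\ forall s : R, attainable (fun w => rotation Omega_x (s * f w)).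

Lemma admissible_scale (k : R) f : admissible f -> admissible (fun w => k * f w).
Proof.
move=> [Cf Af]; split; first exact: C1_scale.
move=> s; have := Af (s * k); congr (attainable _).
by apply/funext => w; rewrite mulrA.
Qed.

Lemma admissible_add f g : admissible f -> admissible g -> admissible (fun w => f w + g w).
Proof.
move=> [Cf Af] [Cg Ag]; split; first exact: C1_add.
move=> s; have := attainable_mul (Af s) (Ag s); congr (attainable _).
by apply/funext => w; rewrite rotationD ?mulrDr//; exact: Omega_x_cube.
Qed.

(** A rotation depends on its angle in a Lipschitz way, in C1. *)
Lemma admissible_lim f : C1 f -> (forall e : R, 0 < e -> exists2 g, admissible g &
    forall w, a <= w <= b -> `|f w - g w| <= e /\ `|derive1 f w - derive1 g w| <= e) ->
  admissible f.
Proof.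
move=> Cf fg; split => // s.
apply: attainable_lim; first by apply: rot_mC1; exact: C1_scale.
move=> d d0.
have [F F0 fF] := @continuous_bounded_itv R (derive1 f) a b
  (fun w _ => @C1_continuous' R f w Cf).
pose S := `|s| + 1.
have S1 : 1 <= S by rewrite lerDr.
have S0 : 0 < S by exact: lt_le_trans S1.
have sS : `|s| <= S by rewrite lerDl.
pose js := jet_size (@Omega_x R) + 1.
have js0 : 0 < js by rewrite ltr_wpDl// jet_size_ge0.
have jsS : jet_size Omega_x <= js by rewrite lerDl.
clearbody S js.
pose M := js * (2 * (S + S * F * S + S)).
have M0 : 0 < M by rewrite !(mulr_gt0, addr_gt0).
have [g [Cg Ag] gf] := fg (d / M) (divr_gt0 d0 M0).
exists (fun w => rotation Omega_x (s * g w)); first exact: Ag.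
move=> w wab; have [h1 h2] := gf w wab.
have Csf : C1 (fun w => s * f w) by exact: C1_scale.
have Csg : C1 (fun w => s * g w) by exact: C1_scale.
apply: (le_trans (jet_rot_lipschitz Omega_x w Csf Csg)).
rewrite !derive1_scale// -!mulrBr !normrM.
set e := d / M in h1 h2.
have e0 : 0 < e by exact: divr_gt0.
have t1 : `|s| * `|f w - g w| <= S * e by rewrite ler_pM.
have t2 : `|s| * `|derive1 f w - derive1 g w| <= S * e by rewrite ler_pM.
have t3 : `|s| * `|derive1 f w| <= S * F by rewrite ler_pM// fF.
have t4 : `|s| * `|derive1 f w| * (`|s| * `|f w - g w|) <= S * F * (S * e).
  by rewrite ler_pM// mulr_ge0.
have -> : d = js * (2 * (S * e + S * F * (S * e) + S * e)).
  by rewrite /e /M; field; rewrite !gt_eqF// !addr_gt0// !mulr_gt0.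
apply: ler_pM; rewrite ?jet_size_ge0//.
lra.
Qed.

Lemma add_mx3 (x11 x12 x13 x21 x22 x23 x31 x32 x33
    y11 y12 y13 y21 y22 y23 y31 y32 y33 : R) :
  mx3 [:: [:: x11; x12; x13]; [:: x21; x22; x23]; [:: x31; x32; x33]] +
  mx3 [:: [:: y11; y12; y13]; [:: y21; y22; y23]; [:: y31; y32; y33]] =
  mx3 [:: [:: x11 + y11; x12 + y12; x13 + y13]; [:: x21 + y21; x22 + y22; x23 + y23];
          [:: x31 + y31; x32 + y32; x33 + y33]].
Proof.
apply/matrixP => -[[|[|[|//]]] ?] -[[|[|[|//]]] ?]; by rewrite !mxE /=.
Qed.

(** Two opposite precessions, of angles [al] and [- al], leave the part of the
rotation axis that lies along the first axis. *)
Lemma conj_Omega_x (k al : R) :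
  rotation Omega_z al *m (k *: Omega_x) *m rotation Omega_z (- al)
  + rotation Omega_z (- al) *m (k *: Omega_x) *m rotation Omega_z al
  = (2 * k * cos al) *: Omega_x.
Proof.
rewrite !rotation_zE /Omega_x !scale_mx3 !mulmx3 add_mx3 sinN cosN.
by congr (mx3 [:: [:: _; _; _]; [:: _; _; _]; [:: _; _; _]]); ring.
Qed.

Lemma tangent_Omega_x (k : R) : tangent (fun=> k *: Omega_x).
Proof.
split; first exact: mC1_cst.
exists (fun e w => rotation Omega_x (e * k)).
exists (jet_size Omega_x * (3 * `|k| ^+ 2 + `|k| ^+ 3)) => e e01.
split; first exact: attainable_rot_x.
move=> w _; apply: (@jet_rot_expansion R Omega_x (fun=> k)) => //; first exact: C1_cst.
by rewrite derive1_cstE normr0.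
Qed.

Lemma C1_affine (t phi : R) : C1 (fun w => t * w + phi).
Proof. exact: (C1_add (C1_scale t C1_id) (C1_cst phi)). Qed.

(** Constant rotations about the first axis, conjugated by the precessions of
angles [t w + phi] and [- (t w + phi)], generate [cos (t w + phi)] times that axis
by [conj_Omega_x]. *)
Lemma admissible_cos (t phi : R) : admissible (fun w => cos (t * w + phi)).
Proof.
have Cc : C1 (fun w => cos (t * w + phi)) by exact: (C1_compose C1_cos (C1_affine t phi)).
split => // s; apply: attainable_exp; first exact: Omega_x_cube.
  exact: C1_scale.
pose B w : 'M[R]_3 := rotation Omega_z (t * w + phi).
pose B' w : 'M[R]_3 := rotation Omega_z (- t * w + - phi).
have BB' w : B w *m B' w = 1%:M.
  by rewrite /B /B' mulNr -opprD rotationV//; exact: Omega_z_cube.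
have B'B w : B' w *m B w = 1%:M.
  rewrite /B /B' mulNr -opprD rotationD; last exact: Omega_z_cube.
  by rewrite addNr rotation0.
have aB : attainable B by exact: attainable_drift.
have aB' : attainable B' by exact: attainable_drift.
have T := tangent_Omega_x (s / 2).
have := tangent_add (tangent_conj aB aB' BB' T) (tangent_conj aB' aB B'B T).
congr (tangent _); apply/funext => w.
rewrite /B /B' mulNr -opprD conj_Omega_x; congr (_ *: _).
by field.
Qed.

Lemma cosBpihalf (x : R) : cos (x - pi / 2) = sin x.
Proof. by rewrite cosB cos_pihalf sin_pihalf mulr0 add0r mulr1. Qed.

(** Differentiating [cos (t w + phi)] with respect to [t] produces a factor [w]:
a symmetric difference quotient does so up to an error small in C1. *)
Lemma admissible_exprn_cos (n : nat) (t phi : R) :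
  admissible (fun w => w ^+ n * cos (t * w + phi)).
Proof.
elim: n t phi => [|n ih] t phi.
  have := admissible_cos t phi; congr (admissible _).
  by apply/funext => w; rewrite expr0 mul1r.
pose h w := w ^+ n * cos (t * w + phi).
have Ch : C1 h by exact: (ih t phi).1.
have fE : (fun w => w ^+ n.+1 * cos (t * w + phi)) = (fun w => w * h w).
  by apply/funext => w; rewrite exprS /h mulrA.
have Cf : C1 (fun w => w * h w) by exact: (C1_mul C1_id Ch).
rewrite fE; apply: admissible_lim => // e e0.
have [H1 H10 hH1] := @continuous_bounded_itv R h a b (fun w _ => @C1_continuous R h w Ch).
have [H2 H20 hH2] := @continuous_bounded_itv R (derive1 h) a b
  (fun w _ => @C1_continuous' R h w Ch).
have [K K0 wK] := @continuous_bounded_itv R (fun w => w ^+ 2) a b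
  (fun w _ => @C1_continuous R _ w (C1_exprn 2)).
pose M := (H1 + H2) * K.
have M0 : 0 < M by rewrite mulr_gt0// addr_gt0.
pose d := Num.min 1 (e / M).
have d0 : 0 < d by rewrite lt_min ltr01 divr_gt0.
have d1 : d <= 1 by rewrite ge_min lexx.
have dM : d * M <= e by rewrite -ler_pdivlMr// ge_min lexx orbT.
pose r w := w - d^-1 * sin (d * w).
have Csin : C1 (fun w => sin (d * w)) by exact: (C1_compose C1_sin (C1_scale d C1_id)).
have Cr1 : C1 (fun w => (- d^-1) * sin (d * w)) by exact: C1_scale.
have rE : r = (fun w => w + (- d^-1) * sin (d * w)).
  by apply/funext => w; rewrite /r mulNr.
have Cr : C1 r by rewrite rE; exact: (C1_add C1_id Cr1).
have r'E w : derive1 r w = 1 - cos (d * w).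
  rewrite rE (derive1_add C1_id Cr1) derive1_idE (derive1_scale _ Csin).
  rewrite (derive1_compE C1_sin (C1_scale d C1_id)) derive1_sin.
  rewrite (derive1_scale _ C1_id) derive1_idE mulr1.
  by field; rewrite gt_eqF.
have rK w : a <= w <= b -> `|r w| <= d * K /\ `|derive1 r w| <= d * K.
  move=> wab; have w2 : w ^+ 2 <= K by rewrite (le_trans (ler_norm _))// wK.
  split.
    have -> : r w = - d^-1 * (sin (d * w) - d * w) by rewrite /r; field; rewrite gt_eqF.
    have dV0 : 0 < d^-1 by rewrite invr_gt0.
    rewrite normrM normrN (gtr0_norm dV0) ler_pdivrMl//.
    apply: (le_trans (sin_quadratic _)).
    have -> : (d * w) ^+ 2 = d * (d * w ^+ 2) by ring.
    by rewrite ler_pM2l// ler_pM2l.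
  rewrite r'E; apply: (le_trans (cos_quadratic _)).
  have -> : (d * w) ^+ 2 = d * (d * w ^+ 2) by ring.
  rewrite ler_pM2l// (le_trans _ w2)// ler_piMl ?sqr_ge0//.
exists (fun w => (2 * d)^-1 * (w ^+ n * cos ((t + d) * w + (phi - pi / 2)))
    + (- (2 * d)^-1) * (w ^+ n * cos ((t - d) * w + (phi - pi / 2)))).
  by apply: admissible_add; apply: admissible_scale; exact: ih.
have gE : (fun w => (2 * d)^-1 * (w ^+ n * cos ((t + d) * w + (phi - pi / 2)))
    + (- (2 * d)^-1) * (w ^+ n * cos ((t - d) * w + (phi - pi / 2))))
    = (fun w => w * h w + (-1) * (r w * h w)).
  apply/funext => w; rewrite !addrA !cosBpihalf /r /h.
  have -> : (t + d) * w + phi = (t * w + phi) + d * w by ring.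
  have -> : (t - d) * w + phi = (t * w + phi) - d * w by ring.
  by rewrite sinD sinB; field; rewrite gt_eqF.
have Crh := C1_mul Cr Ch; have Crh' := C1_scale (-1) Crh.
move=> w wab; have [r1 r2] := rK w wab.
have h1 := hH1 w wab; have h2 := hH2 w wab.
have hb1 : `|r w| * `|h w| <= d * K * H1 by rewrite ler_pM.
have hb2 : `|r w| * `|derive1 h w| <= d * K * H2 by rewrite ler_pM.
have hb3 : `|derive1 r w| * `|h w| <= d * K * H1 by rewrite ler_pM.
have dK0 : 0 <= d * K * H2 by rewrite !mulr_ge0// ltW.
have dKM : d * K * H1 + d * K * H2 <= e.
  by apply: le_trans dM; rewrite /M le_eqVlt; apply/orP; left; apply/eqP; ring.
have gEw := congr1 (fun F => F w) gE; rewrite /= in gEw.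
rewrite gE gEw (derive1_add Cf Crh') (derive1_scale _ Crh) (derive1_mul Cr Ch).
split.
  have -> : w * h w - (w * h w + -1 * (r w * h w)) = r w * h w by ring.
  by rewrite normrM; lra.
set D := derive1 (fun w => w * h w) w.
have -> : D - (D + -1 * (derive1 r w * h w + r w * derive1 h w))
    = derive1 r w * h w + r w * derive1 h w by ring.
apply: (le_trans (ler_normD _ _)); rewrite (normrM (derive1 r w)) (normrM (r w)).
exact: (le_trans (lerD hb3 hb2) dKM).
Qed.

Lemma admissible_horner (p : {poly R}) : admissible (horner p).
Proof.
have pow n : admissible (fun w => w ^+ n).
  have := admissible_exprn_cos n 0 0; congr (admissible _).
  by apply/funext => w; rewrite mul0r addr0 cos0 mulr1.
elim/poly_ind: p => [|p c _].
  have := admissible_scale 0 (pow 0%N); congr (admissible _).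
  by apply/funext => w; rewrite horner0 mul0r.
move: (p * 'X + c%:P) => {c}p.
rewrite (_ : horner p = (fun w => \sum_(i < size p) p`_i * w ^+ i)); last first.
  by apply/funext => w; rewrite horner_coef.
elim: (size p) => [|n ih].
  have := admissible_scale 0 (pow 0%N); congr (admissible _).
  by apply/funext => w; rewrite big_ord0 mul0r.
have := admissible_add ih (admissible_scale p`_n (pow n)); congr (admissible _).
by apply/funext => w; rewrite big_ord_recr.
Qed.

Lemma attainable_horner_x (p : {poly R}) : attainable (fun w => rotation Omega_x p.[w]).
Proof.
have [_ /(_ 1)] := admissible_horner p; congr (attainable _).
by apply/funext => w; rewrite mul1r.
Qed.

Lemma rot_y_conj (s : R) : rotation Omega_z (pi / 2) *m rotation Omega_x s
  *m rotation Omega_z (- (pi / 2)) = rotation Omega_y s.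
Proof.
rewrite rotation_xE rotation_yE !rotation_zE sinN cosN sin_pihalf cos_pihalf !mulmx3.
by congr (mx3 [:: [:: _; _; _]; [:: _; _; _]; [:: _; _; _]]); ring.
Qed.

Lemma attainable_horner_y (p : {poly R}) : attainable (fun w => rotation Omega_y p.[w]).
Proof.
have := attainable_mul (attainable_mul (attainable_rot_z a b (pi / 2))
  (attainable_horner_x p)) (attainable_rot_z a b (- (pi / 2))).
by congr (attainable _); apply/funext => w; rewrite rot_y_conj.
Qed.

End AdmissibleAngles.

(** * Realization by piecewise constant controls *)

Section Realization.
Context {R : realType}.
Local Notation mu := (@lebesgue_measure R).
Implicit Types (u v f : R -> R) (l : seq (R * R * R)).

Lemma bounded_Linfty_loc u K : measurable_fun [set: measurableTypeR R] u ->
  (forall s, `|u s| <= K) -> Linfty_loc u.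
Proof.
move=> mu_ uK T T0; rewrite inE; apply/andP; split; rewrite inE/=.
  apply/(measurable_restrictT _ (measurable_itv _)).
  exact: measurable_funS mu_.
rewrite /finite_norm unlock; case: ifPn => // _.
apply: (@le_lt_trans _ _ K%:E); last by rewrite ltry.
apply/ess_supP; apply: nearW => s /=; rewrite lee_fin patchE.
by case: ifP => // _; rewrite normr0 (le_trans _ (uK 0)).
Qed.

Lemma integrable_setU (A B : set (measurableTypeR R)) f :
  measurable A -> measurable B -> [disjoint A & B] ->
  mu.-integrable A (EFin \o f) -> mu.-integrable B (EFin \o f) ->
  mu.-integrable (A `|` B) (EFin \o f).
Proof.
move=> mA mB AB /integrableP[mfA iA] /integrableP[mfB iB].
have mf : measurable_fun (A `|` B) (EFin \o f) by apply/measurable_funU.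
apply/integrableP; split => //.
rewrite ge0_integral_setU//; first exact: lte_add_pinfty.
exact: measurableT_comp.
Qed.

Lemma pulse_mul p q w t (X : 'cV[R]_3) i : (pulse t p q w *m X) i 0 =
  X i 0 + (sin (t * rabi w p q) / rabi w p q) * (gen w p q *m X) i 0
  + ((1 - cos (t * rabi w p q)) / rabi w p q ^+ 2) * (gen w p q *m gen w p q *m X) i 0.
Proof.
rewrite /pulse 2!mulmxDl mul1mx -!scalemxAl.
by move: (gen w p q *m X) (_ *m X) => Y Z; rewrite !mxE.
Qed.

(** By [gen_cube], the derivative of Rodrigues' formula is the generator times the
formula. *)
Lemma is_derive_pulse p q w (T : R) (X : 'cV[R]_3) i (s : R) :
  is_derive s 1 (fun t => (pulse (t - T) p q w *m X) i 0)
    (bloch_rhs w p q (pulse (s - T) p q w *m X) i 0).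
Proof.
have -> : bloch_rhs w p q (pulse (s - T) p q w *m X) i 0
   = (gen w p q *m (pulse (s - T) p q w *m X)) i 0 by [].
set r := rabi w p q; set A := gen w p q.
have [r0|r0] := eqVneq r 0.
  rewrite /A gen0// mul0mx mxE.
  rewrite (_ : (fun t => _) = cst (X i 0)).
    exact: is_derive_cst.
  by apply/funext => t; rewrite pulse_mul gen0// !mul0mx mxE !mulr0 !addr0.
have -> : A *m (pulse (s - T) p q w *m X) =
   cos ((s - T) * r) *: (A *m X) + (sin ((s - T) * r) / r) *: (A *m A *m X).
  have -> : A *m (pulse (s - T) p q w *m X) = (A *m pulse (s - T) p q w) *m X.
    by rewrite mulmxA.
  have -> : A *m pulse (s - T) p q w = cos ((s - T) * r) *: A + (sin ((s - T) * r) / r) *: (A *m A).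
    rewrite /pulse -/A -/r 2!mulmxDr mulmx1 -!scalemxAr.
    have -> : A *m (A *m A) = - (r ^+ 2) *: A by rewrite mulmxA gen_cube.
    rewrite scalerA mulrN divfK ?sqrf_eq0// addrAC opprB scalerBl scale1r.
    by rewrite addrCA subrr addr0.
  by rewrite mulmxDl -!scalemxAl.
rewrite (_ : (fun t => _) = (fun t => X i 0 + (A *m X) i 0 / r * sin ((t - T) * r)
   + (A *m A *m X) i 0 / r ^+ 2 * (1 - cos ((t - T) * r)))); last first.
  by apply/funext => t; rewrite pulse_mul -/A -/r; ring.
have dg : is_derive s 1 (fun t => (t - T) * r) r.
  rewrite (_ : (fun t => _) = (fun t => r * t + (- (T * r)))); last first.
    by apply/funext => t; ring.
  by apply: is_derive_eq; rewrite /GRing.scale/=; ring.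
have ds : is_derive s 1 (fun t => sin ((t - T) * r)) (r * cos ((s - T) * r)).
  by rewrite mulrC; exact: (@is_derive1_comp _ sin _ _ _ _ (is_derive_sin _) dg).
have dc : is_derive s 1 (fun t => cos ((t - T) * r)) (r * - sin ((s - T) * r)).
  by rewrite mulrC; exact: (@is_derive1_comp _ cos _ _ _ _ (is_derive_cos _) dg).
move: (A *m X) (_ *m X) => Y Z.
by apply: is_derive_eq; rewrite !mxE /GRing.scale/=; field.
Qed.

Lemma pulse_segment p q w T (X : 'cV[R]_3) i (t : R) : T <= t ->
  let f s := bloch_rhs w p q (pulse (s - T) p q w *m X) i 0 in
  mu.-integrable `[T, t] (EFin \o f)
  /\ \int[mu]_(s in `]T, t[) f s = (pulse (t - T) p q w *m X) i 0 - X i 0.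
Proof.
move=> Tt f.
have df x : is_derive (x : R) 1 (fun t => (pulse (t - T) p q w *m X) i 0) (f x).
  exact: is_derive_pulse.
have cf x : {for x, continuous f}.
  have fE : f = (fun s => \sum_j (gen w p q) i j * (pulse (s - T) p q w *m X) j 0).
    by apply/funext => s; rewrite /f /bloch_rhs -/(gen w p q) mxE.
  rewrite /prop_for fE; apply: (@is_derive_continuous _ _ _
    (\sum_j (gen w p q) i j * bloch_rhs w p q (pulse (x - T) p q w *m X) j 0)).
  rewrite -fct_sumE; apply: is_derive_sum => j.
  by apply: is_deriveZ; exact: is_derive_pulse.
have [i1 ->] := FTC2_oo Tt (fun x _ => df x) (fun x _ => cf x).
by split => //; rewrite subrr pulse0 mul1mx.
Qed.

(** A form of [Linfty_loc] whose stability under switching is immediate *)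
Definition admissible_control u := measurable_fun [set: measurableTypeR R] u
  /\ exists K : R, forall s, `|u s| <= K.

Lemma admissible_switch u (T p : R) : admissible_control u ->
  admissible_control (fun s => if s <= T then u s else p).
Proof.
move=> [mu_ [K uK]]; split.
  by apply: measurable_fun_ifT => //; apply: measurable_fun_ler.
exists (Num.max K `|p|) => s; case: ifP => _; rewrite le_max ?uK//.
by rewrite lexx orbT.
Qed.

(** The pulses are applied one after the other. Past the last switching time the
last pulse is kept on, so that the solution is defined for all times. *)
Lemma realization (a b : R) l (M0 : R -> 'cV[R]_3) : durations_ge0 l ->
  exists T u v U, [/\ 0 <= T, admissible_control u /\ admissible_control v,
    bloch_solution a b u v M0 U & forall w, U T w = propagator l w *m M0 w].
Proof.
elim: l => [_|[[tau p] q] l ih /= /andP[/= tau0 l0]].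
  exists 0, (fun=> 0), (fun=> 0), (fun t w => pulse (t - 0) 0 0 w *m M0 w).
  have c0 : admissible_control (fun=> 0 : R).
    by split; [exact: measurable_cst|exists 0 => s; rewrite normr0].
  split => //; last by move=> w; rewrite subrr pulse0.
  move=> w t _ t0 i.
  have [i1 i2] := pulse_segment 0 0 w (M0 w) i t0; split => //.
  have i1' : mu.-integrable `]0, t] (EFin \o (fun s => bloch_rhs w 0 0 (pulse (s - 0) 0 0 w *m M0 w) i 0)).
    apply: integrableS i1 => //; exact: subset_itv_oc_cc.
  have i1'' : mu.-integrable `]0, t[ (EFin \o (fun s => bloch_rhs w 0 0 (pulse (s - 0) 0 0 w *m M0 w) i 0)).
    apply: integrableS i1' => //; exact: subset_itv_oo_oc.
  by rewrite -Rintegral_itv_obnd_cbnd// -Rintegral_itv_bndo_bndc// i2; ring.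
have [T [u [v [U [T0 [au av] sol UT]]]]] := ih l0.
exists (T + tau), (fun s => if s <= T then u s else p), (fun s => if s <= T then v s else q).
exists (fun t w => if t <= T then U t w else pulse (t - T) p q w *m U T w).
split.
- exact: addr_ge0.
- by split; exact: admissible_switch.
- move=> w t wab t0 i.
  have [tT|Tt] := leP t T.
    have [h1 h2] := sol w t wab t0 i.
    split.
      apply: eq_integrable h1 => // s; rewrite inE/= in_itv/= => /andP[_ st].
      by rewrite (le_trans st tT).
    rewrite h2; congr (_ + _); apply: eq_Rintegral => s.
    by rewrite inE/= in_itv/= => /andP[_ st]; rewrite (le_trans st tT).
  have [h1 h2] := sol w T wab T0 i.
  have [g1 g2] := pulse_segment p q w (U T w) i (ltW Tt).
  set F := fun s => bloch_rhs w _ _ _ i 0.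
  have iF1 : mu.-integrable `[0, T] (EFin \o F).
    apply: eq_integrable h1 => // s; rewrite inE/= in_itv/= => /andP[_ st].
    by rewrite /F st.
  have iF2 : mu.-integrable `]T, t] (EFin \o F).
    have g1' : mu.-integrable `]T, t] (EFin \o (fun s => bloch_rhs w p q (pulse (s - T) p q w *m U T w) i 0)).
      by apply: integrableS g1 => //; exact: subset_itv_oc_cc.
    apply: eq_integrable g1' => // s; rewrite inE/= in_itv/= => /andP[Ts _].
    by rewrite /F leNgt Ts.
  have E : `[0, t]%classic = `[0, T]%classic `|` `]T, t]%classic :> set (measurableTypeR R).
    by rewrite -itv_bndbnd_setU// bnd_simp ?(ltW Tt).
  have iF : mu.-integrable `[0, t] (EFin \o F).
    rewrite E; apply: integrable_setU => //.
    apply/disj_setPS => x [] /=; rewrite !in_itv/= => /andP[_ xT] /andP[Tx _].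
    by move: Tx; rewrite ltNge xT.
  split => //.
  have := @Rintegral_itvB _ F (BLeft 0) (BRight t) T iF; rewrite !bnd_simp T0 (ltW Tt).
  move=> /(_ isT isT)/eqP; rewrite subr_eq => /eqP ->.
  have -> : \int[mu]_(x in `[0, T]) F x = U T w i 0 - M0 w i 0.
    rewrite h2 addrC addKr; apply: eq_Rintegral => s; rewrite inE/= in_itv/= => /andP[_ st].
    by rewrite /F st.
  have -> : \int[mu]_(x in `]T, t]) F x = (pulse (t - T) p q w *m U T w) i 0 - U T w i 0.
    rewrite -Rintegral_itv_bndo_bndc; last first.
      by apply: integrableS iF2 => //; exact: subset_itv_oo_oc.
    rewrite -g2; apply: eq_Rintegral => s; rewrite inE/= in_itv/= => /andP[Ts _].
    by rewrite /F leNgt Ts.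
  by rewrite subrKA [RHS]addrC subrK.
- move=> w /=; rewrite -mulmxA -UT.
  case: ifPn => [|_]; last by rewrite addrC addKr.
  rewrite gerDl => tau0'; have -> : tau = 0 by apply/eqP; rewrite eq_le tau0 tau0'.
  by rewrite addr0 pulse0 mul1mx.
Qed.

End Realization.

(** * Convergence in H1 *)

Section SobolevConvergence.
Context {R : realType} (a b : R) (ab : a < b).
Local Notation mu := (@lebesgue_measure R).
Local Notation I := (`]a, b[%classic : set (measurableTypeR R)).
Local Notation W := (W a b).
Local Notation ucvg := (ucvg a b).
Local Notation lcvg := (lcvg a b).
Local Notation wcvg := (wcvg a b).
Implicit Types (f g h k F : R -> R).

Lemma wcvg_cst f g : W f g -> wcvg (fun=> f) (fun=> g) f g.
Proof.
move=> Wf; split => // e e0; apply: nearW => n.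
  by move=> x _; rewrite subrr normr0 ltW.
rewrite (@eq_n2 _ _ _ (cst 0)); last by move=> x _; rewrite subrr.
rewrite /n2 (_ : (fun x => _) = cst 0); last by apply/funext => x; rewrite expr0n.
by rewrite Rintegral_cst ?mul0r ?(ltW e0).
Qed.

Lemma eq_wcvg (f_ g_ : nat -> R -> R) f g (f_' g_' : nat -> R -> R) f' g' : (forall n, f_ n = f_' n) -> (forall n, g_ n = g_' n) ->
  f = f' -> g = g' -> wcvg f_ g_ f g -> wcvg f_' g_' f' g'.
Proof. by move=> /funext -> /funext -> -> ->. Qed.

Lemma wcvg_add (f_ g_ : nat -> R -> R) f g (h_ k_ : nat -> R -> R) h k : wcvg f_ g_ f g -> wcvg h_ k_ h k ->
  wcvg (fun n x => f_ n x + h_ n x) (fun n x => g_ n x + k_ n x)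
    (fun x => f x + h x) (fun x => g x + k x).
Proof.
move=> [Wf_ Wf ff gg] [Wh_ Wh hh kk]; split.
- by move=> n; exact: W_add.
- exact: W_add.
- exact: ucvgD.
- apply: lcvgD => //.
  + by move=> n; exact: (W_sqint (Wf_ n)).
  + exact: (W_sqint Wf).
  + by move=> n; exact: (W_sqint (Wh_ n)).
  + exact: (W_sqint Wh).
Qed.

Lemma wcvg_mul (f_ g_ : nat -> R -> R) f g (h_ k_ : nat -> R -> R) h k : wcvg f_ g_ f g -> wcvg h_ k_ h k ->
  wcvg (fun n x => f_ n x * h_ n x) (fun n x => g_ n x * h_ n x + f_ n x * k_ n x)
    (fun x => f x * h x) (fun x => g x * h x + f x * k x).
Proof.
move=> cf ch; have [u _ l] := leibniz_cvg ab cf ch.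
have [Wf_ Wf _ _] := cf; have [Wh_ Wh _ _] := ch.
by split => // [n|]; exact: W_mul.
Qed.

Lemma wcvg_sum m (f_ g_ : 'I_m -> nat -> R -> R) (f g : 'I_m -> R -> R) :
  (forall j, wcvg (f_ j) (g_ j) (f j) (g j)) ->
  wcvg (fun n x => \sum_j f_ j n x) (fun n x => \sum_j g_ j n x)
    (fun x => \sum_j f j x) (fun x => \sum_j g j x).
Proof.
elim: m f_ g_ f g => [|m ih] f_ g_ f g cf.
  apply: (eq_wcvg _ _ _ _ (wcvg_cst (W_cst ab 0))).
  - by move=> n; apply/funext => x; rewrite big_ord0.
  - by move=> n; apply/funext => x; rewrite big_ord0.
  - by apply/funext => x; rewrite big_ord0.
  - by apply/funext => x; rewrite big_ord0.
have := wcvg_add (cf ord0) (ih _ _ _ _ (fun j => cf (lift ord0 j))).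
apply: eq_wcvg.
- by move=> n; apply/funext => x; rewrite big_ord_recl.
- by move=> n; apply/funext => x; rewrite big_ord_recl.
- by apply/funext => x; rewrite big_ord_recl.
- by apply/funext => x; rewrite big_ord_recl.
Qed.

Lemma wcvg_comp F F' (f_ g_ : nat -> R -> R) f g : (forall t : R, is_derive t 1 F (F' t)) ->
  (forall t, {for t, continuous F'}) -> wcvg f_ g_ f g ->
  wcvg (fun n x => F (f_ n x)) (fun n x => F' (f_ n x) * g_ n x)
    (fun x => F (f x)) (fun x => F' (f x) * g x).
Proof.
move=> dF cF' [Wf_ Wf ff gg].
have WF f1 g1 : W f1 g1 -> W (fun x => F (f1 x)) (fun x => F' (f1 x) * g1 x).
  move=> Wf1; have [K _ fK] := W_bounded ab Wf1.
  apply: (@W_comp _ _ _ ab (- K - 1) (- K)) => //; first by rewrite ltrBlDr ltrDl.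
  by move=> x /fK /ler_normlP[]; rewrite lerNl.
have [K _ fK] := W_bounded ab Wf.
have KK x : a <= x <= b -> - K <= f x <= K by move=> /fK; rewrite ler_norml.
have KK1 : - K - 1 < - K by rewrite ltrBlDr ltrDl.
have mF' f1 g1 : W f1 g1 -> measurable_fun I (fun x => F' (f1 x)).
  move=> Wf1; apply: (@measurableT_comp _ _ _ _ _ _ F'); last exact: (W_measurable ab Wf1).
  by apply: continuous_measurable_fun => t; exact: cF'.
split.
- by move=> n; exact: WF.
- exact: WF.
- apply: (ucvg_comp KK1 _ KK ff) => t _.
  exact: (is_derive_continuous (dF t)).
- have [K' _ fK'] := @continuous_bounded_itv R F' (- K) K (fun x _ => cF' x).
  apply: (@lcvgM _ _ _ ab K') => //.
  + by move=> n; exact: (mF' _ _ (Wf_ n)).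
  + exact: (mF' _ _ Wf).
  + by move=> x /KK /fK'.
  + by move=> n; exact: (W_sqint (Wf_ n)).
  + exact: (W_sqint Wf).
  + by apply: (ucvg_comp KK1 _ KK ff) => t _; exact: cF'.
Qed.

Section Matrices.
Context (p q : nat).

Definition mcvg (A_ D_ : nat -> R -> 'M[R]_(p, q)) (A D : R -> 'M[R]_(p, q)) :=
  forall i j, wcvg (fun n x => A_ n x i j) (fun n x => D_ n x i j)
    (fun x => A x i j) (fun x => D x i j).

Definition mW (A D : R -> 'M[R]_(p, q)) := forall i j, W (fun x => A x i j) (fun x => D x i j).

Lemma mcvg_cst A D : mW A D -> mcvg (fun=> A) (fun=> D) A D.
Proof. by move=> WA i j; exact: wcvg_cst. Qed.

End Matrices.

Lemma mcvg_mul p q r (A_ D_ : nat -> R -> 'M[R]_(p, q)) A D (B_ E_ : nat -> R -> 'M[R]_(q, r)) B E :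
  mcvg A_ D_ A D -> mcvg B_ E_ B E ->
  mcvg (fun n x => A_ n x *m B_ n x) (fun n x => D_ n x *m B_ n x + A_ n x *m E_ n x)
    (fun x => A x *m B x) (fun x => D x *m B x + A x *m E x).
Proof.
move=> cA cB i j; have := wcvg_sum (fun l : 'I_q => wcvg_mul (cA i l) (cB l j)).
apply: eq_wcvg => [n|n||]; apply/funext => x; rewrite !mxE// ?mxE ?big_split//.
Qed.

Lemma mW_mul p q r (A D : R -> 'M[R]_(p, q)) (B E : R -> 'M[R]_(q, r)) : mW A D -> mW B E ->
  mW (fun x => A x *m B x) (fun x => D x *m B x + A x *m E x).
Proof. by move=> WA WB i j; have [] := mcvg_mul (mcvg_cst WA) (mcvg_cst WB) i j. Qed.

Lemma mC1_mW (A : R -> 'M[R]_3) : mC1 A -> mW A (dmx A).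
Proof.
move=> CA i j; apply: W_C1 => // x _.
  by rewrite mxE; exact: C1_derive.
rewrite (_ : (fun x => _) = derive1 (fun x => A x i j)); first exact: C1_continuous'.
by apply/funext => w; rewrite mxE.
Qed.

End SobolevConvergence.

(** * Steering of states *)

Section Steering.
Context {R : realType} (a b : R) (ab : a < b).
Local Notation mu := (@lebesgue_measure R).
Local Notation I := (`]a, b[%classic : set (measurableTypeR R)).
Local Notation W := (W a b).
Local Notation mW := (mW a b).
Local Notation mcvg := (mcvg a b).
Implicit Types (M G : R -> 'cV[R]_3) (A : R -> 'M[R]_3).

(** The derivatives are carried along with the states, so that the approximation
is in H1. *)
Definition reach M G M' G' := forall e : R, 0 < e -> exists l,
  [/\ durations_ge0 l, mC1 (propagator l) & forall i,
    (forall x, a <= x <= b -> `|(propagator l x *m M x) i 0 - M' x i 0| <= e)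
    /\ n2 I (fun x => (dmx (propagator l) x *m M x + propagator l x *m G x) i 0
         - G' x i 0) <= e].

Lemma near_infty_inv (e : R) : 0 < e -> \forall n \near \oo, n.+1%:R^-1 <= e.
Proof.
by move=> e0; apply: filterS (near_infty_natSinv_lt (PosNum e0)) => n /ltW.
Qed.

Lemma reach_seq M G M' G' : mW M G -> mW M' G' -> reach M G M' G' ->
  exists l_ : nat -> seq (R * R * R),
  [/\ forall n, durations_ge0 (l_ n), forall n, mC1 (propagator (l_ n)) &
    mcvg (fun n x => propagator (l_ n) x *m M x)
      (fun n x => dmx (propagator (l_ n)) x *m M x + propagator (l_ n) x *m G x) M' G'].
Proof.
move=> WM WM' rM.
have /choice[l_ hl] (n : nat) := rM n.+1%:R^-1 (ltac:(by rewrite invr_gt0)).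
exists l_; split; [by move=> n; have [] := hl n|by move=> n; have [] := hl n|].
move=> i j; rewrite ord1; split => //.
- move=> n; have [_ C _] := hl n.
  exact: (mW_mul ab (mC1_mW ab C) WM).
- move=> e e0; near=> n => x xab; have [_ _ /(_ i)[h _]] := hl n.
  rewrite (le_trans (h x xab))//; near: n; exact: near_infty_inv.
- move=> e e0; near=> n; have [_ _ /(_ i)[_ h]] := hl n.
  rewrite (le_trans h)//; near: n; exact: near_infty_inv.
Unshelve. all: by end_near. Qed.

Lemma reach_lim M G (M_ G_ : nat -> R -> 'cV[R]_3) M' G' : mW M G -> mcvg M_ G_ M' G' ->
  (forall n, reach M G (M_ n) (G_ n)) -> reach M G M' G'.
Proof.
move=> WM cM rM e e0; have e40 : 0 < e / 4 by rewrite divr_gt0.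
have : \forall n \near \oo, forall i : 'I_3,
    (forall x, a <= x <= b -> `|M_ n x i 0 - M' x i 0| <= e / 4) /\
    n2 I (fun x => G_ n x i 0 - G' x i 0) <= e / 4.
  apply: filter_forall => i; have [_ _ cu cl] := cM i 0.
  by apply: filterS2 (cu _ e40) (cl _ e40).
case=> n _ /(_ n (leqnn n)) hn.
have [l [l0 Cl hl]] := rM n _ e40; exists l; split => // i.
have [u1 v1] := hl i; have [u2 v2] := hn i; split.
  move=> x xab; rewrite -(subrKA (M_ n x i 0)) (le_trans (ler_normD _ _))//.
  by rewrite (le_trans (lerD (u1 x xab) (u2 x xab)))//; lra.
pose D x := dmx (propagator l) x *m M x + propagator l x *m G x.
rewrite (@eq_n2 _ _ _ (fun x => (D x i 0 - G_ n x i 0) + (G_ n x i 0 - G' x i 0))); last first.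
  by move=> x _; rewrite subrKA.
have sD : sqint I (fun x => D x i 0).
  exact: (W_sqint (mW_mul ab (mC1_mW ab Cl) WM i 0)).
have [Wn W' _ _] := cM i 0.
have := n2D (mI a b) (sqintB (mI a b) sD (W_sqint (Wn n)))
  (sqintB (mI a b) (W_sqint (Wn n)) (W_sqint W')).
have v1' : n2 I (fun x => D x i 0 - G_ n x i 0) <= e / 4 by exact: v1.
lra.
Qed.

Lemma reach_exact M G l : durations_ge0 l -> mC1 (propagator l) ->
  reach M G (fun x => propagator l x *m M x)
    (fun x => dmx (propagator l) x *m M x + propagator l x *m G x).
Proof.
move=> l0 Cl e e0; exists l; split => // i; split.
  by move=> x _; rewrite subrr normr0 ltW.
rewrite (@eq_n2 _ _ _ (cst 0)); last by move=> x _; rewrite subrr.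
rewrite /n2 (_ : (fun x => _) = cst 0); last by apply/funext => x; rewrite expr0n.
by rewrite Rintegral_cst ?mul0r ?(ltW e0).
Qed.

(** C1 convergence of the propagators is more than enough to multiply by an H1
state. *)
Lemma reach_attainable M G A : attainable a b A -> mW M G ->
  reach M G (fun x => A x *m M x) (fun x => dmx A x *m M x + A x *m G x).
Proof.
move=> [CA HA] WM.
have /choice[l_ hl] (n : nat) := HA n.+1%:R^-1 (ltac:(by rewrite invr_gt0)).
have cA : mcvg (fun n => propagator (l_ n)) (fun n => dmx (propagator (l_ n))) A (dmx A).
  move=> i j; have WA := mC1_mW ab CA.
  have Wn n : mW (propagator (l_ n)) (dmx (propagator (l_ n))).
    by apply: mC1_mW => //; have [] := hl n.
  split => //.
  - by move=> n; exact: Wn.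
  - move=> e e0; near=> n => x xab; rewrite distrC (le_trans (jet_entry _ _ _ _ _))//.
    have [_ _ /(_ x xab) h] := hl n; rewrite (le_trans h)//.
    near: n; exact: near_infty_inv.
  - apply: (ucvg_lcvg ab).
    + by move=> n; have [[]] := Wn n i j.
    + by have [[]] := WA i j.
    + move=> e e0; near=> n => x xab; rewrite distrC !mxE (le_trans (jet_entry' _ _ _ _ _))//.
      have [_ _ /(_ x xab) h] := hl n; rewrite (le_trans h)//.
      near: n; exact: near_infty_inv.
apply: (reach_lim WM (mcvg_mul ab cA (mcvg_cst WM))) => n.
by have [l0 Cl _] := hl n; exact: reach_exact.
Unshelve. all: by end_near. Qed.

(** A fixed propagator acts continuously on H1, so the second one can be fixed
while the first one approaches its target. *)
Lemma reach_trans M G M1 G1 M2 G2 : mW M G -> mW M1 G1 -> mW M2 G2 ->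
  reach M G M1 G1 -> reach M1 G1 M2 G2 -> reach M G M2 G2.
Proof.
move=> WM WM1 WM2 r1 r2.
have [l1_ [l1 C1 c1]] := reach_seq WM WM1 r1.
have [l2_ [l2 C2 c2]] := reach_seq WM1 WM2 r2.
apply: (reach_lim WM c2) => n.
apply: (reach_lim WM (mcvg_mul ab (mcvg_cst (mC1_mW ab (C2 n))) c1)) => k.
have E : propagator (l2_ n ++ l1_ k) = (fun x => propagator (l2_ n) x *m propagator (l1_ k) x).
  by apply/funext => x; rewrite propagator_cat.
have Cl : mC1 (propagator (l2_ n ++ l1_ k)) by rewrite E; exact: mC1_mul.
have l0 : durations_ge0 (l2_ n ++ l1_ k).
  by rewrite /durations_ge0 all_cat; apply/andP; split; [exact: l2|exact: l1].
have := @reach_exact M G _ l0 Cl; congr (reach _ _ _ _); apply/funext => x.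
  by rewrite propagator_cat mulmxA.
by rewrite E dmx_mul// mulmxDl mulmxDr !mulmxA addrA.
Qed.

(** The derivative of the target is existential: [steer_cell] composes rotations
whose angles are known only as H1 functions. *)
Definition steer M M' := forall G, mW M G -> exists2 G', mW M' G' & reach M G M' G'.

Lemma steer_trans M M1 M2 : steer M M1 -> steer M1 M2 -> steer M M2.
Proof.
move=> s1 s2 G WM; have [G1 WM1 r1] := s1 G WM; have [G2 WM2 r2] := s2 G1 WM1.
exists G2 => //; exact: reach_trans r1 r2.
Qed.

Lemma steer_eq M M' M'' : (forall x, a <= x <= b -> M' x = M'' x) -> steer M M' -> steer M M''.
Proof.
move=> MM s G WM; have [G' WM' r] := s G WM; exists G'.
  by move=> i j; apply: (eq_W ab _ _ (WM' i j)) => // x xab; rewrite MM.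
move=> e e0; have [l [l0 Cl hl]] := r e e0; exists l; split => // i.
by have [h1 h2] := hl i; split => // x xab; rewrite -MM//; exact: h1.
Qed.

(** The angle is approached in H1 by polynomials, for which the rotation is
attainable. *)
Lemma steer_rotation Om M f g :
  (forall p : {poly R}, attainable a b (fun w => rotation Om p.[w])) ->
  W f g -> steer M (fun x => rotation Om (f x) *m M x).
Proof.
move=> aOm Wf G WM; have [p_ cp] := W_wcvg ab Wf.
pose F' (i j : 'I_3) s := cos s * Om i j + sin s * (Om *m Om) i j.
have dF i j (s : R) : is_derive s 1 (fun s => rotation Om s i j) (F' i j s).
  rewrite (_ : (fun s => _) = (fun s => (1%:M : 'M[R]_3) i j + Om i j * sin s + (Om *m Om) i j * (1 - cos s))); last first.
    by apply/funext => t; rewrite /rotation /F'; move: (Om *m Om) => Om2; rewrite !mxE; ring.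
  by apply: is_derive_eq; rewrite /F' /GRing.scale/=; ring.
have cF' i j (s : R) : {for s, continuous (F' i j)}.
  by apply: cvgD; apply: cvgM; try exact: cvg_cst; [exact: continuous_cos|exact: continuous_sin].
pose D x := \matrix_(i, j) (F' i j (f x) * g x).
have cR : mcvg (fun n x => rotation Om (p_ n).[x]) (fun n => dmx (fun x => rotation Om (p_ n).[x]))
    (fun x => rotation Om (f x)) D.
  move=> i j; have := wcvg_comp ab (dF i j) (cF' i j) cp.
  apply: eq_wcvg => // [n|]; apply/funext => x; last by rewrite mxE.
  have d := (@is_derive1_comp _ (fun s => rotation Om s i j) _ _ _ _ (dF i j _) (is_derive_horner (p_ n) x)).
  by rewrite mxE derive1E (@derive_val _ _ _ _ _ _ _ d).
have c := mcvg_mul ab cR (mcvg_cst WM).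
exists (fun x => D x *m M x + rotation Om (f x) *m G x).
  by move=> i j; have [] := c i j.
by apply: (reach_lim WM c) => n; exact: reach_attainable.
Qed.

End Steering.

(** * Steering to the pole *)

Section Geometry.
Context {R : realType}.
Implicit Types (X Y : 'cV[R]_3) (Q : 'M[R]_3) (s x y z m : R).

Local Notation i0 := (@Ordinal 3 0 isT).
Local Notation i1 := (@Ordinal 3 1 isT).
Local Notation i2 := (@Ordinal 3 2 isT).

Definition dot X Y : R := \sum_i X i 0 * Y i 0.

Definition isometry Q := forall X Y, dot (Q *m X) (Q *m Y) = dot X Y.

Lemma sum3 (F : 'I_3 -> R) : \sum_i F i = F i0 + F i1 + F i2.
Proof.
rewrite !big_ord_recl big_ord0 addr0 addrA.
by congr (F _ + F _ + F _); exact: val_inj.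
Qed.

Lemma col3P X Y : X i0 0 = Y i0 0 -> X i1 0 = Y i1 0 -> X i2 0 = Y i2 0 -> X = Y.
Proof.
move=> h0 h1 h2; apply/matrixP => -[[|[|[|//]]] hi] j; rewrite ord1.
- by rewrite (_ : Ordinal hi = i0)//; exact: val_inj.
- by rewrite (_ : Ordinal hi = i1)//; exact: val_inj.
- by rewrite (_ : Ordinal hi = i2)//; exact: val_inj.
Qed.

Lemma isometry_mul Q1 Q2 : isometry Q1 -> isometry Q2 -> isometry (Q1 *m Q2).
Proof. by move=> h1 h2 X Y; rewrite -!mulmxA h1 h2. Qed.

Lemma rot_x_coord s X : [/\ (rotation Omega_x s *m X) i0 0 = X i0 0,
  (rotation Omega_x s *m X) i1 0 = cos s * X i1 0 - sin s * X i2 0 &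
  (rotation Omega_x s *m X) i2 0 = sin s * X i1 0 + cos s * X i2 0].
Proof. by rewrite rotation_xE; split; rewrite mxE sum3 !mxE/=; ring. Qed.

Lemma rot_y_coord s X : [/\ (rotation Omega_y s *m X) i0 0 = cos s * X i0 0 + sin s * X i2 0,
  (rotation Omega_y s *m X) i1 0 = X i1 0 &
  (rotation Omega_y s *m X) i2 0 = - sin s * X i0 0 + cos s * X i2 0].
Proof. by rewrite rotation_yE; split; rewrite mxE sum3 !mxE/=; ring. Qed.

Lemma isometry_rot_x s : isometry (rotation Omega_x s).
Proof.
move=> X Y; rewrite /dot !sum3.
have [-> -> ->] := rot_x_coord s X; have [-> -> ->] := rot_x_coord s Y.
have cs := cos2Dsin2 s.
transitivity (X i0 0 * Y i0 0 + (cos s ^+ 2 + sin s ^+ 2) * (X i1 0 * Y i1 0 + X i2 0 * Y i2 0)).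
  by ring.
by rewrite cs; ring.
Qed.

Lemma isometry_rot_y s : isometry (rotation Omega_y s).
Proof.
move=> X Y; rewrite /dot !sum3.
have [-> -> ->] := rot_y_coord s X; have [-> -> ->] := rot_y_coord s Y.
have cs := cos2Dsin2 s.
transitivity (X i1 0 * Y i1 0 + (cos s ^+ 2 + sin s ^+ 2) * (X i0 0 * Y i0 0 + X i2 0 * Y i2 0)).
  by ring.
by rewrite cs; ring.
Qed.

Lemma dot_e3 X : dot X e3 = X i2 0.
Proof. by rewrite /dot sum3 !mxE/=; ring. Qed.

Lemma unit_e3 X : dot X X = 1 -> X i0 0 = 0 -> X i1 0 = 0 -> 0 < X i2 0 -> X = e3.
Proof.
rewrite /dot sum3 => + x0 y0 z0; rewrite x0 y0 !mul0r !add0r => z1.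
apply: col3P; rewrite !mxE//=.
have /eqP : (X i2 0 - 1) * (X i2 0 + 1) = 0 by rewrite mulrBl !mulrDr z1; ring.
rewrite mulf_eq0 => /orP[]; first by rewrite subr_eq0 => /eqP.
by rewrite gt_eqF// ltr_wpDl// ltW.
Qed.

(** As [tan s = y / z], the rotation of angle [s] brings the point [(y, z)] to the
axis; its other coordinate becomes the norm of [(y, z)], which is at least [z]. *)
Lemma atan_cancel m y z : 0 < m -> m <= z -> let s := atan (y / z) in
  cos s * y - sin s * z = 0 /\ m <= sin s * y + cos s * z.
Proof.
move=> m0 mz s; have z0 : 0 < z := lt_le_trans m0 mz.
have c0 : 0 < cos s.
  by apply: cos_gt0_pihalf; rewrite atan_gtNpi2 atan_ltpi2.
have sc : sin s = cos s * (y / z).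
  by rewrite -(atanK (y / z)) -/s /tan mulrC divfK ?gt_eqF.
have h0 : cos s * y - sin s * z = 0.
  by rewrite sc; field; exact: lt0r_neq0.
split => //; set w := sin s * y + _.
have w0 : 0 < w.
  rewrite /w sc -[X in _ + X]mulrC addrC.
  apply: ltr_wpDr; last exact: mulr_gt0.
  by rewrite -mulrA mulr_ge0 ?(ltW c0)// mulrAC mulr_ge0 ?invr_ge0 ?(ltW z0)// -expr2 sqr_ge0.
have w2 : w ^+ 2 = y ^+ 2 + z ^+ 2.
  have cs := cos2Dsin2 s.
  transitivity ((cos s ^+ 2 + sin s ^+ 2) * (y ^+ 2 + z ^+ 2) - (cos s * y - sin s * z) ^+ 2).
    by rewrite /w; ring.
  by rewrite cs h0; ring.
rewrite (le_trans mz)// -(@ler_pXn2r _ 2)// ?nnegrE ?(ltW w0) ?(ltW z0)//.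
by rewrite w2 lerDr sqr_ge0.
Qed.

End Geometry.

Section SteeringToPole.
Context {R : realType} (a b : R) (ab : a < b).
Local Notation W := (W a b).
Local Notation mW := (mW a b).
Local Notation steer := (steer a b).
Implicit Types (M : R -> 'cV[R]_3) (c d m x : R).

Local Notation i0 := (@Ordinal 3 0 isT).
Local Notation i1 := (@Ordinal 3 1 isT).
Local Notation i2 := (@Ordinal 3 2 isT).

Lemma W_angle (y z : R -> R) gy gz m : 0 < m -> (forall x, a <= x <= b -> m <= z x) ->
  W y gy -> W z gz -> exists g, W (fun x => atan (y x / z x)) g.
Proof.
move=> m0 mz Wy Wz.
have dV t : 0 < t -> is_derive (t : R) 1 (fun t => t^-1) (- t ^- 2).
  by move=> t0; apply: is_derive_eq; [apply: is_deriveV; exact: lt0r_neq0|rewrite /GRing.scale/= mulr1].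
have cV t : 0 < t -> {for t, continuous (fun t : R => - t ^- 2)}.
  move=> t0; apply: cvgN; apply: cvgV; first by rewrite expf_neq0// lt0r_neq0.
  exact: exprn_continuous.
have Wr := W_mul ab Wy (W_comp ab m0 dV cV mz Wz).
have dA (t : R) : is_derive t 1 atan (1 + t ^+ 2)^-1 by exact: is_derive1_atan.
have cA (t : R) : {for t, continuous (fun t : R => (1 + t ^+ 2)^-1)}.
  apply: cvgV; first by rewrite lt0r_neq0// ltr_wpDr// sqr_ge0.
  by apply: cvgD; [exact: cvg_cst|exact: exprn_continuous].
have [_ WA _ _] := wcvg_comp ab dA cA (wcvg_cst Wr).
by exists (fun x => (1 + (y x / z x) ^+ 2)^-1 *
  (gy x * (z x)^-1 + y x * (- z x ^- 2 * gz x))).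
Qed.

Lemma clamp_itv c d x : c <= d -> c <= clamp c d x <= d.
Proof.
by move=> cd; rewrite /clamp le_max lexx/= ge_max cd ge_min lexx orbT.
Qed.

Lemma clamp_id c d x : c <= x <= d -> clamp c d x = x.
Proof. by move=> /andP[cx xd]; rewrite /clamp (min_idPl xd) (max_idPr cx). Qed.

(** A rotation about the first axis cancels the second coordinate, then a rotation
about the second axis cancels the first; neither decreases the third, by
[atan_cancel], so both angles are H1 functions. Evaluating the angles at
[clamp c d x] freezes them outside [[c, d]], where the rotation is thus constant. *)
Lemma steer_cell M G c d m : mW M G -> a <= c -> c <= d -> d <= b -> 0 < m ->
  (forall x, c <= x <= d -> m <= M x i2 0) ->
  (forall x, c <= x <= d -> dot (M x) (M x) = 1) ->
  exists Q, [/\ forall x, isometry (Q x),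
    steer M (fun x => Q (clamp c d x) *m M x) &
    forall x, c <= x <= d -> Q x *m M x = e3].
Proof.
move=> WM ac cd db m0 mM M1.
pose f x := atan (M x i1 0 / M x i2 0).
have [gf Wf] : exists g, W (fun x => f (clamp c d x)) g.
  apply: (W_angle m0 _ (W_clamp ab (WM i1 0) ac cd db) (W_clamp ab (WM i2 0) ac cd db)).
  by move=> x _; apply: mM; exact: clamp_itv.
have s1 := steer_rotation ab (M := M) (fun p => attainable_horner_x a b p) Wf.
have [G1 WM1 _] := s1 _ WM.
pose N x := rotation Omega_x (f x) *m M x.
pose g x := atan (- N x i0 0 / N x i2 0).
have mN x : c <= x <= d -> N x i1 0 = 0 /\ m <= N x i2 0.
  move=> xcd; have [_ -> ->] := rot_x_coord (f x) (M x).
  exact: (atan_cancel _ m0 (mM x xcd)).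
have NE x : N (clamp c d x) = rotation Omega_x (f (clamp c d (clamp c d x))) *m M (clamp c d x).
  by rewrite (@clamp_id _ _ (clamp _ _ _)) ?clamp_itv.
have [gg Wg] : exists gg, W (fun x => g (clamp c d x)) gg.
  have WNi i : exists h, W (fun x => N (clamp c d x) i 0) h.
    eexists; apply: (eq_W ab _ _ (W_clamp ab (WM1 i 0) ac cd db)) => [x _|x _].
      by rewrite NE.
    by [].
  have [h0 Wh0] := WNi i0; have [h2 Wh2] := WNi i2.
  have := W_angle m0 _ (W_mul ab (W_cst ab (-1)) Wh0) Wh2.
  move=> /(_ _)[|k Wk]; first by move=> x _; have [] := mN _ (clamp_itv x cd).
  by exists k; apply: (eq_W ab _ _ Wk) => // x _; rewrite /g mulN1r.
have s2 := steer_rotation ab (M := fun x => rotation Omega_x (f (clamp c d x)) *m M x)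
  (fun p => attainable_horner_y a b p) Wg.
exists (fun x => rotation Omega_y (g x) *m rotation Omega_x (f x)); split.
- by move=> x; apply: isometry_mul; [exact: isometry_rot_y|exact: isometry_rot_x].
- have := steer_trans ab s1 s2; apply: steer_eq => // x _.
  by rewrite mulmxA.
- move=> x xcd; rewrite -mulmxA -/(N x); have [N1 N2] := mN x xcd.
  have [h0 h1 h2] := rot_y_coord (g x) (N x).
  have [k0 k2] := @atan_cancel R m (- N x i0 0) (N x i2 0) m0 N2.
  apply: unit_e3.
  + by rewrite isometry_rot_y isometry_rot_x M1.
  + by rewrite h0; move: k0; rewrite -/(g x); lra.
  + by rewrite h1.
  + by rewrite h2; move: k2; rewrite -/(g x); lra.
Qed.

(** Some coordinate is nonzero; a half or quarter turn makes it the third one, with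
a positive sign. *)
Lemma steer_positive (X : 'cV[R]_3) : dot X X = 1 -> exists Q : 'M[R]_3,
  [/\ isometry Q, forall M, steer M (fun x => Q *m M x) & 0 < (Q *m X) i2 0].
Proof.
move=> X1.
have sx s M : steer M (fun x => rotation Omega_x s *m M x).
  exact: (steer_rotation ab (fun p => attainable_horner_x a b p) (W_cst ab s)).
have sy s M : steer M (fun x => rotation Omega_y s *m M x).
  exact: (steer_rotation ab (fun p => attainable_horner_y a b p) (W_cst ab s)).
have rx s : 0 < sin s * X i1 0 + cos s * X i2 0 -> exists Q : 'M[R]_3,
    [/\ isometry Q, forall M, steer M (fun x => Q *m M x) & 0 < (Q *m X) i2 0].
  move=> h; exists (rotation Omega_x s); split => //; first exact: isometry_rot_x.
  by have [_ _ ->] := rot_x_coord s X.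
have ry s : 0 < - sin s * X i0 0 + cos s * X i2 0 -> exists Q : 'M[R]_3,
    [/\ isometry Q, forall M, steer M (fun x => Q *m M x) & 0 < (Q *m X) i2 0].
  move=> h; exists (rotation Omega_y s); split => //; first exact: isometry_rot_y.
  by have [_ _ ->] := rot_y_coord s X.
have [z0|z0|z0] := ltgtP (X i2 0) 0.
- by apply: (rx pi); rewrite sinpi cospi; lra.
- by apply: (rx 0); rewrite sin0 cos0; lra.
have [y0|y0|y0] := ltgtP (X i1 0) 0.
- by apply: (rx (- (pi / 2))); rewrite sinN cosN sin_pihalf cos_pihalf; lra.
- by apply: (rx (pi / 2)); rewrite sin_pihalf cos_pihalf; lra.
have [x0|x0|x0] := ltgtP (X i0 0) 0.
- by apply: (ry (pi / 2)); rewrite sin_pihalf cos_pihalf; lra.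
- by apply: (ry (- (pi / 2))); rewrite sinN cosN sin_pihalf cos_pihalf; lra.
by move: X1; rewrite /dot sum3 x0 y0 z0 !mul0r !addr0 => /eqP; rewrite eq_sym oner_eq0.
Qed.

(** For unit vectors, [2 dot X Y = 2 - |X - Y| ^ 2]. *)
Lemma dot_close (X Y : 'cV[R]_3) : dot X X = 1 -> dot Y Y = 1 ->
  (forall i, `|X i 0 - Y i 0| <= 1 / 2) -> 1 / 2 <= dot X Y.
Proof.
move=> X1 Y1 h.
have sq i : (X i 0 - Y i 0) ^+ 2 <= 1 / 4.
  rewrite -real_normK ?num_real// (_ : 1 / 4 = (1 / 2) ^+ 2); last by field.
  by rewrite lerXn2r ?nnegrE// divr_ge0.
have := sq i0; have := sq i1; have := sq i2.
move: X1 Y1; rewrite /dot !sum3 => X1 Y1.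
nra.
Qed.

(** Induction over cells [[c k, c k.+1]] in which [M] varies little. When the state
is the pole on [[a, c k]], its third coordinate at a point [x] of the next cell is
its scalar product with its value at [c k]. This is the same as for [M], because
the rotations applied so far are constant on [[c k, b]]; it is therefore at least
1 / 2, and [steer_cell] applies. The points of [[a, c k]] then undergo the rotation
of the point [c k], which fixes the pole. *)
Lemma steer_e3 M G : mW M G -> (forall x, a <= x <= b -> dot (M x) (M x) = 1) ->
  steer M (cst e3).
Proof.
move=> WM M1.
have ba0 : 0 < b - a by rewrite subr_gt0.
have [d d0 Md] : exists2 d : R, 0 < d & forall x y, a <= x <= b -> a <= y <= b ->
    `|x - y| < d -> forall i, `|M x i 0 - M y i 0| <= 1 / 2.
  have h20 : (0 : R) < 1 / 2 by rewrite divr_gt0.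
  have /choice[d_ hd] (i : 'I_3) : exists d : R, 0 < d /\ forall x y, a <= x <= b -> a <= y <= b ->
      `|x - y| < d -> `|M x i 0 - M y i 0| <= 1 / 2.
    by have [d d0 hd] := W_uniform_continuous ab (WM i 0) h20; exists d.
  exists (\big[Num.min/1]_i d_ i).
    by apply: lt_bigmin => // i _; have [] := hd i.
  move=> x y xab yab xy i; have [_] := hd i; apply => //.
  by rewrite (lt_le_trans xy)// bigmin_le_cond.
pose N := (Num.truncn ((b - a) / d)).+1; pose h := (b - a) / N%:R.
have N0 : 0 < N%:R :> R by rewrite ltr0n.
have h0 : 0 < h by rewrite divr_gt0.
have hd : h < d by rewrite ltr_pdivrMr// mulrC -ltr_pdivrMr// truncnS_gt.
pose c (k : nat) : R := a + k%:R * h.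
have cS k : c k.+1 = c k + h by rewrite /c -natr1; ring.
have cN : c N = b by rewrite /c /h mulrC divfK ?lt0r_neq0// addrC subrK.
have ac k : a <= c k by rewrite lerDl mulr_ge0// ltW.
have cb k : (k <= N)%N -> c k <= b.
  by move=> kN; rewrite -cN /c lerD2l ler_wpM2r ?(ltW h0)// ler_nat.
have cell k x y : (k < N)%N -> c k <= x <= c k.+1 -> c k <= y <= c k.+1 -> 1 / 2 <= dot (M x) (M y).
  move=> kN /andP[cx xc] /andP[cy yc].
  have xab : a <= x <= b by rewrite (le_trans (ac k) cx) (le_trans xc)// cb.
  have yab : a <= y <= b by rewrite (le_trans (ac k) cy) (le_trans yc)// cb.
  apply: dot_close; [exact: M1|exact: M1|apply: Md => //].
  rewrite (le_lt_trans _ hd)// ler_norml.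
  by move: xc yc; rewrite cS => xc yc; apply/andP; split; lra.
have main k : (k <= N)%N -> exists M', [/\ steer M M',
    forall x, a <= x <= c k -> M' x = e3 &
    forall x y, c k <= x <= b -> c k <= y <= b -> dot (M' x) (M' y) = dot (M x) (M y)].
  elim: k => [_|k ih kN].
    (* in the degenerate cell [[a, a]], after a turn that makes the third coordinate
       of [M a] positive *)
    have aab : a <= a <= b by rewrite lexx ltW.
    have c0 : c 0%N = a by rewrite /c mul0r addr0.
    have [Q [iQ sQ Qa]] := steer_positive (M1 a aab).
    have [G1 WM1 _] := sQ M G WM.
    have [||Q2 [iQ2 sQ2 Q2e]] := @steer_cell (fun x => Q *m M x) G1 a a _ WM1 (lexx a) (lexx a) (ltW ab) Qa.
    - by move=> x /le_anti <-.
    - by move=> x /le_anti <-; rewrite iQ M1.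
    have cla x : clamp a a x = a by have := clamp_itv x (lexx a); move=> /le_anti.
    exists (fun x => Q2 (clamp a a x) *m (Q *m M x)); split.
    - exact: steer_trans (sQ M) sQ2.
    - by rewrite c0 => x /le_anti <-; rewrite cla; apply: Q2e; rewrite lexx.
    - by move=> x y _ _; rewrite !cla iQ2 iQ.
  have [M' [sM' e3M' dM']] := ih (ltnW kN).
  have [G' WM' _] := sM' G WM.
  have ckS : c k <= c k.+1 by rewrite cS lerDl ltW.
  have cSb := cb _ kN.
  have cell_ab x : c k <= x <= c k.+1 -> c k <= x <= b.
    by move=> /andP[-> xc]/=; exact: le_trans cSb.
  have h20 : (0 : R) < 1 / 2 by rewrite divr_gt0.
  have cke : M' (c k) = e3 by apply: e3M'; rewrite ac lexx.
  have ckc : c k <= c k <= c k.+1 by rewrite lexx.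
  have [||Q [iQ sQ Qe]] := @steer_cell M' G' (c k) (c k.+1) _ WM' (ac k) ckS cSb h20.
  - move=> x xc; rewrite -dot_e3 -cke dM'; [|exact: cell_ab|exact: cell_ab].
    exact: (cell k _ _ kN xc ckc).
  - move=> x xc; rewrite dM' ?cell_ab// M1//.
    by have /andP[cx ->] := cell_ab _ xc; rewrite (le_trans (ac k)).
  exists (fun x => Q (clamp (c k) (c k.+1) x) *m M' x); split.
  - exact: steer_trans sM' sQ.
  - move=> x /andP[ax xc]; have [cx|xck] := leP (c k) x.
      by rewrite clamp_id ?cx//; apply: Qe; rewrite cx.
    have -> : clamp (c k) (c k.+1) x = c k.
      by rewrite /clamp (min_idPl xc) (max_idPl (ltW xck)).
    by rewrite e3M' ?ax ?(ltW xck)// -cke Qe.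
  - move=> x y /andP[cx xb] /andP[cy yb].
    have clE z : c k.+1 <= z -> clamp (c k) (c k.+1) z = c k.+1.
      by move=> cz; rewrite /clamp (min_idPr cz) (max_idPr ckS).
    by rewrite !clE// iQ dM' ?xb ?yb ?(le_trans ckS).
have [M' [sM' e3M' _]] := main N (leqnn N).
by rewrite cN in e3M'; exact: (steer_eq ab e3M' sM').
Qed.

End SteeringToPole.

(** * From steering to weak convergence *)

Section AlmostEverywhere.
Context {R : realType} (a b : R) (ab : a < b).
Local Notation mu := (@lebesgue_measure R).
Local Notation I := (`]a, b[%classic : set (measurableTypeR R)).
Local Notation W := (W a b).
Local Notation mW := (mW a b).
Implicit Types (f g h : R -> R) (F G : R -> 'cV[R]_3).

Definition aeI f g := {ae mu, forall x, I x -> f x = g x}.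

Lemma aeI_Rintegral f g : measurable_fun I f -> measurable_fun I g -> aeI f g ->
  \int[mu]_(x in I) f x = \int[mu]_(x in I) g x.
Proof.
move=> mf mg fg; congr fine; apply: ae_eq_integral.
- exact: mI.
- exact/measurable_EFinP.
- exact/measurable_EFinP.
- by apply: filterS fg => x h Ix; rewrite h.
Qed.

Lemma aeI_n2 f g : measurable_fun I f -> measurable_fun I g -> aeI f g -> n2 I f = n2 I g.
Proof.
move=> mf mg fg; apply: aeI_Rintegral; [exact: measurable_funX|exact: measurable_funX|].
by apply: filterS fg => x h Ix; rewrite h.
Qed.

Lemma weak_derivative_ae f fc g : measurable_fun I f -> measurable_fun I fc -> aeI f fc ->
  weak_derivative a b fc g -> weak_derivative a b f g.
Proof.
move=> mf mfc ffc wfc phi tphi; rewrite -wfc//.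
have mphi : measurable_fun I (derive1 phi).
  have [dphi _ _] := tphi; apply: measurable_C1 => x _.
  by apply/differentiable_continuous/derivable1_diffP; exact: (dphi 1%N x).
apply: aeI_Rintegral; [exact: measurable_funM|exact: measurable_funM|].
by apply: filterS ffc => x h Ix; rewrite h.
Qed.

(** [f] is continuous, and a nonempty open interval is not negligible. *)
Lemma W_ae0 f g : W f g -> aeI f (cst 0) -> forall x, a <= x <= b -> f x = 0.
Proof.
move=> Wf f0 x xab; apply: contrapT => /eqP fx.
have e0 : 0 < `|f x| / 2 by rewrite divr_gt0// normr_gt0.
have [d d0 fd] := W_uniform_continuous ab Wf e0.
pose c := Num.max a (x - d); pose c' := Num.min b (x + d).
have cc : c < c'.
  have /andP[ax xb] := xab.
  by rewrite /c /c' lt_min !gt_max ab/=; apply/andP; split; [|apply/andP; split]; lra.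
have sub : `]c, c'[ `<=` [set y | ~ (I y -> f y = cst 0 y)].
  move=> y; rewrite /= in_itv/= /c /c' gt_max lt_min => /andP[/andP[ay xdy] /andP[yb yxd]] h.
  have fy : f y = 0 by apply: h; rewrite in_itv/= ay yb.
  have := fd x y xab; rewrite (ltW ay) (ltW yb) fy subr0 => /(_ isT).
  have -> : `|x - y| < d by rewrite ltr_norml; apply/andP; split; lra.
  move=> /(_ isT); lra.
have neg : mu.-negligible `]c, c'[ by apply: negligibleS f0 => y /sub.
have : mu `]c, c'[%classic = 0%E by apply/negligibleP.
rewrite lebesgue_measure_itv/= lte_fin cc -EFinD => -[] /eqP.
by rewrite subr_eq0 gt_eqF.
Qed.

Lemma H1_with_ae F (Fc : R -> 'cV[R]_3) G : (forall i, sqint I (fun x => F x i 0)) ->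
  (forall i, aeI (fun x => F x i 0) (fun x => Fc x i 0)) -> mW Fc G -> H1_with a b F G.
Proof.
move=> sF FFc WF i; split.
- exact: sqint_L2.
- by apply: sqint_L2; exact: (W_sqint (WF i 0)).
- apply: weak_derivative_ae (FFc i) (W_weak ab (WF i 0)).
    by have [] := sF i.
  exact: (W_measurable ab (WF i 0)).
Qed.

(** A bounded linear form is continuous for the H1 norm. *)
Lemma H1_norm_cvg_weakly (F : nat -> R -> 'cV[R]_3) F' (E : nat -> R -> 'cV[R]_3) :
  (forall n, H1 a b (F n)) -> H1 a b F' ->
  (forall n, H1_with a b (-1 *: F' + F n) (E n)) ->
  (forall e : R, 0 < e -> \forall n \near \oo, H1_norm a b (-1 *: F' + F n) (E n) <= e) ->
  weakly_cvg_H1 a b F F'.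
Proof.
move=> HF HF' HE FE; split => // l [ladd [C lC]].
apply/cvgrPdist_le => e e0.
have C0 : 0 < `|C| + 1 by rewrite ltr_wpDl.
near=> n.
have -> : l F' - l (F n) = - l (-1 *: F' + F n).
  by rewrite ladd// mulN1r opprD opprK.
rewrite normrN (le_trans (lC _ _ (HE n)))//.
have h : H1_norm a b (-1 *: F' + F n) (E n) <= e / (`|C| + 1).
  by near: n; apply: FE; exact: divr_gt0.
rewrite (@le_trans _ _ ((`|C| + 1) * (e / (`|C| + 1))))//.
  apply: (@le_trans _ _ ((`|C| + 1) * H1_norm a b (-1 *: F' + F n) (E n))).
    by rewrite ler_wpM2r ?sqrtr_ge0// (le_trans (ler_norm C))// lerDl.
  by rewrite ler_pM2l.
by rewrite mulrC divfK// lt0r_neq0.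
Unshelve. all: by end_near. Qed.

Lemma H1_norm_le (e : R) F G : 0 <= e ->
  (forall i, n2 I (fun x => F x i 0) <= e ^+ 2 / 6) ->
  (forall i, n2 I (fun x => G x i 0) <= e ^+ 2 / 6) -> H1_norm a b F G <= e.
Proof.
move=> e0 hF hG; rewrite /H1_norm -[leRHS](ger0_norm e0) -sqrtr_sqr ler_wsqrtr// sum3.
have -> : e ^+ 2 = (e ^+ 2 / 6 + e ^+ 2 / 6) + (e ^+ 2 / 6 + e ^+ 2 / 6) + (e ^+ 2 / 6 + e ^+ 2 / 6).
  by field.
by do ![apply: lerD]; [exact: hF|exact: hG|exact: hF|exact: hG|exact: hF|exact: hG].
Qed.

(** The H1 norm sees only the almost everywhere class of the states, so that the
convergence established from the continuous representative [M] holds from [M0]. *)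
Lemma reach_weakly (M0 M G0 M' G' : R -> 'cV[R]_3) (l_ : nat -> seq (R * R * R)) :
  (forall i, sqint I (fun x => M0 x i 0)) ->
  {ae mu, forall x, I x -> M0 x = M x} -> mW M G0 -> mW M' G' ->
  (forall n, mC1 (propagator (l_ n))) ->
  mcvg a b (fun n x => propagator (l_ n) x *m M x)
    (fun n x => dmx (propagator (l_ n)) x *m M x + propagator (l_ n) x *m G0 x) M' G' ->
  weakly_cvg_H1 a b (fun n x => propagator (l_ n) x *m M0 x) M'.
Proof.
move=> sM0 M0M WM WM' Cl cl.
pose F n x : 'cV[R]_3 := propagator (l_ n) x *m M0 x.
pose Fc n x : 'cV[R]_3 := propagator (l_ n) x *m M x.
pose D n x : 'cV[R]_3 := dmx (propagator (l_ n)) x *m M x + propagator (l_ n) x *m G0 x.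
have WF n : mW (Fc n) (D n) by move=> i j; have [h _ _ _] := cl i j; exact: h.
have sF n i : sqint I (fun x => F n x i 0).
  have sP j : sqint I (fun x => propagator (l_ n) x i j * M0 x j 0).
    have WP := mC1_mW ab (Cl n) i j; have [K _ PK] := W_bounded ab WP.
    exact: (sqintM (mI a b) (W_measurable ab WP) (fun x Ix => PK x (I_ab Ix)) (sM0 j)).
  have sum_sqint k (f : 'I_k -> R -> R) : (forall j, sqint I (f j)) -> sqint I (fun x => \sum_j f j x).
    elim: k f => [|k ih] f sf.
      have -> : (fun x => \sum_j f j x) = cst 0 by apply/funext => x; rewrite big_ord0.
      by apply: (@sqint_bounded _ _ _ 0 (mI a b) (muI ab)) => // x _; rewrite normr0.
    have -> : (fun x => \sum_j f j x) = (fun x => f ord0 x + \sum_j f (lift ord0 j) x).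
      by apply/funext => x; rewrite big_ord_recl.
    by apply: (sqintD (mI a b)) => //; exact: ih.
  have := sum_sqint _ _ sP; congr (sqint _ _).
  by apply/funext => x; rewrite mxE.
have FFc n i : aeI (fun x => F n x i 0) (fun x => Fc n x i 0).
  by apply: filterS M0M => x h Ix; rewrite /F h.
have sM' i : sqint I (fun x => M' x i 0).
  have [K _ K'] := W_bounded ab (WM' i 0).
  apply: (@sqint_bounded _ _ _ K (mI a b) (muI ab) (W_measurable ab (WM' i 0))).
  by move=> x /I_ab; exact: K'.
pose E n x : 'cV[R]_3 := - G' x + D n x.
have dFE n x i : (-1 *: M' + F n) x i 0 = F n x i 0 - M' x i 0.
  by rewrite !mxE mulN1r addrC.
have EE n x i j : E n x i j = D n x i j - G' x i j.
  by rewrite /E; move: (D n x) => d; rewrite !mxE addrC.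
have sdF n i : sqint I (fun x => (-1 *: M' + F n) x i 0).
  have := sqintB (mI a b) (sF n i) (sM' i); congr (sqint _ _).
  by apply/funext => x; rewrite dFE.
have WE n : mW (fun x => Fc n x - M' x) (E n).
  move=> i j; have := W_add ab (WF n i j) (W_mul ab (W_cst ab (-1)) (WM' i j)).
  apply: (eq_W ab) => x _; first by rewrite !mxE mulN1r.
  by rewrite EE mul0r add0r mulN1r.
have dFFc n i : aeI (fun x => (-1 *: M' + F n) x i 0) (fun x => (Fc n x - M' x) i 0).
  by apply: filterS (FFc n i) => x h Ix; rewrite dFE h// !mxE.
apply: (@H1_norm_cvg_weakly _ _ E).
- by move=> n; exists (D n); exact: (H1_with_ae (sF n) (FFc n) (WF n)).
- by exists G'; apply: (H1_with_ae sM' _ WM') => i; apply: nearW.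
- by move=> n; exact: (H1_with_ae (sdF n) (dFFc n) (WE n)).
move=> e e0; have e60 : 0 < e ^+ 2 / 6 by rewrite divr_gt0// exprn_gt0.
have : \forall n \near \oo, forall i : 'I_3, n2 I (fun x => (-1 *: M' + F n) x i 0) <= e ^+ 2 / 6
    /\ n2 I (fun x => E n x i 0) <= e ^+ 2 / 6.
  apply: filter_forall => i; have [_ _ cu cd] := cl i 0.
  have cu' := ucvg_lcvg ab (fun n => W_measurable ab (WF n i 0)) (W_measurable ab (WM' i 0)) cu.
  apply: filterS2 (cu' _ e60) (cd _ e60) => n h1 h2; split.
    rewrite (aeI_n2 _ _ (dFFc n i)).
    - by rewrite (@eq_n2 _ _ _ (fun x => Fc n x i 0 - M' x i 0))// => x _; rewrite !mxE.
    - by have [] := sdF n i.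
    - exact: (W_measurable ab (WE n i 0)).
  by rewrite (@eq_n2 _ _ _ (fun x => D n x i 0 - G' x i 0))// => x _; rewrite EE.
by apply: filterS => n h; apply: H1_norm_le => [|i|i]; [exact: ltW|have [] := h i|have [] := h i].
Qed.

(** The continuous representatives of the coordinates form a vector of norm 1 almost
everywhere, hence everywhere on [[a, b]] by [W_ae0]. *)
Lemma H1_S2_representative F : H1_S2 a b F -> exists M G,
  [/\ mW M G, {ae mu, forall x, I x -> F x = M x} &
      forall x, a <= x <= b -> dot (M x) (M x) = 1].
Proof.
move=> [[G HF] SF].
have /choice[fc hfc] (i : 'I_3) : exists fc : R -> R, W fc (fun x => G x i 0) /\
    aeI (fun x => F x i 0) fc.
  have [h1 h2 h3] := HF i.
  by have [fc Wfc Ffc] := weak_derivative_W ab (L2_sqint h1) (L2_sqint h2) h3; exists fc.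
pose M x : 'cV[R]_3 := \col_i fc i x.
have WM : mW M G.
  move=> i j; rewrite ord1; have [Wfc _] := hfc i.
  by apply: (eq_W ab _ _ Wfc) => // x _; rewrite mxE.
have FM : {ae mu, forall x, I x -> F x = M x}.
  have : {ae mu, forall x, forall i, I x -> F x i 0 = M x i 0}.
    apply: filter_forall => i; have [_] := hfc i.
    by apply: filterS => x h Ix; rewrite mxE h.
  by apply: filterS => x h Ix; apply/matrixP => i j; rewrite ord1; exact: h.
exists M, G; split => // x xab.
have [_ Wd _ _] := wcvg_sum ab (fun i => wcvg_mul ab (wcvg_cst (WM i 0)) (wcvg_cst (WM i 0))).
have h := W_ae0 (W_add ab Wd (W_cst ab (-1))).
apply/eqP; rewrite -subr_eq0; apply/eqP; apply: h xab.
apply: filterS FM => y Fy Iy /=.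
have := SF y; rewrite inE => /(_ Iy); rewrite /S2/= Fy// => <-.
by apply/eqP; rewrite subr_eq0; apply/eqP/eq_bigr => i _; rewrite expr2.
Qed.

End AlmostEverywhere.

Theorem corollary1 (R : realType) (a b : R) (hab : a < b)
    (M0 : R -> 'cV[R]_3) (hM0 : H1_S2 a b M0) :
  exists (t : nat -> R) (u v : nat -> R -> R) (U : nat -> R -> R -> 'cV[R]_3),
    [/\ forall n, 0 <= t n,
        forall n, Linfty_loc (u n) /\ Linfty_loc (v n),
        forall n, bloch_solution a b (u n) (v n) M0 (U n) &
        weakly_cvg_H1 a b (fun n => U n (t n)) (cst e3)].
Proof.
have [M [G0 [WM M0M M1]]] := H1_S2_representative hab hM0.
have [G WG rG] := steer_e3 hab WM M1 WM.
have [l_ [l0 Cl cl]] := reach_seq hab WM WG rG.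
have /choice[T hT] n : exists T, exists u v U, [/\ 0 <= T, admissible_control u /\ admissible_control v,
    bloch_solution a b u v M0 U & forall w, U T w = propagator (l_ n) w *m M0 w].
  exact: realization.
have /choice[u hu] := hT; have /choice[v hv] := hu; have /choice[U hU] := hv.
exists T, u, v, U; split.
- by move=> n; have [] := hU n.
- move=> n; have [_ [[mu_ [K uK]] [mv [K' vK]]] _ _] := hU n.
  by split; [exact: bounded_Linfty_loc uK|exact: bounded_Linfty_loc vK].
- by move=> n; have [] := hU n.
have -> : (fun n => U n (T n)) = (fun n w => propagator (l_ n) w *m M0 w).
  by apply/funext => n; apply/funext => w; have [_ _ _ ->] := hU n.
apply: (reach_weakly hab _ M0M WM WG Cl cl) => i.
by have [[G' /(_ i)[L _ _]] _] := hM0; exact: L2_sqint.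
Qed.
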